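(* Let $k\ge1$ and let $\mathsf S_k^{\mathrm{mid}}$ be the matrix, indexed by $i,j\in[\![1,k']\!]$, of the de Rham intersection pairing on $\mathrm H^1_{\mathrm{dR,mid}}(\mathbb G_m,\mathrm{Sym}^k\mathrm{Kl}_2)$ with respect to the basis $(\omega_i')_{i\in[\![1,k']\!]}$. Then $\mathsf S_k^{\mathrm{mid}}$ is lower-right triangular (i.e. the entries $(i,j)$ are zero if $i+j\le k'$) and the anti-diagonal entry (i.e. $i+j=k'+1$) on the $i$-th row is equal to $$\begin{cases}(-2)^{k'}\,\dfrac{k'!}{k!!}&\text{if $k$ is odd},\\[6pt] \dfrac{(-1)^{k'+1}}{2^{k'}(k'+1-2i)}\cdot\dfrac{(k-1)!!}{(k'+1)!}&\text{if $k$ is even}.\end{cases}$$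
   Context: $k\ge1$ is an integer, $k'=\lfloor(k-1)/2\rfloor$, $[\![1,k']\!]=\{1,\dots,k'\}$ if $4\nmid k$ and $[\![1,k']\!]=\{1,\dots,k'\}\setminus\{k/4\}$ if $4\mid k$. $m!=m!!=1$ for $m\le0$. $I_0,K_0$ are the modified Bessel functions of order zero. On $\mathbb G_m=\mathrm{Spec}\,\mathbb C[z,z^{-1}]$, $\mathrm{Kl}_2$ is the free $\mathbb C[z^{\pm1}]$-module with basis $v_0,v_1$ and connection $z\nabla_{\partial_z}v_0=v_1$, $z\nabla_{\partial_z}v_1=zv_0$. $\mathrm{Sym}^k\mathrm{Kl}_2$ is the $\mathfrak S_k$-invariant part of $\mathrm{Kl}_2^{\otimes k}$, with basis $u_a=v_0^{k-a}v_1^a$ ($0\le a\le k$; average over $\mathfrak S_k$ of the corresponding tensor). It carries the flat pairing $\langle u_a,u_b\rangle_{\mathrm{alg}}=(-1)^a\frac{a!\,b!}{k!}$ if $a+b=k$, and $0$ otherwise. $\mathrm H^1_{\mathrm{dR}}(\mathbb G_m,\mathrm{Sym}^k\mathrm{Kl}_2)=\mathrm{coker}\,\nabla$. Elements of $\mathrm H^1_{\mathrm{dR,c}}$ are represented by pairs $(\widehat m,\eta)$, $\eta$ a global section of $\Omega^1_{\mathbb G_m}\otimes\mathrm{Sym}^k\mathrm{Kl}_2$ and $\widehat m=(\widehat m_0,\widehat m_\infty)$ in the formalizations of $\mathrm{Sym}^k\mathrm{Kl}_2$ at $0$ and $\infty$ (over $\mathbb C((z))$ and $\mathbb C((1/z))$),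 with $\widehat\nabla\widehat m=\widehat\eta$ (modulo pairs $(\widehat m,\nabla m)$ coming from global sections $m$). $\mathrm H^1_{\mathrm{dR,mid}}$ is the image of $\mathrm H^1_{\mathrm{dR,c}}\to\mathrm H^1_{\mathrm{dR}}$, $(\widehat m,\eta)\mapsto\eta$. The de Rham intersection pairing on $\mathrm H^1_{\mathrm{dR,mid}}$ is $([\eta],[\omega])\mapsto\mathrm{Res}_{z=0}\langle\widehat m_0,\omega\rangle_{\mathrm{alg}}+\mathrm{Res}_{z=\infty}\langle\widehat m_\infty,\omega\rangle_{\mathrm{alg}}$, with $(\widehat m,\eta)$ any lift of $[\eta]$. Put $\omega_i=[z^iv_0^k\,dz/z]$. If $4\mid k$, with $w=1/z=4/t^2$, write the asymptotic expansion at $t\to+\infty$ as $2^k(I_0(t)K_0(t))^{k/2}\sim w^{k/4}\sum_{j\ge0}\gamma_{k,k/4+j}w^j$ and set $\gamma_{k,i}=0$ for integers $i<k/4$; if $4\nmid k$ set $\gamma_{k,i}=0$ for all $i$. For $i\in[\![1,k']\!]$, $\omega_i'=\omega_i-\gamma_{k,i}\omega_{k/4}$ (so $\omega'_i=\omega_i$ if $4\nmid k$, or if $4\mid k$ and $i<k/4$). The family $(\omega_i')_{i\in[\![1,k']\!]}$ is a basis of $\mathrm H^1_{\mathrm{dR,mid}}$. *)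

(* Defs.v *)
From HB Require Import structures.
From mathcomp Require Import all_boot all_order all_algebra all_fingroup.
From mathcomp Require Import complex.
From mathcomp Require Import all_classical all_reals all_analysis.
Set Implicit Arguments.
Unset Strict Implicit.
Unset Printing Implicit Defensive.
Import Order.TTheory GRing.Theory Num.Theory.
Import numFieldNormedType.Exports.
Local Open Scope classical_set_scope.
Local Open Scope ring_scope.

Fixpoint dfact (n : nat) : nat := if n is m.+2 then (n * dfact m)%N else 1%N.

(* Truncation is harmless for k >= 1, where this is floor((k-1)/2). *)
Definition kprime (k : nat) : nat := (k.-1)./2.

Definition in_idx (k i : nat) : bool :=
  [&& (1 <= i)%N, (i <= kprime k)%N & ~~ ((4 %| k)%N && (i == k %/ 4)%N)].

Section Bessel.
Variable R : realType.

Definition besselI0 (t : R) : R :=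
  limn (series (fun n : nat => (t / 2) ^+ (2 * n) / (n`!)%:R ^+ 2)).

(* K_0(t) = int_0^oo exp(- t cosh u) du, valid for t > 0. *)
Definition besselK0 (t : R) : R :=
  \int[@lebesgue_measure R]_(u in `[0, +oo[)
     expR (- t * ((expR u + expR (- u)) / 2)).

(* Poincare expansion of 2^k (I_0 K_0)^(k/2) at t -> +oo in powers of
   w = 4/t^2; only used when 4 %| k, so that k/2 and k/4 are naturals.
   [c j] is the coefficient of w^(k/4+j). *)
Definition IK_expansion (k : nat) (c : nat -> R) : Prop :=
  forall N : nat,
    (2 ^+ k * (besselI0 t * besselK0 t) ^+ (k %/ 2)
     - (4 / t ^+ 2) ^+ (k %/ 4) * \sum_(j < N.+1) c j * (4 / t ^+ 2) ^+ j)
    / (4 / t ^+ 2) ^+ (k %/ 4 + N) @[t --> +oo] --> (0 : R).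

Definition is_gamma (k : nat) (gamma : nat -> R) : Prop :=
  if (4 %| k)%N then
    IK_expansion k (fun j => gamma (k %/ 4 + j)%N)
    /\ (forall i, (i < k %/ 4)%N -> gamma i = 0)
  else forall i, gamma i = 0.

End Bessel.

Section DeRham.
Variable R : realType.
Local Notation C := (R[i]).

(* [f n] is the coefficient of z^n.  Laurent polynomials and the two kinds of
   formal Laurent series are all two-sided series with a support condition, so
   that passing from global sections to formalizations is the identity. *)
Definition zseries := int -> C.

(* C((z)) *)
Definition formal0 (f : zseries) : Prop :=
  exists N : int, forall n : int, n < N -> f n = 0.
(* C((1/z)) *)
Definition formaloo (f : zseries) : Prop :=
  exists N : int, forall n : int, N < n -> f n = 0.
(* C[z, 1/z] *)
Definition laurent (f : zseries) : Prop := formal0 f /\ formaloo f.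

(* The sum has finite support when f is in C((z)) or C((1/z)) and g is a
   Laurent polynomial, the only case in which it is used. *)
Definition zmul (f g : zseries) : zseries :=
  fun n => \sum_(l \in [set: int]) f l * g (n - l).

Definition zshift (i : int) (f : zseries) : zseries := fun n => f (n - i).

(* f dz/z has residue f_0 at z = 0, and - f_0 at z = oo since
   dz/z = - dw/w for w = 1/z. *)
Definition res0 (f : zseries) : C := f 0.
Definition resoo (f : zseries) : C := - f 0.

(* Kl_2 with z nabla v_0 = v_1 and z nabla v_1 = z v_0; the index of v_0 is
   [false], that of v_1 is [true].  [kl2_conn c b f] is the coefficient of v_c
   in f * (z nabla_{d/dz} v_b). *)
Definition kl2_conn (c b : bool) (f : zseries) : zseries :=
  match c, b with
  | true, false => f
  | false, true => zshift 1 f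
  | _, _ => fun _ => 0
  end.

Section Sym.
Variable k : nat.

Local Notation word := ({ffun 'I_k -> bool}).

(* The element sum_e m_e v_{e_0} (x) ... (x) v_{e_{k-1}} of the k-th tensor
   power of Kl_2, with coefficients two-sided series. *)
Definition tens := word -> zseries.

Definition upd (e : word) (j : 'I_k) (b : bool) : word :=
  [ffun i => if i == j then b else e i].

(* z nabla_{d/dz} on the tensor power: z d/dz on coefficients plus the Leibniz
   rule over the k factors. *)
Definition nabla (m : tens) : tens := fun e n =>
  n%:~R * m e n
  + \sum_(j < k) \sum_(b : bool) kl2_conn (e j) b (m (upd e j b)) n.

Definition tens_act (s : 'S_k) (m : tens) : tens :=
  fun e => m [ffun i => e (s i)].

(* Sections of Sym^k Kl_2 with coefficients satisfying P.  One-forms are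
   represented by their coefficient of dz/z, so that [nabla] is the connection
   with values in one-forms. *)
Definition symsec (P : zseries -> Prop) : set tens :=
  [set m | (forall e, P (m e)) /\ (forall s, tens_act s m = m)].

(* v_0^{(x)(k-a)} (x) v_1^{(x)a} *)
Definition std_word (a : nat) : word := [ffun i : 'I_k => (k - a <= i)%N].

Definition basis_tens (w : word) : tens :=
  fun e n => ((e == w) && (n == 0))%:R.

(* u_a = v_0^{k-a} v_1^a, the average of the orbit under 'S_k *)
Definition sym_u (a : nat) : tens := fun e n =>
  (k`!)%:R^-1 * \sum_(s : 'S_k) tens_act s (basis_tens (std_word a)) e n.

Definition weight (e : word) : nat := (\sum_(i < k) e i)%N.

(* The u_a-coordinate of a symmetric tensor; see [sym_coord_u] and
   [sym_coordP]. *)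
Definition sym_coord (m : tens) (a : nat) : zseries :=
  fun n => \sum_(e : word | weight e == a) m e n.

Lemma weight_std_word a : (a <= k)%N -> weight (std_word a) = a.
Proof.
move=> ak; rewrite /weight.
under eq_bigr do rewrite ffunE.
rewrite -(big_mkord predT (fun i => nat_of_bool (k - a <= i)%N)).
rewrite (big_cat_nat (n := (k - a)%N)) ?leq_subr//=.
rewrite [X in (X + _)%N]big_nat_cond big1 ?add0n; last first.
  by move=> i /andP[/andP[_ +] _]; rewrite ltnNge => /negbTE ->.
rewrite (@eq_big_nat _ _ _ _ _ _ (fun=> 1%N)); last by move=> i /andP[->].
by rewrite sum_nat_const_nat muln1 subKn.
Qed.

Lemma weight_le (e : word) : (weight e <= k)%N.
Proof.
rewrite /weight -[leqRHS]card_ord -sum1_card.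
by apply: leq_sum => i _; case: (e i).
Qed.

Lemma weight_perm (s : 'S_k) (e : word) :
  weight [ffun i => e (s i)] = weight e.
Proof.
rewrite /weight [RHS](reindex_inj (@perm_inj _ s)) /=.
by apply: eq_bigr => i _; rewrite ffunE.
Qed.

Lemma weight_trans (e e' : word) : weight e = weight e' ->
  exists s : 'S_k, e' = [ffun i => e (s i)].
Proof.
have wE (f : word) : count_mem true [tuple f i | i < k] = weight f.
  rewrite /weight -sum1_count big_map big_mkcond /= big_enum /=.
  by apply: eq_bigr => i _; case: (f i).
move=> we; have : perm_eq [tuple e' i | i < k] [tuple e i | i < k].
  have c0 (t : k.-tuple bool) : count_mem false t = (k - count_mem true t)%N.
    have := count_predC (pred1 true) t; rewrite size_tuple.
    have /eq_count -> : predC (pred1 true) =1 pred1 false by case.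
    by move=> h; apply/esym/(canLR (addKn _)); rewrite h.
  have h b : count_mem b [tuple e' i | i < k]
             = count_mem b [tuple e i | i < k].
    by case: b; rewrite ?c0 !wE we.
  by apply/allP => b _; apply/eqP/h.
case/tuple_permP => s es; exists s; apply/ffunP => i; rewrite ffunE.
have /(congr1 (fun t : k.-tuple bool => tnth t i)) := val_inj es.
by rewrite !tnth_mktuple.
Qed.

Lemma sym_coord_u (a b : nat) : (a <= k)%N ->
  sym_coord (sym_u a) b = fun n => ((b == a) && (n == 0))%:R.
Proof.
move=> ak; apply/funext => n; rewrite /sym_coord /sym_u -mulr_sumr exchange_big /=.
rewrite (eq_bigr (fun=> ((b == a) && (n == 0))%:R)); last first.
  move=> s _; pose e0 : word := [ffun i => std_word a ((s^-1)%g i)].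
  have e0s (e : word) : ([ffun i => e (s i)] == std_word a) = (e == e0).
    rewrite /e0; move: (std_word a) => w.
    by apply/eqP/eqP => [<-|->]; apply/ffunP => i; rewrite !ffunE ?permKV ?permK.
  rewrite /tens_act /basis_tens.
  under eq_bigr do rewrite e0s.
  have we0 : weight e0 = a by rewrite weight_perm weight_std_word.
  case: (eqVneq b a) => [->|ba] /=.
    rewrite (bigD1 e0) ?we0 ?eqxx//= big1 ?addr0// => e /andP[_ /negbTE ->].
    by [].
  apply: big1 => e /eqP we; case: eqP => // ee; move: ba.
  by rewrite -we ee we0 eqxx.
by rewrite sumr_const card_Sn -[X in _ * X = _]mulr_natl mulKf// pnatr_eq0 -lt0n fact_gt0.
Qed.

Lemma tens_act_sym_u (s : 'S_k) a : tens_act s (sym_u a) = sym_u a.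
Proof.
apply/funext => e; apply/funext => n; rewrite /tens_act /sym_u; congr (_ * _).
rewrite [RHS](reindex_inj (mulIg s)) /=; apply: eq_bigr => t _.
by rewrite /tens_act; congr basis_tens; apply/ffunP => i; rewrite !ffunE permM.
Qed.

Lemma sym_coordP (m : tens) : (forall s, tens_act s m = m) ->
  forall e n,
    m e n = \sum_(a < k.+1) sym_coord m a n * sym_u a e 0.
Proof.
have const (p : tens) : (forall s, tens_act s p = p) ->
    forall e n, sym_coord p (weight e) n
                = p e n *+ #|[pred f : word | weight f == weight e]|.
  move=> ps e n; rewrite /sym_coord -sumr_const; apply: eq_bigr => f /eqP wf.
  by have [s ->] := weight_trans wf; rewrite -[in LHS](ps s).
move=> ms e n.
have we : (weight e < k.+1)%N by rewrite ltnS weight_le.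
rewrite (bigD1 (Ordinal we)) //= big1 ?addr0 => [|a ae].
  have := const _ (fun s => tens_act_sym_u s (weight e)) e 0.
  rewrite sym_coord_u ?weight_le// !eqxx /= => u1.
  by rewrite const// mulrnAl -mulrnAr -u1 mulr1.
have := const _ (fun s => tens_act_sym_u s a) e 0.
rewrite sym_coord_u -1?ltnS// (_ : (weight e == a) = false) /=; last first.
  by apply: contraNF ae => /eqP h; apply/eqP/val_inj; rewrite /= h.
move/esym/eqP; rewrite mulrn_eq0 => /orP[|/eqP ->]; last by rewrite mulr0.
by move=> /eqP/card0_eq/(_ e); rewrite !inE eqxx.
Qed.

Definition u_pairing (a b : nat) : C :=
  if (a + b == k)%N then (-1) ^+ a * (a`! * b`!)%:R / (k`!)%:R else 0.

Definition alg_pairing (m p : tens) : zseries := fun n =>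
  \sum_(a < k.+1) \sum_(b < k.+1)
    u_pairing a b * zmul (sym_coord m a) (sym_coord p b) n.

(* The class of eta in H^1_dR = coker nabla, as a coset. *)
Definition dR_class (eta : tens) : set tens :=
  [set eta' | symsec laurent eta' /\
     exists m, symsec laurent m /\
       forall e n, eta' e n = eta e n + nabla m e n].

(* Representatives ((m0, moo), eta) of elements of H^1_{dR,c}. *)
Definition dRc_rep (m0 moo eta : tens) : Prop :=
  [/\ symsec formal0 m0, symsec formaloo moo, symsec laurent eta,
      nabla m0 = eta & nabla moo = eta].

Definition H1_mid : set (set tens) :=
  [set a | exists m0 moo eta, dRc_rep m0 moo eta /\ a = dR_class eta].

Definition dR_pairing_value (a b : set tens) : set C :=
  [set c | exists m0 moo eta omega,
     [/\ dRc_rep m0 moo eta, a = dR_class eta,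
         symsec laurent omega, b = dR_class omega &
         c = res0 (alg_pairing m0 omega) + resoo (alg_pairing moo omega)]].

(* The intersection pairing on H^1_{dR,mid} (where the value does not depend on
   the lift nor on the representatives); 0 outside of H^1_{dR,mid}. *)
Definition dR_mid_pairing (a b : set tens) : C :=
  if `[< H1_mid a /\ H1_mid b >] then xget 0 (dR_pairing_value a b) else 0.

(* z^i v_0^k dz/z *)
Definition omega_form (i : nat) : tens := fun e => zshift i%:Z (sym_u 0 e).

Definition omega'_form (gamma : nat -> R) (i : nat) : tens := fun e n =>
  omega_form i e n - (gamma i)%:C%C * omega_form (k %/ 4) e n.

Definition S_mid (gamma : nat -> R) (i j : nat) : C :=
  dR_mid_pairing (dR_class (omega'_form gamma i))
                 (dR_class (omega'_form gamma j)).

End Sym.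
End DeRham.

(* Main.v *)
Require Import Defs.
From HB Require Import structures.
From mathcomp Require Import all_boot all_order all_algebra all_fingroup.
From mathcomp Require Import complex.
From mathcomp Require Import all_classical all_reals all_analysis.
From mathcomp Require Import measurable_realfun.
From mathcomp Require Import ring lra zify.
Set Implicit Arguments.
Unset Strict Implicit.
Unset Printing Implicit Defensive.
Import Order.TTheory GRing.Theory Num.Theory.
Local Open Scope ring_scope.

(** The pairing of a middle class with z^j v_0^k dz/z only sees the last
    coordinate (that of v_1^k) of the two primitives m_0 and m_oo of the first
    class: it is (-1)^k times the coefficient of z^(-j) in the difference of
    these coordinates.  The primitive at 0 has no negative powers of z, so the
    whole intersection matrix is read off from the last coordinate s of the
    primitive at infinity.

    The coordinate s determines the section.  The equations of nabla m = eta at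
    v_0^(k-a) v_1^a with a >= 1 express the other coordinates through s, and
    the equation at v_0^k becomes a scalar recurrence, the one of the
    differential operator that annihilates products of k Bessel functions
    ([bessel_op], [bessel_op_of_section]).  Put K = k' + 1.  At infinity this
    recurrence expresses the right hand side at z^n through s at z^(n-K) and
    higher powers, with a leading coefficient ([lead_oo]) equal to
    (-1)^K (k!!)^2 for k odd and to (-1)^K 4^K (K!)^2 (n - K/2) for k = 2K; the
    latter comes from the identity sum_i C(2i,i) C(2(K-i),K-i) = 4^K.  For the
    form z^i v_0^k dz/z the series s therefore starts at z^(i-K), with
    coefficient the inverse of the leading coefficient up to the factor
    (-1)^k k!.  This is the triangular shape, and the anti-diagonal.

    When 4 divides k the leading coefficient vanishes at n = k/4, where a flat
    section lives.  This has two consequences.  First, s is no longer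
    unique; its coefficients of z^(-j) with j < k/4 still are, and the entries
    with j > k/4 follow by skew-symmetry of the pairing ([spair_skew]), since
    then i < k/4.  Second, the primitive at infinity exists only for
    z^i - c z^(k/4) with a suitable constant c, and c = gamma_i has to be shown
    ([residue_eq_gamma]).  Pairing a truncation of the formal primitive with
    the product of k/2 solutions of the Bessel equation of type I_0 and k/2 of
    type K_0 gives a function with a power asymptotics in t, whose image under
    z d/dz is (I_0 K_0)^(k/2) (z^i - c z^(k/4)) up to o(1).  A constant term
    there would integrate to a logarithm ([no_constant_term]), so
    gamma_i - c gamma_(k/4) = 0; and gamma_(k/4) = 1 because I_0 K_0 ~ 1/(2t).

    The power asymptotics rest on the logarithmic derivatives p of I_0 and r
    of K_0, which solve the same Riccati equation q' = 1 - q^2 - q/t; near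
    p = 1 it attracts the solutions, near r = -1 it repels them but r stays
    bounded, so both follow a formal solution to every order
    ([riccati_attracting], [riccati_repelling]).  The Wronskian then gives
    I_0 K_0 = 1 / (t (p - r)) ([I0K0E]). *)

(** * Central binomial coefficients *)

(** The recurrence (l+1) C(2l+2,l+1) = 2(2l+1) C(2l,l) makes the convolution
    identity below an induction on K. *)
Lemma nat_central_binS l :
  (l.+1 * 'C(l.+1.*2, l.+1) = (l.*2.+1).*2 * 'C(l.*2, l))%N.
Proof.
apply/eqP; rewrite -(eqn_pmul2l (ltn0Sn l)) doubleS -mul_bin_diag /=.
have -> : 'C(l.*2.+1, l) = 'C(l.*2.+1, l.+1).
  by rewrite -bin_sub; [congr 'C(_, _)|]; lia.
have := mul_bin_diag l.*2.+1 l; rewrite /=; nia.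
Qed.

Section CentralBinomials.
Variable F : numFieldType.

Definition central_bin l : F := ('C(l.*2, l))%:R.

Lemma central_binS l : l.+1%:R * central_bin l.+1 = (4 * l%:R + 2) * central_bin l.
Proof.
by rewrite /central_bin -natrM nat_central_binS -!muln2 -addn1 !natrM natrD natrM; ring.
Qed.

(** Symmetry under i <-> K - i: the index has mean K/2 for the weights
    C(2i,i) C(2(K-i),K-i). *)
Lemma central_bin_conv_moment K : 2 * (\sum_(i < K.+1) i%:R * (central_bin i *
  central_bin (K - i)))
  = K%:R * \sum_(i < K.+1) central_bin i * central_bin (K - i).
Proof.
rewrite mulr_natl mulr2n {2}(reindex_inj rev_ord_inj) -big_split mulr_sumr /=.
apply: eq_bigr => i _.
have iK : (i <= K)%N by rewrite -ltnS.
by rewrite subSS subKn// natrB//; ring.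
Qed.

(** Multiplying the (K+1)-st sum by (K+1)/2 replaces its weights by
    i C(2i,i) = (4(i-1)+2) C(2(i-1),i-1), which brings back the K-th sum and its
    first moment. *)
Lemma central_bin_conv K : \sum_(i < K.+1) central_bin i * central_bin (K - i) = 4 ^+ K.
Proof.
elim: K => [|K IH]; first by rewrite big_ord1 /central_bin bin0 mulr1.
have K0 : K.+1%:R != 0 :> F by rewrite pnatr_eq0.
apply: (mulfI K0); rewrite -central_bin_conv_moment big_ord_recl mul0r add0r.
under eq_bigr => i _ do rewrite lift0 subSS mulrA central_binS -mulrA.
rewrite (eq_bigr (fun i : 'I_K.+1 => 4 * (i%:R * (central_bin i * central_bin (K - i)))
   + 2 * (central_bin i * central_bin (K - i)))); last first.
  by move=> i _; ring.
rewrite big_split -!mulr_sumr /= IH.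
have := central_bin_conv_moment K; rewrite IH; set S := \sum_(i < _) _ => eqS.
rewrite (_ : 2 * _ = 4 * (2 * S) + 4 * 4 ^+ K); last by ring.
by rewrite eqS exprS -natr1; ring.
Qed.

End CentralBinomials.

(** * The scalar recursion behind the symmetric powers *)

Section BesselOperator.
Variables (F : numFieldType) (k : nat).
Implicit Types (s : int -> F) (j l : nat) (n nu : int).

(** With theta acting on z^n as n and z shifting the index, this is the
    recursion L_(j+1) = theta L_j - j (k+1-j) z L_(j-1) producing the operator
    L_(k+1) that annihilates products of k solutions of the Bessel equation.
    When s is the coordinate of v_1^k of a section that nabla maps to a multiple
    of v_0^k, L_j s is, up to a constant, its coordinate of v_0^j v_1^(k-j). *)
Fixpoint bessel_op s j : int -> F :=
  match j with
  | 0 => s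
  | j'.+1 => fun n => n%:~R * bessel_op s j' n
                      - (j' * (k.+1 - j'))%:R * bessel_op s j'.-1 (n - 1)
  end.

Lemma bessel_opS s j n :
  bessel_op s j.+1 n = n%:~R * bessel_op s j n
                      - (j * (k.+1 - j))%:R * bessel_op s j.-1 (n - 1).
Proof. by []. Qed.

Lemma nat_ind2 (P : nat -> Prop) :
  P 0%N -> P 1%N -> (forall j, P j -> P j.+1 -> P j.+2) -> forall j, P j.
Proof.
move=> P0 P1 PS j; suff [] : P j /\ P j.+1 by [].
by elim: j => // j [? ?]; split => //; apply: PS.
Qed.

(** The j-th operator has degree at most j/2 in z. *)
Lemma bessel_op_local s s' j n :
  (forall nu, n - (j./2)%:Z <= nu <= n -> s nu = s' nu) ->
  bessel_op s j n = bessel_op s' j n.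
Proof.
elim/nat_ind2: j n => [||j IH0 IH1] n eq_s.
- by apply: eq_s; lia.
- by rewrite !bessel_opS /= !mul0n !mul0r eq_s//; lia.
rewrite !(bessel_opS _ j.+1) IH1 ?IH0// => nu nuP; apply: eq_s; move: nuP.
  by rewrite /=; lia.
by rewrite (_ : j.+2./2 = (j./2).+1)//; have := uphalf_half j; lia.
Qed.

Lemma bessel_op_lin s s' (c : F) j n :
  bessel_op (fun nu => s nu + c * s' nu) j n
  = bessel_op s j n + c * bessel_op s' j n.
Proof.
elim/nat_ind2: j n => [||j IH0 IH1] n //.
  by rewrite !bessel_opS /=; ring.
by rewrite !(bessel_opS _ j.+1) IH1 IH0 /=; ring.
Qed.

Lemma bessel_op0 j n : bessel_op (fun=> 0) j n = 0.
Proof.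
have := bessel_op_lin (fun=> 0) (fun=> 0) (-1) j n.
rewrite (@bessel_op_local _ (fun=> 0)) => [->|nu _]; last by rewrite mulr0 addr0.
by rewrite mulN1r subrr.
Qed.

(** At z = 0 only theta^j survives, hence the exponent 0 with full
    multiplicity. *)
Lemma bessel_op_low s n : (forall nu, nu < n -> s nu = 0) ->
  forall j, bessel_op s j n = n%:~R ^+ j * s n.
Proof.
move=> s0; elim/nat_ind2 => [||j _ IH].
- by rewrite expr0 mul1r.
- by rewrite bessel_opS /= !mul0n mul0r subr0 expr1.
rewrite bessel_opS IH (@bessel_op_local _ (fun=> 0)) => [|nu nuP].
  by rewrite bessel_op0 mulr0 subr0 mulrA -exprS.
by apply: s0; move: nuP; lia.
Qed.

Lemma bessel_op_high s j n : (forall nu, n - (j./2)%:Z <= nu -> s nu = 0) ->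
  bessel_op s j n = 0.
Proof.
move=> s0; rewrite (@bessel_op_local _ (fun=> 0)) ?bessel_op0// => nu /andP[? _].
exact: s0.
Qed.

(** In even order the top power of z is reached by the steps that multiply
    by z alone, so the top coefficient is a product. *)
Lemma bessel_op_lead_even s nu : (forall n, nu < n -> s n = 0) ->
  forall l, bessel_op s l.*2 (nu + l%:Z)
  = \prod_(i < l) (- ((i.*2.+1) * (k - i.*2))%:R) * s nu.
Proof.
move=> s0; elim=> [|l IH]; first by rewrite big_ord0 mul1r addr0.
rewrite doubleS bessel_opS (@bessel_op_high _ l.*2.+1) => [|n]; last first.
  move=> ?; apply: s0; have := uphalf_double l; have := uphalfE l.*2 => /=; lia.
rewrite /= (_ : nu + l.+1 - 1 = nu + l); last by lia.
by rewrite IH big_ord_recr /= subSS; ring.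
Qed.

End BesselOperator.
Arguments bessel_op : simpl never.

Section Leading.
Variables (F : numFieldType).
Local Notation central_bin := (central_bin F).

(** The products of the factors 2i+1 and of the factors k-2i are both k!!. *)
Lemma bessel_op_lead_odd_k K (s : int -> F) (nu : int) :
  (forall n, nu < n -> s n = 0) ->
  bessel_op K.*2.+1 s K.+1.*2 (nu + K.+1%:Z)
  = (-1) ^+ K.+1 * (\prod_(i < K.+1) (i.*2.+1)%:R) ^+ 2 * s nu.
Proof.
move=> s0; rewrite bessel_op_lead_even//; congr (_ * _).
under eq_bigr do rewrite -mulN1r natrM.
rewrite !big_split /= prodr_const card_ord expr2; congr (_ * (_ * _)).
rewrite (reindex_inj rev_ord_inj); apply: eq_bigr => i _ /=; congr (_%:R).
by have := ltn_ord i; lia.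
Qed.

Let hcoef K l : F :=
  (\prod_(i < l) (i.+1.*2 * (K - i).*2.-1)%:R) / central_bin K.

Let central_bin_neq0 l : central_bin l != 0.
Proof. by rewrite pnatr_eq0 -lt0n bin_gt0; lia. Qed.

Let lead_even K l : (l <= K)%N ->
  \prod_(i < l) (- ((i.*2.+1) * (K.*2 - i.*2))%:R)
  = (-1) ^+ l * hcoef K l * (central_bin l * central_bin (K - l)) :> F.
Proof.
elim: l => [_|l IH lK].
  rewrite /hcoef !big_ord0 {2}/central_bin bin0 subn0 expr0 !mul1r.
  by rewrite mulVf.
rewrite big_ord_recr /= IH; last by lia.
rewrite /hcoef big_ord_recr /= !natrM exprS.
have [m Km] : exists m, (K - l)%N = m.+1 by exists (K - l).-1; lia.
have -> : (K - l.+1 = m)%N by lia.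
have -> : (K.*2 - l.*2 = m.+1.*2)%N by lia.
rewrite Km doubleS /=.
have := central_binS F m; have := central_binS F l.
set a := (\prod_(i < _) _); move: (central_bin l) (central_bin l.+1) (central_bin m)
  (central_bin m.+1).
move=> c c' d d' ec ed.
have e2 p : p.*2.+1%:R = 2 * p%:R + 1 :> F by rewrite -addn1 natrD -muln2 natrM; ring.
have e2' p : p.*2.+2%:R = 2 * p.+1%:R :> F by rewrite -doubleS -muln2 natrM; ring.
transitivity (- ((-1) ^+ l * a / central_bin K * ((4 * l%:R + 2) * c) * (m.+1%:R * d'))).
  by rewrite e2 e2'; ring.
by rewrite -ec ed e2 e2'; ring.
Qed.

(** In odd order one of the steps uses theta instead of z; summing over its
    position l gives weights C(2l,l) C(2(K-l),K-l), of total 4^K, against the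
    exponents nu + l, of mean nu + K/2. *)
Lemma bessel_op_lead_even_k K (s : int -> F) (nu : int) :
  (forall n, nu < n -> s n = 0) ->
  bessel_op K.*2 s K.*2.+1 (nu + K%:Z)
  = (-1) ^+ K * 4 ^+ K * (K`!)%:R ^+ 2 * ((nu + K%:Z)%:~R - K%:R / 2) * s nu.
Proof.
move=> s0.
have partial l : (l <= K)%N -> bessel_op K.*2 s l.*2.+1 (nu + l%:Z)
   = (-1) ^+ l * hcoef K l
     * (\sum_(i < l.+1) (nu + i%:Z)%:~R * (central_bin i * central_bin (K - i))) * s nu.
  elim: l => [_|l IH lK].
    rewrite big_ord1 bessel_opS /= mul0n mul0r subr0 addr0 subn0.
    have -> : central_bin 0 = 1 by rewrite /central_bin bin0.
    by rewrite /hcoef big_ord0 expr0 !mul1r mulrCA mulVf ?mulr1.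
  rewrite bessel_opS bessel_op_lead_even// lead_even//.
  rewrite doubleS /= (_ : nu + l.+1 - 1 = nu + l); last by lia.
  rewrite IH; last by lia.
  have -> : hcoef K l.+1 = hcoef K l * (l.+1.*2 * (K.*2.+1 - l.*2.+2))%:R.
    rewrite /hcoef big_ord_recr mulrAC /= doubleS; congr (_ * (_ * _)%:R).
    by lia.
  by rewrite [in RHS]big_ord_recr doubleS exprS /=; ring.
rewrite partial//.
have -> : hcoef K K = (K`!)%:R ^+ 2.
  apply: (mulIf (central_bin_neq0 K)); rewrite /hcoef divfK//.
  rewrite /central_bin -natrX -natrM mulnC -natr_prod; congr (_%:R).
  have := bin_fact (leq_addr K K); rewrite addnK addnn mulnn => ->.
  rewrite big_split /= [X in (_ * X)%N](reindex_inj rev_ord_inj) -big_split /=.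
  rewrite (eq_bigr (fun i : 'I_K => i.*2.+2 * i.*2.+1)%N) => [|i _]; last first.
    rewrite /= doubleS; congr muln; have := ltn_ord i; lia.
  elim: K {s0 s nu partial} => [|K IH]; first by rewrite big_ord0.
  by rewrite big_ord_recr /= IH doubleS !factS mulnC mulnA.
rewrite -[_ * 4 ^+ K * _]mulrAC; congr (_ * _); rewrite -!mulrA; congr (_ * _).
rewrite -(central_bin_conv F K).
under eq_bigr => i _ do rewrite intrD mulrDl.
rewrite big_split -mulr_sumr /=.
have /(canRL (mulKf _)) -> := central_bin_conv_moment F K; last by rewrite pnatr_eq0.
rewrite intrD; set S := \sum_(i < _) _; by field.
Qed.
End Leading.

(** * Solving the connection equation in formal Laurent series *)

Section Triangular.
Variables (F : fieldType) (T : (int -> F) -> int -> F).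
Variables (pos eqn : nat -> int) (idx : int -> nat).
Hypothesis idxK : cancel pos idx.
Hypothesis T_lin : forall s s' (c : F) n,
  T (fun nu => s nu + c * s' nu) n = T s n + c * T s' n.
Hypothesis T_local : forall N s s',
  (forall M, (M <= N)%N -> s (pos M) = s' (pos M)) ->
  (forall nu, nu != pos (idx nu) -> s nu = s' nu) ->
  T s (eqn N) = T s' (eqn N).

Let unit_at N : int -> F := fun nu => (nu == pos N)%:R.

(** The N-th equation is solved for the N-th unknown, unless its diagonal
    coefficient vanishes, in which case that unknown is set to 0.  Stated for an
    enumeration [pos] of the unknowns so as to cover ascending recursions at 0
    and descending ones at infinity. *)
Lemma triangular_solve (rhs : nat -> F) :
  exists2 s, forall nu, nu != pos (idx nu) -> s nu = 0 &
    forall N, T (unit_at N) (eqn N) != 0 -> T s (eqn N) = rhs N.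
Proof.
pose coef S N := if T (unit_at N) (eqn N) == 0 then 0
                 else (rhs N - T S (eqn N)) / T (unit_at N) (eqn N).
pose fix S N : int -> F :=
  if N is M.+1 then fun nu => S M nu + coef (S M) M * unit_at M nu else fun=> 0.
have SS N nu : S N.+1 nu = S N nu + coef (S N) N * unit_at N nu by [].
have S_off nu : nu != pos (idx nu) -> forall N, S N nu = 0.
  move=> off; elim=> // N IH; rewrite SS IH add0r /unit_at.
  by have [nuE|] := eqVneq nu (pos N); [rewrite nuE idxK eqxx in off|rewrite mulr0].
have S_stable M d : S (M.+1 + d)%N (pos M) = S M.+1 (pos M).
  elim: d => [|d IH]; first by rewrite addn0.
  rewrite addnS SS IH /unit_at (can_eq idxK) (_ : (M == _) = false).
    by rewrite mulr0 addr0.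
  by apply/eqP; lia.
exists (fun nu => S (idx nu).+1 nu) => [nu off|N TN]; first exact: S_off.
rewrite (@T_local N _ (S N.+1)) => [|M MN|nu off]; last 2 first.
- by rewrite idxK -(subnKC MN) -addSn S_stable.
- by rewrite !S_off.
rewrite (_ : S N.+1 = fun nu => S N nu + coef (S N) N * unit_at N nu)//.
by rewrite T_lin /coef (negbTE TN) divfK// addrC subrK.
Qed.

End Triangular.

Section Solutions.
Variables (F : numFieldType) (k : nat).
Implicit Types (s : int -> F) (x y : nat -> int -> F) (n : int).

(** The connection on symmetric tensors, in the coordinates for which a
    tensor takes the value x a on every word with a letters v_1.  Each
    letter v_1 arises from a v_0, each letter v_0 from a v_1 with a factor z. *)
Definition sym_conn x a n : F :=
  n%:~R * x a n + a%:R * x a.-1 n + (k%:R - a%:R) * x a.+1 (n - 1).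

(** The section whose last coordinate is s and for which all components of
    the connection but that of v_0^k vanish. *)
Definition cyclic_section s a n : F :=
  (-1) ^+ (k - a) * (a`!)%:R / (k`!)%:R * bessel_op k s (k - a) n.

Lemma fact_neq0 m : (m`!)%:R != 0 :> F.
Proof. by rewrite pnatr_eq0 -lt0n fact_gt0. Qed.

(** The recursion of [bessel_op] is the equation at v_0^(k-a) v_1^a solved
    for the next coordinate. *)
Lemma sym_conn_cyclic s a n : (a <= k)%N ->
  sym_conn (cyclic_section s) a n =
  if a == 0%N then (-1) ^+ k / (k`!)%:R * bessel_op k s k.+1 n else 0.
Proof.
rewrite /sym_conn /cyclic_section; case: a => [_|a ak] /=.
  rewrite subn0 mul0r addr0 bessel_opS fact0 subSnn muln1.
  case: k => [|m]; first by rewrite /= !mul0r; ring.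
  rewrite subSS subn0 exprS factS /= natrM -[1`!%N]/1%N.
  by field; rewrite ?fact_neq0 ?nat1r ?pnatr_eq0.
have kaE : (k - a = (k - a.+1).+1)%N by lia.
rewrite kaE bessel_opS -subnS -natrB//.
rewrite (_ : k.+1 - (k - a.+1) = a.+2)%N; last by lia.
rewrite (subnS k a.+1); case: (k - a.+1)%N => [|m] /=.
  by rewrite !mul0n mul0r expr1 factS natrM; ring.
by rewrite !exprS !factS !natrM; ring.
Qed.

(** Conversely the last coordinate of a section is a solution of the scalar
    equation: the equations for a > 0 leave no choice for the other
    coordinates. *)
Lemma bessel_op_of_section x :
  (forall a n, (0 < a <= k)%N -> sym_conn x a n = 0) ->
  forall n, bessel_op k (x k) k.+1 n = (-1) ^+ k * (k`!)%:R * sym_conn x 0 n.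
Proof.
move=> x0.
have step j : (j <= k)%N -> forall n,
    bessel_op k (x k) j n
    = (-1) ^+ j * (k`!)%:R / ((k - j)`!)%:R * x (k - j)%N n.
  elim/ltn_ind: j => -[_ _ n|j IH jk n].
    by rewrite subn0 expr0 mul1r divff ?mul1r// fact_neq0.
  rewrite bessel_opS IH//; last by lia.
  have -> : (j * (k.+1 - j))%:R * bessel_op k (x k) j.-1 (n - 1)
     = - (-1) ^+ j * (k`!)%:R / ((k - j)`!)%:R * (j%:R * x (k - j).+1 (n - 1)).
    case: j IH jk => [|j] IH jk; first by rewrite mul0n !mul0r mulr0.
    rewrite IH//=; [|lia..].
    rewrite subnSK; last lia.
    rewrite (_ : k.+1 - j.+1 = (k - j.+1).+1)%N; last lia.
    rewrite (_ : k - j = (k - j.+1).+1)%N; last lia.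
    by rewrite factS exprS !natrM; field; rewrite ?fact_neq0 ?nat1r ?pnatr_eq0.
  have := x0 (k - j)%N n; rewrite /sym_conn.
  have -> : k%:R - (k - j)%:R = j%:R :> F by rewrite natrB; [ring|lia].
  have [m km] : exists m, (k - j = m.+1)%N by exists (k - j).-1; lia.
  rewrite (_ : k - j.+1 = m)%N; last lia.
  rewrite km factS natrM /= exprS => eq0.
  have -> : x m n = - (n%:~R * x m.+1 n + j%:R * x m.+2 (n - 1)) / m.+1%:R.
    apply/eqP; rewrite eq_sym -subr_eq0; apply/eqP.
    have : - m.+1%:R^-1 * (n%:~R * x m.+1 n + m.+1%:R * x m n + j%:R * x m.+2 (n - 1)) = 0.
      by rewrite eq0 ?mulr0//; lia.
    by move=> <-; field; rewrite ?nat1r ?pnatr_eq0.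
  by field; rewrite ?fact_neq0 ?nat1r ?pnatr_eq0.
move=> n; rewrite bessel_opS !step ?leq_pred// /sym_conn subnn fact0.
rewrite subSnn muln1 mul0r addr0 subr0.
case: k step => [|m] step; first by rewrite /= fact0; field.
by rewrite exprS /= subSnn -[1`!%N]/1%N; field.
Qed.

End Solutions.

Section Existence.
Variables (F : numFieldType) (k : nat).
Implicit Types (s : int -> F) (x : nat -> int -> F) (y : int -> F) (n : int).

(** The coefficient of s at z^(n-K) in the scalar equation at z^n, where
    K = ceil(k/2); all other contributions come from higher powers of z. *)
Definition lead_oo n : F :=
  let K := uphalf k in
  if odd k then (-1) ^+ K * (\prod_(i < K) (i.*2.+1)%:R) ^+ 2
  else (-1) ^+ K * 4 ^+ K * (K`!)%:R ^+ 2 * (n%:~R - K%:R / 2).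

Lemma bessel_op_lead s (nu n : int) : nu = n - (uphalf k)%:Z ->
  (forall n, nu < n -> s n = 0) ->
  bessel_op k s k.+1 n = lead_oo n * s nu.
Proof.
move=> nuE s0; rewrite /lead_oo.
have -> : n = nu + uphalf k by lia.
have [ok|ok] := boolP (odd k).
  have [l kE] : exists l, k = l.*2.+1 by exists k./2; lia.
  have -> : uphalf k = l.+1 by lia.
  by rewrite kE -doubleS bessel_op_lead_odd_k.
have [l kE] : exists l, k = l.*2 by exists k./2; lia.
have -> : uphalf k = l by lia.
by rewrite kE bessel_op_lead_even_k.
Qed.

(** For k = 2K the zero n = K/2 is an integer exactly when 4 divides k. *)
Lemma lead_oo_neq0 n : ~~ ((4 %| k)%N && (n == (k %/ 4)%N)) -> lead_oo n != 0.
Proof.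
rewrite /lead_oo; case: ifPn => [_ _|ok nk].
  rewrite mulf_neq0 ?signr_eq0// expf_neq0//.
  by apply/prodf_neq0 => i _; rewrite pnatr_eq0.
rewrite !mulf_neq0 ?signr_eq0 ?expf_neq0 ?fact_neq0 ?pnatr_eq0//.
apply: contra nk => /eqP nK; have {nK}: (2 * n)%:~R == (uphalf k)%:Z%:~R :> F.
  by rewrite intrM -subr_eq0 -(mulr0 2) -nK; apply/eqP; field.
rewrite eqr_int => /eqP nK; apply/andP.
have kE := odd_double_half k; rewrite uphalf_half (negbTE ok) in nK kE.
have k4 : (k = `|n| * 4)%N by lia.
by rewrite [in X in X /\ _]k4 dvdn_mull// k4 mulnK//; split => //; apply/eqP; lia.
Qed.

(** At z = 0 the diagonal coefficients n^(k+1) are nonzero for n > 0. *)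
Lemma solve_0 y : (forall n, n <= 0 -> y n = 0) ->
  exists2 x : nat -> int -> F, forall a n, n <= 0 -> x a n = 0 &
    forall a n, (a <= k)%N -> sym_conn k x a n = if a == 0%N then y n else 0.
Proof.
move=> y0; pose pos N := (N.+1)%:Z; pose idx (n : int) := (`|n|%N).-1.
have idxK : cancel pos idx by move=> N; rewrite /idx /pos; lia.
have [||s s0 sE] := @triangular_solve F (fun s => bessel_op k s k.+1) pos pos
  idx idxK _ _ (fun N => (k`!)%:R / (-1) ^+ k * y (pos N)).
- by move=> *; apply: bessel_op_lin.
- move=> N s s' eq_s eq_off; apply: bessel_op_local => nu /andP[_ nuN].
  have [nuE|] := eqVneq nu (pos (idx nu)); last exact: eq_off.
  by rewrite nuE; apply: eq_s; by rewrite /pos in nuE nuN; lia.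
have {}s0 n : n <= 0 -> s n = 0 by move=> n0; apply: s0; rewrite /pos; lia.
exists (cyclic_section k s) => [a n n0|a n ak].
  rewrite /cyclic_section (@bessel_op_local _ _ _ (fun=> 0)) ?bessel_op0 ?mulr0//.
  by move=> nu nun; apply: s0; lia.
rewrite sym_conn_cyclic//; case: eqP => // _.
case: (lerP n 0) => n0.
  rewrite bessel_op_low ?s0 ?y0 ?mulr0// => nu nun; apply: s0; lia.
have nE : n = pos (idx n) by rewrite /pos /idx; lia.
rewrite {1}nE sE ?bessel_op_low//.
- by rewrite -nE; field; rewrite fact_neq0 signr_eq0.
- by rewrite eqxx mulr1 expf_neq0// intr_eq0.
- by move=> nu; rewrite lt_neqAle => /andP[/negbTE-> _].
Qed.

(** At infinity the only equation that cannot be imposed is the one at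
    z^(k/4) when 4 divides k; the constant c is its defect. *)
Lemma solve_oo y (n1 : int) : (forall n, n1 < n -> y n = 0) ->
  exists x : nat -> int -> F, exists n0 : int, exists c : F,
    (forall a n, n0 < n -> x a n = 0) /\
    forall a n, (a <= k)%N -> sym_conn k x a n =
      if a == 0%N then y n - c * ((4 %| k)%N && (n == (k %/ 4)%N))%:R else 0.
Proof.
move=> y0; pose K := uphalf k.
pose pos (N : nat) : int := n1 - K%:Z - N%:Z; pose eqn (N : nat) : int := n1 - N%:Z.
pose idx (n : int) := `|(n1 - K%:Z - n)%R|%N.
have idxK : cancel pos idx by move=> N; rewrite /idx /pos; lia.
have [||s s0 sE] := @triangular_solve F (fun s => bessel_op k s k.+1) pos eqn
  idx idxK _ _ (fun N => (k`!)%:R / (-1) ^+ k * y (eqn N)).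
- by move=> *; apply: bessel_op_lin.
- move=> N s s' eq_s eq_off; apply: bessel_op_local => nu /andP[nuN _].
  have [nuE|] := eqVneq nu (pos (idx nu)); last exact: eq_off.
  by rewrite nuE; apply: eq_s; rewrite -uphalfE -/K /eqn /pos in nuE nuN; lia.
have {}s0 n : n1 - K%:Z < n -> s n = 0.
  by move=> n0; apply: s0; rewrite /pos /idx; lia.
pose c := y (k %/ 4)%N - (-1) ^+ k / (k`!)%:R * bessel_op k s k.+1 (k %/ 4)%N.
exists (cyclic_section k s), (n1 + k%:Z), c; split => [a n n0|a n ak].
  rewrite /cyclic_section bessel_op_high ?mulr0// => nu nun.
  by apply: s0; lia.
rewrite sym_conn_cyclic//; case: eqP => // _.
have [/andP[k4 /eqP ->]|k4] := boolP (_ && _).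
  by rewrite mulr1 /c opprB addrCA subrr addr0.
rewrite mulr0 subr0; case: (ltrP n1 n) => n0.
  rewrite bessel_op_high ?y0 ?mulr0// => nu nun.
  by apply: s0; rewrite -uphalfE -/K in nun; lia.
have nE : n = eqn (idx (n - K%:Z)) by rewrite /eqn /idx; lia.
rewrite {1}nE sE.
- by rewrite -nE; field; rewrite fact_neq0 signr_eq0.
rewrite -nE (@bessel_op_lead _ (n - K%:Z))//.
  rewrite (_ : pos _ = n - K%:Z) ?eqxx ?mulr1 ?lead_oo_neq0//.
  by rewrite /pos /idx; lia.
by move=> nu; rewrite /pos /idx => h; case: eqP => // ?; lia.
Qed.

End Existence.

Section Extract.
Variables (F : numFieldType) (k : nat).
Implicit Types (x : nat -> int -> F) (y : int -> F) (n : int).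

Definition solves x y := forall a n, (a <= k)%N ->
  sym_conn k x a n = if a == 0%N then y n else 0.

Lemma solves_bessel_op x y n : solves x y ->
  bessel_op k (x k) k.+1 n = (-1) ^+ k * (k`!)%:R * y n.
Proof.
move=> xy; rewrite bessel_op_of_section ?xy// => a m /andP[a0 ak].
by rewrite xy// gtn_eqF.
Qed.

(** At the lowest exponent n < 0 of s the scalar equation would read
    n^(k+1) s_n = 0. *)
Lemma solves_low x y (N : int) : solves x y ->
  (forall n, n < N -> x k n = 0) -> (forall n, n < 0 -> y n = 0) ->
  forall n, n < 0 -> x k n = 0.
Proof.
move=> xy xN y0.
have main (d : nat) n : n < 0 -> n < N + d%:Z -> x k n = 0.
  elim: d n => [|d IH] n n0 nd; first by apply: xN; lia.
  have := solves_bessel_op n xy; rewrite y0// mulr0 bessel_op_low => [/eqP|m mn].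
    by rewrite mulf_eq0 expf_eq0 intr_eq0 /= lt_eqF// => /eqP.
  by apply: IH; lia.
move=> n n0; apply: (main `|N|%N) => //; lia.
Qed.

(** Going down from above the support, every coefficient of s vanishes until
    the equation number e is reached, provided that the flat section sits
    strictly lower. *)
Lemma solves_high x y (N e : int) : solves x y ->
  (forall n, N < n -> x k n = 0) ->
  (forall n, e < n -> y n = 0) ->
  (forall n, e <= n -> ~~ ((4 %| k)%N && (n == (k %/ 4)%N))) ->
  x k (e - (uphalf k)%:Z) = (-1) ^+ k * (k`!)%:R / lead_oo F k e * y e.
Proof.
move=> xy xN y0 e4.
have top n : e <= n -> (forall m, n - (uphalf k)%:Z < m -> x k m = 0) ->
    x k (n - (uphalf k)%:Z) = (-1) ^+ k * (k`!)%:R / lead_oo F k n * y n.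
  move=> en x0; have := solves_bessel_op n xy.
  have lead0 := lead_oo_neq0 F (e4 n en).
  rewrite (bessel_op_lead (erefl _) x0) => xE; apply: (mulfI lead0).
  by rewrite xE; field.
have main (d : nat) n : e - (uphalf k)%:Z < n -> N - d%:Z < n -> x k n = 0.
  elim: d n => [|d IH] n en nd; first by apply: xN; lia.
  have -> : n = (n + (uphalf k)%:Z) - (uphalf k)%:Z by lia.
  rewrite top ?y0 ?mulr0//; [lia|lia|].
  by move=> m ?; apply: IH; lia.
apply: top => // m em; apply: (main `|N - m|.+1) => //; lia.
Qed.

End Extract.

(** * Symmetric tensors in coordinates *)

Section SymTens.
Variables (R : realType) (k : nat).
Local Notation C := (R[i]).
Local Notation word := ({ffun 'I_k -> bool}).
Implicit Types (x y : nat -> int -> C) (m : tens R k) (e : word) (n : int).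

(** Symmetric tensors are the functions of the number of letters v_1. *)
Definition sym_tens x : tens R k := fun e n => x (weight e) n.

Definition tens_coef m : nat -> int -> C := fun a n => m (std_word k a) n.

Lemma tens_act_sym_tens s x : tens_act s (sym_tens x) = sym_tens x.
Proof. by apply/funext => e; rewrite /tens_act /sym_tens weight_perm. Qed.

Lemma sym_tensK m : (forall s, tens_act s m = m) -> m = sym_tens (tens_coef m).
Proof.
move=> ms; apply/funext => e; rewrite /sym_tens /tens_coef.
have [s es] : exists s : 'S_k, e = [ffun i => std_word k (weight e) (s i)].
  by apply: weight_trans; rewrite weight_std_word ?weight_le.
by rewrite {1}es -[in RHS](ms s).
Qed.

Lemma weight_upd e j b :
  (weight (upd e j b) + e j)%N = (weight e + b)%N.
Proof.
rewrite /weight (bigD1 j)//= [in RHS](bigD1 j)//= ffunE eqxx.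
rewrite (eq_bigr (fun i => nat_of_bool (e i))) => [|i /negbTE ij]; last first.
  by rewrite ffunE ij.
by rewrite addnAC [RHS]addnC addnA.
Qed.

(** The Leibniz sum over the k factors has weight e terms that turn a v_0
    into the letter v_1 and k - weight e terms of the other kind. *)
Lemma nabla_sym_tens x : nabla (sym_tens x) = sym_tens (sym_conn k x).
Proof.
apply/funext => e; apply/funext => n; rewrite /nabla /sym_tens /sym_conn -addrA.
congr (_ + _); set a := weight e.
transitivity (\sum_(j < k) ((e j)%:R * x a.-1 n + (1 - (e j)%:R) * x a.+1 (n - 1))).
  apply: eq_bigr => j _; rewrite big_bool.
  have := weight_upd e j (~~ e j); rewrite -/a /sym_tens /zshift.
  case: (e j) => /= aE.
    by rewrite subrr mul0r mul1r !addr0 add0r; congr (x _ _); lia.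
  by rewrite subr0 mul0r mul1r !add0r addr0; congr (x _ _); lia.
rewrite big_split -!mulr_suml /= sumrB sumr_const card_ord.
by rewrite -natr_sum.
Qed.

(** Words are subsets of the set of positions. *)
Lemma card_weight a : (\sum_(e : word | weight e == a) 1)%N = 'C(k, a).
Proof.
rewrite -[k in RHS]card_ord -card_draws -sum1_card.
pose f (A : {set 'I_k}) : word := [ffun i => i \in A].
rewrite (reindex f) /=; last first.
  exists (fun e : word => [set i | e i]%SET) => [A _|e _].
    by apply/setP => i; rewrite inE ffunE.
  by apply/ffunP => i; rewrite ffunE inE.
apply: eq_bigl => A; rewrite inE; congr (_ == _).
rewrite /weight -sum1_card [RHS]big_mkcond /=; apply: eq_bigr => i _.
by rewrite ffunE; case: (i \in A).
Qed.

Lemma sym_coord_sym_tens x a :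
  sym_coord (sym_tens x) a = fun n => ('C(k, a))%:R * x a n.
Proof.
apply/funext => n; rewrite /sym_coord -card_weight natr_sum mulr_suml.
by apply: eq_bigr => e /eqP we; rewrite /sym_tens we mul1r.
Qed.

Lemma omega_formE i : @omega_form R k i
  = sym_tens (fun a n => ((a == 0%N) && (n == i%:Z))%:R).
Proof.
apply/funext => e; apply/funext => n; rewrite /omega_form /zshift /sym_u /sym_tens.
have b0 (s : 'S_k) : tens_act s (@basis_tens R k (std_word k 0)) e (n - i%:Z)
   = ((weight e == 0%N) && (n == i%:Z))%:R.
  rewrite /tens_act /basis_tens subr_eq0; congr (_ && _)%:R.
  apply/eqP/idP => [es|].
    by rewrite -(weight_perm s) es weight_std_word.
  rewrite /weight sum_nat_eq0 => /forallP e0; apply/ffunP => j.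
  rewrite !ffunE; have := e0 (s j).
  by rewrite subn0 (leqNgt k j) (ltn_ord j) /=; case: (e (s j)).
rewrite (eq_bigr _ (fun s _ => b0 s)) sumr_const card_Sn.
by rewrite -[X in _ * X]mulr_natl mulKf// fact_neq0.
Qed.

End SymTens.

(** * The residue pairing *)

Section ResiduePairing.
Variables (R : realType) (k : nat).
Local Notation C := (R[i]).
Implicit Types (f g : int -> C) (x y : nat -> int -> C) (n : int) (M : nat).

Definition zres f g : C := zmul f g 0.

Definition zres_trunc M f g : C :=
  \sum_(i < M.*2.+1) f (i%:Z - M%:Z) * g (M%:Z - i%:Z).

(** This ensures that the products f g, (z f) g and f (z g) are finite sums
    in degree 0, all indexed by the same range; the pair may be two series at 0,
    two at infinity, or one of any kind with a Laurent polynomial. *)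
Definition supp_compat M f g := forall l1 l2 : int, M%:Z < `|l1| -> `|l1 + l2| <= 1 ->
  f l1 = 0 \/ g l2 = 0.

Lemma zres_truncE M f g : supp_compat M f g -> zres f g = zres_trunc M f g.
Proof.
move=> cfg; rewrite /zres /zmul.
pose r := [seq i%:Z - M%:Z | i <- iota 0 M.*2.+1].
have ur : uniq r by rewrite map_inj_uniq ?iota_uniq// => a b; lia.
rewrite -(@fsbig_widen _ _ _ _ [set` r] setT) //=.
  rewrite -fsbig_seq// big_map -[M.*2.+1]subn0 -/(index_iota 0 M.*2.+1) big_mkord.
  by apply: eq_bigr => i _; congr (_ * g _); lia.
move=> l [_ nlr] /=.
have [||-> | ->] := cfg l (0 - l); rewrite ?mul0r ?mulr0//; last by lia.
rewrite ltNge; apply: contra_notN nlr => lM /=.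
by apply/mapP; exists (`|(l + M%:Z)%R|%N); [rewrite mem_iota|]; lia.
Qed.

Lemma supp_compat_le M M' f g : (M <= M')%N -> supp_compat M f g -> supp_compat M' f g.
Proof. by move=> MM cfg l1 l2 l1M; apply: cfg; lia. Qed.

Lemma supp_compat_sym M f g : supp_compat M f g -> supp_compat M.+1 g f.
Proof. by move=> cfg l1 l2 l1M l12; have [||h|h] := cfg l2 l1;
  [lia|lia|by right|by left]. Qed.

Lemma zres_truncC M f g : zres_trunc M f g = zres_trunc M g f.
Proof.
rewrite /zres_trunc (reindex_inj rev_ord_inj); apply: eq_bigr => i _ /=.
by rewrite mulrC; have := ltn_ord i => ?; congr (g _ * f _); lia.
Qed.

(** The residue of theta (f g) is 0. *)
Lemma zres_trunc_theta M f g :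
  zres_trunc M (fun n => n%:~R * f n) g
  = - zres_trunc M f (fun n => n%:~R * g n).
Proof.
rewrite /zres_trunc -sumrN; apply: eq_bigr => i _.
rewrite -(opprB i%:Z M%:Z) rmorphN /=; ring.
Qed.

Lemma sum_ord_shift (h : nat -> C) N : h 0%N = 0 -> h N.+1 = 0 ->
  \sum_(i < N.+1) h i = \sum_(i < N.+1) h i.+1.
Proof. by move=> h0 hN; rewrite big_ord_recl h0 add0r big_ord_recr /= hN addr0. Qed.

Lemma zres_trunc_shift M f g : supp_compat M f g ->
  zres_trunc M.+1 (fun n => f (n - 1)) g = zres_trunc M.+1 f (fun n => g (n - 1)).
Proof.
move=> cfg; rewrite /zres_trunc.
rewrite (sum_ord_shift (h := fun i => f (i%:Z - M.+1%:Z - 1) * g (M.+1%:Z - i%:Z))).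
- by apply: eq_bigr => i _; congr (f _ * g _); lia.
- by have [||->|->] := cfg (0%N%:Z - M.+1%:Z - 1) (M.+1%:Z - 0%N%:Z);
    rewrite ?mulr0 ?mul0r//; lia.
- by have [||->|->] := cfg (M.+1.*2.+1%:Z - M.+1%:Z - 1) (M.+1%:Z - M.+1.*2.+1%:Z);
    rewrite ?mulr0 ?mul0r//; lia.
Qed.

Lemma zres_truncDl M f f' (c : C) g :
  zres_trunc M (fun n => f n + c * f' n) g
  = zres_trunc M f g + c * zres_trunc M f' g.
Proof.
by rewrite /zres_trunc mulr_sumr -big_split; apply: eq_bigr => i _ /=; ring.
Qed.

(** The pairing of the symmetric tensors with coordinates x and y: the
    numbers of words C(k,a) and C(k,k-a) turn the coefficients a! (k-a)! / k! of
    the algebraic pairing into C(k,a). *)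
Definition spair x y : C :=
  \sum_(a < k.+1) (-1) ^+ a * ('C(k, a))%:R * zres (x a) (y (k - a)%N).

Definition spair_trunc M x y : C :=
  \sum_(a < k.+1) (-1) ^+ a * ('C(k, a))%:R * zres_trunc M (x a) (y (k - a)%N).

Definition supp_compat2 M x y := forall a b, supp_compat M (x a) (y b).

Lemma spair_truncE M x y : supp_compat2 M x y -> spair x y = spair_trunc M x y.
Proof. by move=> c; apply: eq_bigr => a _; rewrite (zres_truncE (c _ _)). Qed.

Lemma supp_compat2_le M M' x y : (M <= M')%N -> supp_compat2 M x y -> supp_compat2 M' x y.
Proof. by move=> MM c a b; apply: supp_compat_le MM _. Qed.

Lemma supp_compat2_sym M x y : supp_compat2 M x y -> supp_compat2 M.+1 y x.
Proof. by move=> c a b; apply: supp_compat_sym. Qed.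

Lemma spair_truncC M x y : spair_trunc M x y = (-1) ^+ k * spair_trunc M y x.
Proof.
rewrite /spair_trunc (reindex_inj rev_ord_inj) mulr_sumr; apply: eq_bigr => a _ /=.
have ak : (a <= k)%N by rewrite -ltnS.
rewrite subSS subKn// zres_truncC bin_sub// !mulrA -exprD.
congr (_ * _ * _); rewrite -[LHS]signr_odd -[RHS]signr_odd; congr (_ ^+ nat_of_bool _).
by rewrite oddB// oddD.
Qed.

(** The pairing is flat and a derivative has no residue.  The terms in which
    the connection changes a letter cancel in pairs, by
    (a+1) C(k,a+1) = (k-a) C(k,a). *)
Lemma spair_trunc_conn M x y : supp_compat2 M x y ->
  spair_trunc M.+1 (sym_conn k x) y = - spair_trunc M.+1 x (sym_conn k y).
Proof.
move=> cxy.
pose B := zres_trunc M.+1.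
pose U a : C := (-1) ^+ a * ('C(k, a))%:R * a%:R * B (x a.-1) (y (k - a)%N).
pose V a : C := (-1) ^+ a * ('C(k, a))%:R * (k - a)%N%:R
                * B (fun n => x a.+1 (n - 1)) (y (k - a)%N).
pose U' a : C := (-1) ^+ a * ('C(k, a))%:R * (k - a)%N%:R * B (x a) (y (k - a).-1).
pose V' a : C := (-1) ^+ a * ('C(k, a))%:R * a%:R
                * B (x a) (fun n => y (k - a).+1 (n - 1)).
have connl a : (a <= k)%N -> (-1) ^+ a * ('C(k, a))%:R * B (sym_conn k x a) (y (k - a)%N)
   = (-1) ^+ a * ('C(k, a))%:R * B (fun n => n%:~R * x a n) (y (k - a)%N) + U a + V a.
  move=> ak; rewrite /sym_conn /B !zres_truncDl /U /V natrB// -/B; ring.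
have connr a : (a <= k)%N -> (-1) ^+ a * ('C(k, a))%:R * B (x a) (sym_conn k y (k - a)%N)
   = (-1) ^+ a * ('C(k, a))%:R * B (x a) (fun n => n%:~R * y (k - a)%N n) + U' a + V' a.
  move=> ak; rewrite /sym_conn /B zres_truncC !zres_truncDl.
  rewrite -!(zres_truncC _ (x a)) /U' /V' natrB// -/B; ring.
rewrite /spair_trunc -/B.
under [LHS]eq_bigr => a _ do rewrite (connl a (leq_ord a)).
under [X in _ = - X]eq_bigr => a _ do rewrite (connr a (leq_ord a)).
rewrite !big_split /=.
have binE a : a.+1%:R * ('C(k, a.+1))%:R = (k - a)%N%:R * ('C(k, a))%:R :> C.
  by rewrite -!natrM mul_bin_left.
have -> : \sum_(a < k.+1) U a = - \sum_(a < k.+1) U' a.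
  rewrite big_ord_recl [in RHS]big_ord_recr /= {1}/U {2}/U' subnn mulr0 !mul0r.
  rewrite mulr0 mul0r addr0 add0r -sumrN; apply: eq_bigr => a _.
  rewrite /U /U' /bump /= add1n exprS subnS; move: (B _ _) => b.
  by rewrite -[_ * _ * a.+1%:R]mulrA [_ * a.+1%:R]mulrC binE; ring.
have -> : \sum_(a < k.+1) V a = - \sum_(a < k.+1) V' a.
  rewrite [in RHS]big_ord_recl big_ord_recr /= {2}/V {1}/V' subnn mulr0 !mul0r.
  rewrite mulr0 mul0r addr0 add0r -sumrN; apply: eq_bigr => a _.
  rewrite /V /V' /bump /= add1n exprS subnSK// /B (zres_trunc_shift (cxy _ _)).
  move: (zres_trunc _ _ _) => b.
  by rewrite -[_ * _ * a.+1%:R]mulrA [_ * a.+1%:R]mulrC binE; ring.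
rewrite !opprD; congr (_ - _ - _); rewrite -sumrN; apply: eq_bigr => a _.
by rewrite /B zres_trunc_theta mulrN.
Qed.

Lemma spair_conn_of_bound M x y : supp_compat2 M x y -> supp_compat2 M.+1 (sym_conn k x)
  y ->
  supp_compat2 M.+1 x (sym_conn k y) ->
  spair (sym_conn k x) y = - spair x (sym_conn k y).
Proof. by move=> c cx cy; rewrite (spair_truncE cx) (spair_truncE cy) spair_trunc_conn. Qed.

End ResiduePairing.

Section Lifts.
Variables (R : realType) (k : nat).
Local Notation C := (R[i]).
Implicit Types (x y : nat -> int -> C) (n : int) (m : tens R k).
Local Notation spair := (@spair R k).
Local Notation stens := (@sym_tens R k).

Definition supp_ge (N : int) x := forall a n, n < N -> x a n = 0.
Definition supp_le (N : int) x := forall a n, N < n -> x a n = 0.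

Definition tame x y := exists M, supp_compat2 M x y.

Lemma tame_supp_ge N N' x y : supp_ge N x -> supp_ge N' y -> tame x y.
Proof.
move=> xN yN; exists (`|N| + `|N'| + 2)%N => a b l1 l2 l1M l12.
by case: (lerP 0 l1) => l1s; [right; apply: yN | left; apply: xN]; lia.
Qed.

Lemma tame_supp_le N N' x y : supp_le N x -> supp_le N' y -> tame x y.
Proof.
move=> xN yN; exists (`|N| + `|N'| + 2)%N => a b l1 l2 l1M l12.
by case: (lerP 0 l1) => l1s; [left; apply: xN | right; apply: yN]; lia.
Qed.

Lemma supp_ge_conn N x : supp_ge N x -> supp_ge N (sym_conn k x).
Proof. by move=> xN a n nN; rewrite /sym_conn !xN ?mulr0 ?addr0//; lia. Qed.

Lemma supp_le_conn N x : supp_le N x -> supp_le (N + 1) (sym_conn k x).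
Proof. by move=> xN a n nN; rewrite /sym_conn !xN ?mulr0 ?addr0//; lia. Qed.

Lemma spair_conn x y : tame x y -> tame (sym_conn k x) y ->
  tame x (sym_conn k y) -> spair (sym_conn k x) y = - spair x (sym_conn k y).
Proof.
move=> [M c] [M1 c1] [M2 c2]; apply: (@spair_conn_of_bound R k (M + M1 + M2)).
- by apply: supp_compat2_le c; lia.
- by apply: supp_compat2_le c1; lia.
- by apply: supp_compat2_le c2; lia.
Qed.

(** The algebraic pairing is (-1)^k-symmetric. *)
Lemma spairC x y : tame x y -> spair x y = (-1) ^+ k * spair y x.
Proof.
move=> [M c]; rewrite (spair_truncE _ (supp_compat2_le (leqnSn M) c)).
by rewrite (spair_truncE _ (supp_compat2_sym c)) spair_truncC.
Qed.

Lemma spairDl (c : C) x x' y : tame x y -> tame x' y ->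
  spair (fun a n => x a n + c * x' a n) y = spair x y + c * spair x' y.
Proof.
move=> [M t] [M' t'].
have {}t : supp_compat2 (M + M') x y by apply: supp_compat2_le t; lia.
have {}t' : supp_compat2 (M + M') x' y by apply: supp_compat2_le t'; lia.
rewrite (spair_truncE _ t) (spair_truncE _ t') (@spair_truncE _ _ (M + M')).
  rewrite /spair_trunc mulr_sumr -big_split; apply: eq_bigr => a _ /=.
  by rewrite zres_truncDl; ring.
move=> a b l1 l2 l1M l12; have [->|->] := t a b _ _ l1M l12; last by right.
by have [->|->] := t' a b _ _ l1M l12; [left; rewrite mulr0 addr0|right].
Qed.

Lemma tameDl (c : C) x x' y : tame x y -> tame x' y ->
  tame (fun a n => x a n + c * x' a n) y.
Proof.
move=> [M t] [M' t']; exists (M + M')%N => a b l1 l2 l1M l12.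
have [||->|->] := t a b l1 l2; [lia|lia| |by right].
by have [||->|->] := t' a b l1 l2; [lia|lia|left; rewrite mulr0 addr0|right].
Qed.

Lemma eq_spairr x y y' : (forall a n, (a <= k)%N -> y a n = y' a n) ->
  spair x y = spair x y'.
Proof.
move=> yy'; apply: eq_bigr => a _; rewrite (_ : y _ = y' (k - a)%N)//.
by apply/funext => n; rewrite yy' ?leq_subr.
Qed.

Lemma eq_spairl x x' y : (forall a n, (a <= k)%N -> x a n = x' a n) ->
  spair x y = spair x' y.
Proof.
move=> xx'; apply: eq_bigr => a _; rewrite (_ : x _ = x' a)//.
by apply/funext => n; rewrite xx' -1?ltnS.
Qed.

(** Only b = k - a contributes, and
    C(k,a)^2 a! (k-a)! / k! = C(k,a). *)
Lemma alg_pairing_res x y : tame x y ->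
  alg_pairing (stens x) (stens y) 0 = spair x y.
Proof.
move=> [M t]; apply: eq_bigr => a _.
have ak : (a <= k)%N by rewrite -ltnS.
have bk : (k - a < k.+1)%N by rewrite ltnS leq_subr.
rewrite (bigD1 (Ordinal bk)) //= big1 ?addr0 => [|b ba]; last first.
  rewrite /u_pairing ifF ?mul0r//; apply: contraNF ba => /eqP ab.
  by apply/eqP/val_inj => /=; lia.
rewrite /u_pairing subnKC// eqxx !sym_coord_sym_tens -/(zres _ _).
have t' : supp_compat M (fun n => 'C(k, a)%:R * x a n)
  (fun n => 'C(k, k - a)%:R * y (k - a)%N n).
  move=> l1 l2 l1M l12; have [->|->] := t a (k - a)%N _ _ l1M l12.
    by left; rewrite mulr0.
  by right; rewrite mulr0.
rewrite (zres_truncE t') (zres_truncE (t _ _)).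
rewrite (_ : zres_trunc _ _ _ = 'C(k, a)%:R ^+ 2 * zres_trunc M (x a) (y (k - a)%N)).
  rewrite -(bin_fact ak) !natrM; field.
  rewrite !pnatr_eq0 -!lt0n !fact_gt0 bin_gt0 ak.
  done.
rewrite /zres_trunc mulr_sumr; apply: eq_bigr => i _.
by rewrite bin_sub//; ring.
Qed.

Lemma formal0_supp_ge m : (forall e, formal0 (m e)) ->
  exists N, supp_ge N (tens_coef m).
Proof.
move=> /choice[N mN]; exists (- \sum_e `|N e|) => a n nN; apply: (mN (std_word k a)).
apply: lt_le_trans nN _; rewrite lerNl (bigD1 (std_word k a))//=.
rewrite (le_trans (ler_norm _))// normrN lerDl sumr_ge0//.
Qed.

Lemma formaloo_supp_le m : (forall e, formaloo (m e)) ->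
  exists N, supp_le N (tens_coef m).
Proof.
move=> /choice[N mN]; exists (\sum_e `|N e|) => a n nN; apply: (mN (std_word k a)).
apply: le_lt_trans nN; rewrite (bigD1 (std_word k a))//=.
by rewrite (le_trans (ler_norm _))// lerDl sumr_ge0.
Qed.

Lemma symsec_formal0 N x : supp_ge N x -> symsec (@formal0 R) (stens x).
Proof.
move=> xN; split; last by move=> s; rewrite tens_act_sym_tens.
by move=> e; exists N => n nN; apply: xN.
Qed.

Lemma symsec_formaloo N x : supp_le N x -> symsec (@formaloo R) (stens x).
Proof.
move=> xN; split; last by move=> s; rewrite tens_act_sym_tens.
by move=> e; exists N => n nN; apply: xN.
Qed.

End Lifts.

Section Forms.
Variables (R : realType) (k : nat) (gamma : nat -> R).
Local Notation C := (R[i]).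
Implicit Types (x y : nat -> int -> C) (n : int).
Local Notation spair := (@spair R k).
Local Notation stens := (@sym_tens R k).

Definition omega_coef (i : nat) : int -> C :=
  fun n => (n == i%:Z)%:R - (gamma i)%:C%C * (n == (k %/ 4)%N%:Z)%:R.

Definition omega_sec (i : nat) : nat -> int -> C :=
  fun a n => if a == 0%N then omega_coef i n else 0.

Lemma omega'_formE i : @omega'_form R k gamma i = stens (omega_sec i).
Proof.
apply/funext => e; apply/funext => n.
rewrite /omega'_form !omega_formE /sym_tens /omega_sec /omega_coef.
by case: eqP => _ //=; rewrite mulr0 subr0.
Qed.

Lemma supp_ge_omega i : supp_ge 0 (omega_sec i).
Proof.
move=> a n n0; rewrite /omega_sec /omega_coef; case: ifP => // _.
by rewrite !(lt_eqF (lt_le_trans n0 _))// mulr0 subr0.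
Qed.

Lemma supp_le_omega i : supp_le (i + k %/ 4)%N (omega_sec i).
Proof.
move=> a n n0; rewrite /omega_sec /omega_coef; case: ifP => // _.
by rewrite !gt_eqF ?mulr0 ?subr0//; lia.
Qed.

Lemma symsec_laurent_omega i : symsec (@laurent R) (stens (omega_sec i)).
Proof.
have [a b] := symsec_formal0 k (@supp_ge_omega i).
by have [c _] := symsec_formaloo k (@supp_le_omega i).
Qed.

Lemma solves_nabla x i : solves k x (omega_coef i) <->
  nabla (stens x) = stens (omega_sec i).
Proof.
rewrite nabla_sym_tens; split => [xi|eqx a n ak].
  by apply/funext => e; apply/funext => n; rewrite /sym_tens xi ?weight_le.
have := congr1 (fun m : tens R k => m (std_word k a) n) eqx.
by rewrite /sym_tens weight_std_word.
Qed.

(** Coordinates of the two primitives of omega'_i that exhibit it as a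
    middle class. *)
Definition mid_lift i x0 xoo := [/\ solves k x0 (omega_coef i), solves k xoo (omega_coef i),
  exists N, supp_ge N x0 & exists N, supp_le N xoo].

Lemma mid_lift_rep i x0 xoo : mid_lift i x0 xoo ->
  dRc_rep (stens x0) (stens xoo) (@omega'_form R k gamma i).
Proof.
move=> [/solves_nabla s0 /solves_nabla soo [N xN] [N' xN']].
rewrite omega'_formE; split => //; [exact: symsec_formal0 xN|
  exact: symsec_formaloo xN'|exact: symsec_laurent_omega].
Qed.

End Forms.

(** * The intersection pairing through lifts *)

Section Pairing.
Variables (R : realType) (k : nat) (gamma : nat -> R).
Local Notation C := (R[i]).
Implicit Types (x y : nat -> int -> C) (n : int).
Local Notation spair := (@spair R k).
Local Notation stens := (@sym_tens R k).
Local Notation omega_sec := (omega_sec k gamma).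
Local Notation omega_coef := (omega_coef k gamma).
Local Notation mid_lift := (mid_lift k gamma).

Lemma dR_class_refl (eta : tens R k) : symsec (@laurent R) eta -> dR_class eta eta.
Proof.
move=> s; split => //; exists (stens (fun _ _ => 0)); split.
  split; last by move=> t; rewrite tens_act_sym_tens.
  by move=> e; split; exists 0.
move=> e n; rewrite nabla_sym_tens /sym_tens /sym_conn.
by rewrite !mulr0 !addr0.
Qed.

Lemma dR_class_laurent (eta eta' : tens R k) : symsec (@laurent R) eta' ->
  dR_class eta = dR_class eta' -> exists p, [/\ (exists N, supp_ge N p), (exists N,
    supp_le N p)
   & eta' = (fun e n => eta e n + nabla (stens p) e n)].
Proof.
move=> s e; have := dR_class_refl s; rewrite -e => -[_ [m [[lm sm] mE]]].
exists (tens_coef m); split.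
- by apply: formal0_supp_ge => f; case: (lm f).
- by apply: formaloo_supp_le => f; case: (lm f).
by rewrite -sym_tensK//; apply/funext => f; apply/funext => n; exact: mE.
Qed.

Lemma dR_class_omega_sec i (eta : tens R k) : symsec (@laurent R) eta ->
  dR_class (@omega'_form R k gamma i) = dR_class eta ->
  exists p, [/\ (exists N, supp_ge N p), (exists N, supp_le N p)
   & eta = stens (fun a n => omega_sec i a n + 1 * sym_conn k p a n)].
Proof.
move=> s /(dR_class_laurent s) [p [lp hp ->]]; exists p; split => //.
rewrite omega'_formE nabla_sym_tens; apply/funext => e; apply/funext => n.
by rewrite /sym_tens mul1r.
Qed.

Lemma spairDr (c : C) x y y' : tame y x -> tame y' x ->
  spair x (fun a n => y a n + c * y' a n) = spair x y + c * spair x y'.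
Proof.
move=> t t'; have tC u v : tame u v -> tame v u.
  by case=> M m; exists M.+1; apply: supp_compat2_sym.
rewrite spairC; last by apply: tC; apply: tameDl.
rewrite spairDl// mulrDr mulrCA -!spairC//; exact: tC.
Qed.

Lemma supp_ge_lin N N' (c : C) x x' : supp_ge N x -> supp_ge N' x' ->
  supp_ge (- (`|N| + `|N'|)) (fun a n => x a n + c * x' a n).
Proof. by move=> xN xN' a n nN; rewrite xN ?xN' ?mulr0 ?addr0//; lia. Qed.

Lemma supp_le_lin N N' (c : C) x x' : supp_le N x -> supp_le N' x' ->
  supp_le (`|N| + `|N'|) (fun a n => x a n + c * x' a n).
Proof. by move=> xN xN' a n nN; rewrite xN ?xN' ?mulr0 ?addr0//; lia. Qed.

Lemma sym_connD (c : C) x x' a n :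
  sym_conn k (fun a n => x a n + c * x' a n) a n
  = sym_conn k x a n + c * sym_conn k x' a n.
Proof. by rewrite /sym_conn; ring. Qed.

(** The value does not depend on the representatives.  Changing the first
    class by nabla p changes both primitives by the same Laurent section p,
    which cancels in the difference of the two residues; changing the second
    form by nabla q contributes, by flatness, the residue at 0 and the one at
    infinity of the same Laurent pairing, which cancel as well. *)
Lemma dR_mid_pairing_eval i j v :
  (exists x0 xoo, mid_lift i x0 xoo) -> (exists x0 xoo, mid_lift j x0 xoo) ->
  (forall x0 xoo, mid_lift i x0 xoo ->
     spair x0 (omega_sec j) - spair xoo (omega_sec j) = v) ->
  S_mid k gamma i j = v.
Proof.
move=> [x0 [xoo li]] [y0 [yoo lj]] value; rewrite /S_mid /dR_mid_pairing ifT; last first.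
  apply/asboolP; split; [exists (stens x0), (stens xoo)|exists (stens y0), (stens yoo)].
    by exists (@omega'_form R k gamma i); split => //; exact: mid_lift_rep.
  by exists (@omega'_form R k gamma j); split => //; exact: mid_lift_rep.
set P := dR_pairing_value _ _.
have Pv c : P c -> c = v.
  move=> [m0 [moo [eta [omega [rep ei so ej ->]]]]].
  case: rep => -[lm0 sm0] [lmoo smoo] seta nm0 nmoo.
  have [N0 N0m] := formal0_supp_ge lm0; have [Noo Noom] := formaloo_supp_le lmoo.
  have [p [[Np lp] [Np' hp] pE]] := dR_class_omega_sec seta ei.
  have [q [[Nq lq] [Nq' hq] qE]] := dR_class_omega_sec so ej.
  rewrite (sym_tensK sm0) (sym_tensK smoo) in nm0 nmoo *.
  move: (tens_coef m0) (tens_coef moo) N0m Noom nm0 nmoo => u0 uoo N0m Noom nm0 nmoo.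
  have conn (x : nat -> int -> C) : nabla (stens x) = eta ->
      forall a n, (a <= k)%N -> sym_conn k x a n
         = omega_sec i a n + 1 * sym_conn k p a n.
    move=> xE a n ak; have := congr1 (fun m : tens R k => m (std_word k a) n) xE.
    by rewrite nabla_sym_tens pE /sym_tens weight_std_word.
  have l' : mid_lift i (fun a n => u0 a n + (-1) * p a n)
    (fun a n => uoo a n + (-1) * p a n).
    split.
    - by move=> a n ak; rewrite sym_connD conn// /omega_sec; case: ifP => _; ring.
    - by move=> a n ak; rewrite sym_connD conn// /omega_sec; case: ifP => _; ring.
    - by exists (- (`|N0| + `|Np|)); exact: supp_ge_lin.
    - by exists (`|Noo| + `|Np'|); exact: supp_le_lin.
  rewrite -(value _ _ l').
  have lw := @supp_ge_omega R k gamma; have hw := @supp_le_omega R k gamma.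
  have lcq := supp_ge_conn k lq; have hcq := supp_le_conn k hq.
  have lcp := supp_ge_conn k lp; have hcp := supp_le_conn k hp.
  rewrite /res0 /resoo qE !alg_pairing_res; last 2 first.
  - by apply: tame_supp_le Noom _; apply: supp_le_lin (hw j) hcq.
  - by apply: tame_supp_ge N0m _; apply: supp_ge_lin (lw j) lcq.
  rewrite (@spairDr _ u0); [|exact: tame_supp_ge (lw j) N0m|exact: tame_supp_ge lcq N0m].
  rewrite (@spairDr _ uoo); [|exact: tame_supp_le (hw j) Noom|exact: tame_supp_le hcq Noom].
  have adj0 : spair u0 (sym_conn k q) =
      - spair (fun a n => omega_sec i a n + 1 * sym_conn k p a n) q.
    rewrite -(eq_spairl q (conn _ nm0)) spair_conn ?opprK//.
    + exact: tame_supp_ge N0m lq.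
    + exact: tame_supp_ge (supp_ge_conn k N0m) lq.
    + exact: tame_supp_ge N0m lcq.
  have adjoo : spair uoo (sym_conn k q) =
      - spair (fun a n => omega_sec i a n + 1 * sym_conn k p a n) q.
    rewrite -(eq_spairl q (conn _ nmoo)) spair_conn ?opprK//.
    + exact: tame_supp_le Noom hq.
    + exact: tame_supp_le (supp_le_conn k Noom) hq.
    + exact: tame_supp_le Noom hcq.
  rewrite adj0 adjoo !spairDl; first ring.
  - exact: tame_supp_le Noom (hw j).
  - exact: tame_supp_le hp (hw j).
  - exact: tame_supp_ge N0m (lw j).
  - exact: tame_supp_ge lp (lw j).
  - exact: tame_supp_ge (lw i) lq.
  - exact: tame_supp_ge lcp lq.
apply: Pv; case: xgetP => // h; exfalso.
apply: (h (res0 (alg_pairing (stens x0) (@omega'_form R k gamma j))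
        + resoo (alg_pairing (stens xoo) (@omega'_form R k gamma j)))).
exists (stens x0), (stens xoo), (@omega'_form R k gamma i), (@omega'_form R k gamma j).
split => //; first exact: mid_lift_rep.
by rewrite omega'_formE; exact: symsec_laurent_omega.
Qed.

(** Writing the second form as nabla of its own primitive at 0 and at
    infinity, flatness moves the connection to the first primitive. *)
Lemma spair_skew i j x0 xoo y0 yoo : mid_lift i x0 xoo -> mid_lift j y0 yoo ->
  spair x0 (omega_sec j) - spair xoo (omega_sec j)
  = - (-1) ^+ k * (spair y0 (omega_sec i) - spair yoo (omega_sec i)).
Proof.
move=> [sx0 sxoo [N0 lx0] [Noo hxoo]] [sy0 syoo [N0' ly0] [Noo' hyoo]].
have solvesE x l : solves k x (omega_coef l) -> forall a n, (a <= k)%N ->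
  omega_sec l a n = sym_conn k x a n by move=> s a n ak; rewrite s.
have lw := @supp_ge_omega R k gamma; have hw := @supp_le_omega R k gamma.
rewrite (eq_spairr x0 (solvesE _ _ sy0)) (eq_spairr xoo (solvesE _ _ syoo)).
have -> : spair x0 (sym_conn k y0) = - spair (sym_conn k x0) y0.
  rewrite spair_conn ?opprK//.
  - exact: tame_supp_ge lx0 ly0.
  - exact: tame_supp_ge (supp_ge_conn k lx0) ly0.
  - exact: tame_supp_ge lx0 (supp_ge_conn k ly0).
have -> : spair xoo (sym_conn k yoo) = - spair (sym_conn k xoo) yoo.
  rewrite spair_conn ?opprK//.
  - exact: tame_supp_le hxoo hyoo.
  - exact: tame_supp_le (supp_le_conn k hxoo) hyoo.
  - exact: tame_supp_le hxoo (supp_le_conn k hyoo).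
rewrite -(eq_spairl y0 (solvesE _ _ sx0)) -(eq_spairl yoo (solvesE _ _ sxoo)).
rewrite (spairC _ (tame_supp_ge (lw i) ly0)) (spairC _ (tame_supp_le (hw i) hyoo)).
ring.
Qed.

Lemma zres_delta (f : int -> C) (l : int) : zres f (fun n => (n == l)%:R) = f (- l).
Proof.
rewrite /zres /zmul -(@fsbig_widen _ _ _ _ [set - l]%classic setT) //=.
  by rewrite fsbig_set1 opprK add0r eqxx mulr1.
move=> m [_ /= ml]; rewrite sub0r (_ : _ == _ = false) ?mulr0//.
by apply: contra_notF ml => /eqP <-; rewrite opprK.
Qed.

(** z^j v_0^k pairs only with the coordinate of v_1^k. *)
Lemma spair_omega_sec x j : gamma j = 0 ->
  spair x (omega_sec j) = (-1) ^+ k * x k (- j%:Z).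
Proof.
move=> gj; rewrite /spair big_ord_recr big1 ?add0r => [|a _] /=; last first.
  have -> : omega_sec j (k - a)%N = fun=> 0.
    apply/funext => n; rewrite /omega_sec ifF//.
    by have := ltn_ord a; case: eqP => //; lia.
  by rewrite /zres /zmul fsbig1 ?mulr0// => l _; rewrite mulr0.
rewrite subnn binn mulr1 (_ : omega_sec j 0%N = fun n => (n == j%:Z)%:R).
  by rewrite zres_delta add0r.
by apply/funext => n; rewrite /omega_sec eqxx /omega_coef gj mul0r subr0.
Qed.

(** At 0 the coefficient of z^(-j) vanishes, at infinity it is given by the
    equation at z^(K-j), where K - j >= i.  For k even the bound 4 j < k says
    that this equation lies above the one of the flat section, and that the
    correction gamma_i z^(k/4) is invisible to it. *)
Lemma mid_lift_value i j x0 xoo : mid_lift i x0 xoo -> gamma j = 0 ->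
  (gamma i = 0 \/ (4 * j < k)%N) -> (odd k || (4 * j < k)%N) ->
  (1 <= j)%N -> (i + j <= uphalf k)%N ->
  spair x0 (omega_sec j) - spair xoo (omega_sec j)
  = - (k`!)%:R / lead_oo C k i%:Z * ((i + j)%N == uphalf k)%:R.
Proof.
move=> [s0 soo [N lx0] [M hxoo]] gj gi kj j1 ij.
rewrite !spair_omega_sec//.
rewrite (solves_low s0 (lx0 k)); [|by move=> n;
  exact: (@supp_ge_omega R k gamma i 0%N)|lia].
pose e : int := (uphalf k)%:Z - j%:Z.
have -> : - j%:Z = e - (uphalf k)%:Z by rewrite /e; lia.
have ine : i%:Z <= e by rewrite /e; lia.
have k4e n : e <= n -> ((4 * j < k)%N) -> n != (k %/ 4)%N.
  by rewrite /e => en jk; apply/eqP; have := uphalf_half k; lia.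
rewrite (solves_high soo (hxoo k)) => [|n en|n en]; last 2 first.
- rewrite /omega_coef gt_eqF//; last by lia.
  case: gi => [->|jk]; first by rewrite mul0r subr0.
  by rewrite (negbTE (k4e n _ jk)) ?mulr0 ?subr0//; lia.
- case/orP: kj => jk; last by rewrite negb_and k4e ?orbT.
  by rewrite negb_and; apply/orP; left; apply: contraL jk => /dvdnP[q ->]; lia.
have -> : omega_coef i e = ((i + j)%N == uphalf k)%:R.
  rewrite /omega_coef (_ : (e == i) = ((i + j)%N == uphalf k)); last by apply/eqP/eqP; lia.
  case: gi => [->|jk]; first by rewrite mul0r subr0.
  by rewrite (negbTE (k4e e _ jk)) ?mulr0 ?subr0//; lia.
case: eqP => [ijk|_]; last by rewrite !mulr0 subr0.
have <- : e = i by rewrite /e; lia.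
by rewrite mulr0 sub0r !mulr1 !mulrA -exprMn mulrN1 opprK expr1n mul1r mulNr.
Qed.

End Pairing.

(** * The Bessel function I_0 *)

Section I0.
Import numFieldNormedType.Exports.
Local Open Scope classical_set_scope.
Variable R : realType.
Implicit Types (z t : R).

Definition i0_coef (n : nat) : R := (n`!)%:R^-1 ^+ 2.
(** The coefficients of z d/dz applied to the series of I_0 in z = t^2/4. *)
Definition i0_euler_coef (n : nat) : R := n%:R * i0_coef n.

(** Convergence everywhere, for a series and its first two derived series, is
    all that term-by-term differentiation requires. *)
Lemma cvg_pseries_le_exp (c : nat -> R) : (forall n, 0 <= c n <= (n`!)%:R^-1) ->
  forall z, cvgn (pseries c z).
Proof.
move=> cP z; apply: normed_cvg; apply: (@series_le_cvg _ _ (exp_coeff `|z|)).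
- by move=> n /=.
- by move=> n; apply: exp_coeff_ge0.
- move=> n; rewrite exp_coeffE /= normrM normrX ler_wpM2r ?exprn_ge0//.
  by have /andP[c0 cn] := cP n; rewrite ger0_norm.
exact: is_cvg_series_exp_coeff.
Qed.

Lemma inv_fact_le n m : 0 <= ((n`!)%:R^-1 / (m`!)%:R : R) <= (n`!)%:R^-1.
Proof.
rewrite mulr_ge0 ?invr_ge0//= ler_piMr ?invr_ge0//.
by rewrite invf_le1 ?ler1n ?ltr0n fact_gt0.
Qed.

Lemma diffs_i0_coef n : pseries_diffs i0_coef n = (n`!)%:R^-1 / (n.+1`!)%:R.
Proof.
rewrite /pseries_diffs /i0_coef factS natrM; field.
by rewrite ?nat1r !pnatr_eq0 -!lt0n fact_gt0.
Qed.

Lemma diffs2_i0_coef n :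
  pseries_diffs (pseries_diffs i0_coef) n = (n`!)%:R^-1 / (n.+2`!)%:R.
Proof.
rewrite /pseries_diffs -/(pseries_diffs i0_coef n.+1) diffs_i0_coef.
rewrite (factS n) natrM; field.
by rewrite ?nat1r !pnatr_eq0 -!lt0n !fact_gt0.
Qed.

Lemma diffs_i0_euler_coef : pseries_diffs i0_euler_coef = i0_coef.
Proof.
apply/funext => n; rewrite /pseries_diffs /i0_euler_coef /i0_coef factS natrM.
by field; rewrite ?nat1r !pnatr_eq0 -!lt0n !fact_gt0.
Qed.

Lemma i0_euler_coefP n : 0 <= i0_euler_coef n <= (n`!)%:R^-1.
Proof.
case: n => [|n]; first by rewrite /i0_euler_coef mul0r lexx invr_ge0 ler0n.
rewrite /i0_euler_coef -/(pseries_diffs i0_coef n) diffs_i0_coef mulrC.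
exact: inv_fact_le.
Qed.

Definition i0_series z := limn (pseries i0_coef z).
Definition i0_euler_series z := limn (pseries i0_euler_coef z).

Lemma cvg_i0_coef z : cvgn (pseries i0_coef z).
Proof. by apply: cvg_pseries_le_exp => n; exact: inv_fact_le. Qed.

Lemma cvg_diffs_i0_coef z : cvgn (pseries (pseries_diffs i0_coef) z).
Proof. by apply: cvg_pseries_le_exp => n; rewrite diffs_i0_coef; exact: inv_fact_le. Qed.

Lemma cvg_diffs2_i0_coef z : cvgn (pseries (pseries_diffs (pseries_diffs i0_coef)) z).
Proof. by apply: cvg_pseries_le_exp => n; rewrite diffs2_i0_coef; exact: inv_fact_le. Qed.

Lemma cvg_i0_euler_coef z : cvgn (pseries i0_euler_coef z).
Proof. by apply: cvg_pseries_le_exp => n; exact: i0_euler_coefP. Qed.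

Lemma i0_euler_seriesE z :
  i0_euler_series z = z * limn (pseries (pseries_diffs i0_coef) z).
Proof.
apply/cvg_lim => //; rewrite -cvg_shiftS /=.
rewrite (_ : (fun n => _) = (fun n => z * pseries (pseries_diffs i0_coef) z n)).
  by apply: cvgMr; exact: cvg_diffs_i0_coef.
apply/funext => n; rewrite /pseries /series /= big_nat_recl//.
rewrite /i0_euler_coef mul0r mul0r add0r mulr_sumr; apply: eq_bigr => i _.
by rewrite /pseries_diffs exprS; ring.
Qed.

Lemma is_derive_i0_series z : is_derive z (1 : R) i0_series
  (limn (pseries (pseries_diffs i0_coef) z)).
Proof.
apply: (@pseries_snd_diffs _ _ (`|z| + 1)).
- exact: cvg_i0_coef.
- exact: cvg_diffs_i0_coef.
- exact: cvg_diffs2_i0_coef.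
- by rewrite [ltRHS]ger0_norm ?addr_ge0// ltrDl.
Qed.

Lemma is_derive_i0_euler_series z :
  is_derive z (1 : R) i0_euler_series (i0_series z).
Proof.
rewrite /i0_series -diffs_i0_euler_coef.
apply: (@pseries_snd_diffs _ _ (`|z| + 1)).
- exact: cvg_i0_euler_coef.
- by rewrite diffs_i0_euler_coef; exact: cvg_i0_coef.
- by rewrite diffs_i0_euler_coef; exact: cvg_diffs_i0_coef.
- by rewrite [ltRHS]ger0_norm ?addr_ge0// ltrDl.
Qed.

Lemma i0_series_ge1 z : 0 <= z -> 1 <= i0_series z.
Proof.
move=> z0; have -> : 1 = pseries i0_coef z 1%N.
  by rewrite /pseries /series /= big_nat1 /i0_coef expr0 invr1 expr1n mulr1.
apply: nondecreasing_cvgn_le; last exact: cvg_i0_coef.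
apply/nondecreasing_seqP => n; rewrite /pseries /series /= big_nat_recr//= lerDl.
by rewrite mulr_ge0 ?exprn_ge0// ?invr_ge0.
Qed.

Lemma i0_euler_series_ge0 z : 0 <= z -> 0 <= i0_euler_series z.
Proof.
move=> z0; apply: limr_ge; first exact: cvg_i0_euler_coef.
apply: nearW => n; rewrite /pseries /series /= sumr_ge0// => i _.
by rewrite !mulr_ge0 ?exprn_ge0// ?invr_ge0.
Qed.

(** z d/dz I_0 at z = t^2/4, the I_0-solution paired with v_1. *)
Definition I0_euler t : R := i0_euler_series (t ^+ 2 / 4).

Lemma besselI0E t : besselI0 t = i0_series (t ^+ 2 / 4).
Proof.
rewrite /besselI0 /i0_series /pseries; congr (limn (series _)).
apply/funext => n; rewrite /i0_coef /= exprM mulrC exprVn; congr (_^-1 * _ ^+ _).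
by field.
Qed.

Lemma is_derive_besselI0 t : 0 < t ->
  is_derive t 1 (@besselI0 R) (2 / t * I0_euler t).
Proof.
move=> t0; rewrite (_ : @besselI0 R = i0_series \o (fun t => t ^+ 2 / 4)); last first.
  by apply/funext => u; rewrite besselI0E.
apply: is_derive_eq.
  apply: is_derive1_comp; exact: is_derive_i0_series.
rewrite /I0_euler i0_euler_seriesE /GRing.scale /=; field.
by rewrite gt_eqF.
Qed.

Lemma is_derive_I0_euler t : is_derive t 1 I0_euler (t / 2 * besselI0 t).
Proof.
rewrite besselI0E; apply: is_derive_eq.
  by apply: is_derive1_comp; exact: is_derive_i0_euler_series.
by rewrite /GRing.scale /=; field.
Qed.

Lemma besselI0_ge1 t : 1 <= besselI0 t.
Proof. by rewrite besselI0E i0_series_ge1// mulr_ge0// sqr_ge0. Qed.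

Lemma I0_euler_ge0 t : 0 <= I0_euler t.
Proof. by rewrite i0_euler_series_ge0// mulr_ge0// sqr_ge0. Qed.

Lemma besselI0_cvg0 : besselI0 t @[t --> 0^'+] --> (1 : R).
Proof.
have i00 : i0_series 0 = 1.
  apply/cvg_lim => //; rewrite -cvg_shiftS /=.
  rewrite (_ : (fun n => _) = fun=> 1); first exact: cvg_cst.
  apply/funext => n; rewrite /pseries /series /= big_nat_recl// big1 => [|i _].
    by rewrite /i0_coef !expr0 invr1 expr1n mulr1 addr0.
  by rewrite expr0n mulr0.
have I00 : besselI0 0 = 1 :> R by rewrite besselI0E expr0n mul0r.
have [d0 _] : is_derive (0 : R) 1 (i0_series \o (fun t => t ^+ 2 / 4))
   (0 * limn (pseries (pseries_diffs i0_coef) (0 ^+ 2 / 4))).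
  apply: is_derive_eq.
    by apply: is_derive1_comp; exact: is_derive_i0_series.
  by rewrite /GRing.scale /= mul0r; ring.
rewrite -I00; apply: cvg_at_right_filter.
rewrite (_ : @besselI0 R = i0_series \o (fun t => t ^+ 2 / 4)); last first.
  by apply/funext => u; rewrite besselI0E.
by apply: differentiable_continuous; apply/derivable1_diffP.
Qed.

(** Coefficientwise n / (n!)^2 <= 1 / ((n-1)!)^2; this makes the product
    with K_0 vanish at t = 0. *)
Lemma I0_euler_le t : I0_euler t <= t ^+ 2 / 4 * besselI0 t.
Proof.
rewrite besselI0E /I0_euler i0_euler_seriesE; apply: ler_wpM2l.
  by rewrite divr_ge0// sqr_ge0.
apply: lim_series_le; [exact: cvg_diffs_i0_coef|exact: cvg_i0_coef|move=> i].
apply: ler_wpM2r; first by rewrite exprn_ge0// divr_ge0// sqr_ge0.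
rewrite diffs_i0_coef /i0_coef expr2 ler_wpM2l ?invr_ge0//.
by rewrite lef_pV2 ?posrE ?ltr0n ?fact_gt0// ler_nat factS leq_pmull.
Qed.

End I0.

(** * The Bessel function K_0 *)

Section K0.
Import numFieldNormedType.Exports.
Local Open Scope classical_set_scope.
Variable R : realType.
Implicit Types (t u : R) (n : nat).
Local Notation mu := (@lebesgue_measure R).
Local Notation halfline := (`[(0 : R)%R, +oo[%classic).

(** For a nonnegative integrand the fundamental theorem on the half-line
    gives integrability for free. *)
Lemma ge0_FTC_halfline (f F : R -> R) (l : R) : continuous f ->
  (forall u, 0 <= u -> 0 <= f u) -> (forall u, is_derive u 1 F (f u)) ->
  F u @[u --> +oo] --> l ->
  mu.-integrable halfline (EFin \o f) /\ \int[mu]_(u in halfline) f u = l - F 0.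
Proof.
move=> cf f0 dF Fl.
have intE : (\int[mu]_(u in halfline) (f u)%:E = l%:E - (F 0)%:E)%E.
  apply: ge0_continuous_FTC2y => //.
  - exact: continuous_subspaceT.
  - apply: cvg_at_right_filter.
    by apply: differentiable_continuous; apply/derivable1_diffP.
  - by move=> u _; rewrite derive1E derive_val.
split; last by rewrite /Rintegral intE.
apply/integrableP; split.
  apply/measurable_EFinP; apply: measurable_funTS.
  exact: continuous_measurable_fun.
apply: le_lt_trans (ltry (l - F 0)); rewrite EFinB -intE le_eqVlt.
apply/orP; left; apply/eqP; apply: eq_integral => u.
by rewrite inE /= in_itv /= andbT => u0; rewrite ger0_norm ?f0.
Qed.

Lemma integrable_expRN : mu.-integrable halfline (EFin \o (fun u => expR (- u)))
  /\ \int[mu]_(u in halfline) expR (- u) = 1.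
Proof.
have [||||i e] := @ge0_FTC_halfline (fun u => expR (- u)) (fun u => - expR (- u)) 0.
- move=> u; apply: (@continuous_comp _ _ _ -%R expR); [exact: opp_continuous|].
  exact: continuous_expR.
- by move=> u _; rewrite expR_ge0.
- by move=> u; apply: is_derive_eq; rewrite /GRing.scale /=; ring.
- rewrite -oppr0; apply: cvgN; exact: cvgr_expR.
by rewrite e sub0r opprK oppr0 expR0.
Qed.

Definition coshR u : R := (expR u + expR (- u)) / 2.
Definition sinhR u : R := (expR u - expR (- u)) / 2.

Lemma coshR_sinhR u : coshR u ^+ 2 - sinhR u ^+ 2 = 1.
Proof.
have := expRxMexpNx_1 u; rewrite /coshR /sinhR => e.
transitivity (expR u * expR (- u)); [by field|exact: e].
Qed.

Lemma coshR_sinh_exp u : coshR u = sinhR u + expR (- u).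
Proof. by rewrite /coshR /sinhR; field. Qed.

Lemma coshR_gt0 u : 0 < coshR u.
Proof. by rewrite divr_gt0// addr_gt0// expR_gt0. Qed.

Lemma coshR_ge u : expR u / 2 <= coshR u.
Proof. by rewrite ler_pM2r// lerDl expR_ge0. Qed.

Lemma coshR_ge1 u : 1 <= coshR u.
Proof.
have := coshR_sinhR u; have := coshR_gt0 u; have := sqr_ge0 (sinhR u).
by move: (coshR u) (sinhR u) => c s; nra.
Qed.

Lemma sinhR_ge0 u : 0 <= u -> 0 <= sinhR u.
Proof.
by move=> u0; rewrite divr_ge0// subr_ge0 ler_expR; lra.
Qed.

Lemma is_derive_coshR u : is_derive u 1 coshR (sinhR u).
Proof.
by apply: is_derive_eq; rewrite /sinhR /GRing.scale /=; field.
Qed.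

Lemma is_derive_sinhR u : is_derive u 1 sinhR (coshR u).
Proof.
by apply: is_derive_eq; rewrite /coshR /GRing.scale /=; field.
Qed.

Lemma continuous_coshR : continuous coshR.
Proof.
move=> u; apply: differentiable_continuous; apply/derivable1_diffP.
by case: (is_derive_coshR u).
Qed.

Lemma continuous_sinhR : continuous sinhR.
Proof.
move=> u; apply: differentiable_continuous; apply/derivable1_diffP.
by case: (is_derive_sinhR u).
Qed.

Definition bkern n t u : R := coshR u ^+ n * expR (- t * coshR u).

Lemma bkern_gt0 n t u : 0 < bkern n t u.
Proof. by rewrite mulr_gt0 ?exprn_gt0 ?coshR_gt0 ?expR_gt0. Qed.

Definition bkern_bound n t : R := 2 * (n.+1`!)%:R / t ^+ n.+1.

(** exp y >= y^(n+1) / (n+1)! with y = t cosh u bounds the kernel by a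
    multiple of 1 / cosh u, hence of exp(-u). *)
Lemma bkern_le n t u : 0 < t -> bkern n t u <= bkern_bound n t * expR (- u).
Proof.
move=> t0; have c0 := coshR_gt0 u; have y0 : 0 <= t * coshR u by rewrite mulr_ge0// ltW.
have := expR_ge1Dxn n y0; rewrite /bkern mulNr expRN => ey.
have f0 : 0 < (n.+1`!)%:R :> R by rewrite ltr0n fact_gt0.
have e0 := expR_gt0 (t * coshR u).
have tn : 0 < t ^+ n.+1 by rewrite exprn_gt0.
have {ey}ey : t ^+ n.+1 * coshR u ^+ n.+1 <= (n.+1`!)%:R * expR (t * coshR u).
  rewrite -exprMn [leRHS]mulrC -ler_pdivrMr// (le_trans _ ey)//.
  by rewrite lerDr.
have eu := expR_gt0 u; have cu := coshR_ge u.
rewrite expRN /bkern_bound ler_pdivrMr// mulrAC ler_pdivlMr// mulrAC ler_pdivlMr//.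
rewrite -subr_ge0; rewrite -subr_ge0 in ey; rewrite -subr_ge0 in cu.
have cn : 0 <= coshR u ^+ n * t ^+ n.+1 by rewrite mulr_ge0 ?exprn_ge0 ?ltW.
move: ey cu; rewrite (exprS (coshR u)).
set E := expR (t * _); set c := coshR u in cn *; set T := t ^+ _ in cn *; set f := _%:R.
set cc := c ^+ n in cn *; set U := expR u.
move=> ey cu; have := mulr_ge0 cn cu => h; lra.
Qed.

Lemma continuous_bkern n t : continuous (bkern n t).
Proof.
move=> u; apply: cvgM.
  apply: (@continuous_comp _ _ _ coshR (fun x => x ^+ n)); first exact: continuous_coshR.
  exact: exprn_continuous.
apply: (@continuous_comp _ _ _ (fun u => - t * coshR u) expR).
  by apply: cvgMr; exact: continuous_coshR.
exact: continuous_expR.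
Qed.

Lemma integrable_bkern n t : 0 < t -> mu.-integrable halfline (EFin \o bkern n t).
Proof.
move=> t0; apply: (@le_integrable _ _ _ mu _ _ _ (EFin \o (fun u
  => bkern_bound n t * expR (- u)))) => //.
- apply/measurable_EFinP; apply: measurable_funTS.
  by apply: continuous_measurable_fun; exact: continuous_bkern.
- move=> u _; rewrite lee_fin ger0_norm; last exact/ltW/bkern_gt0.
  rewrite ger0_norm ?bkern_le//.
  by rewrite mulr_ge0 ?expR_ge0// divr_ge0 ?exprn_ge0 ?mulr_ge0// ltW.
have [ie _] := integrable_expRN.
have := integrableZl _ (bkern_bound n t) ie.
by apply.
Qed.

Lemma bkern_cvg0 n t : 0 < t -> bkern n t u @[u --> +oo] --> (0 : R).
Proof.
move=> t0; apply: (@squeeze_cvgr _ _ _ _ (fun=> 0) (fun u => bkern_bound n t * expR (- u))).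
- by apply: nearW => u; rewrite ltW ?bkern_gt0//= bkern_le.
- exact: cvg_cst.
- by rewrite -[X in _ --> X](mulr0 (bkern_bound n t)); apply: cvgMr; exact: cvgr_expR.
Qed.

Lemma integrable_lin (f g : R -> R) (a b : R) :
  mu.-integrable halfline (EFin \o f) -> mu.-integrable halfline (EFin \o g) ->
  mu.-integrable halfline (EFin \o (fun u => a * f u + b * g u)) /\
  \int[mu]_(u in halfline) (a * f u + b * g u)
  = a * \int[mu]_(u in halfline) f u + b * \int[mu]_(u in halfline) g u.
Proof.
move=> fi gi.
have afi : mu.-integrable halfline (EFin \o (fun u => a * f u)).
  by have := integrableZl _ a fi; apply.
have bgi : mu.-integrable halfline (EFin \o (fun u => b * g u)).
  by have := integrableZl _ b gi; apply.
split; last by rewrite RintegralD// !RintegralZl.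
by have := integrableD _ afi bgi; apply.
Qed.

(** This is (-d/dt)^n K_0, not the Bessel function of order n (they agree
    for n = 0 and n = 1). *)
Definition besselK n t : R := \int[mu]_(u in halfline) bkern n t u.

Lemma besselK0E t : besselK0 t = besselK 0 t.
Proof. by apply: eq_Rintegral => u _; rewrite /bkern expr0 mul1r. Qed.

Lemma is_derive_bkern n t u :
  is_derive t 1 (fun t => bkern n t u) (- bkern n.+1 t u).
Proof.
apply: is_derive_eq; rewrite /bkern /GRing.scale /= exprS; ring.
Qed.

(** Differentiation under the integral sign; on ]t/2, 2t[ the derivative is
    dominated by the kernel at t/2. *)
Lemma is_derive_besselK n t : 0 < t ->
  is_derive t 1 (besselK n) (- besselK n.+1 t).
Proof.
move=> t0; have It : `]t / 2, t * 2[%classic t by rewrite /= in_itv /=; lra.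
have intf x : `]t / 2, t * 2[%classic x -> mu.-integrable halfline (EFin \o bkern n x).
  by rewrite /= in_itv /= => /andP[x0 _]; apply: integrable_bkern; lra.
have derf (x u : R) : derivable ((bkern n) ^~ u) x 1.
  by case: (is_derive_bkern n x u).
have dE (x u : R) : partial1of2 (bkern n) x u = - bkern n.+1 x u.
  by rewrite partial1of2E; have [_ ->] := is_derive_bkern n x u.
have G0 u : 0 <= bkern n.+1 (t / 2) u by rewrite ltW// bkern_gt0.
have iG : mu.-integrable halfline (EFin \o bkern n.+1 (t / 2)).
  by apply: integrable_bkern; lra.
have Gub (x u : R) : `]t / 2, t * 2[%classic x -> halfline u ->
    `|partial1of2 (bkern n) x u| <= bkern n.+1 (t / 2) u.
  rewrite /= in_itv /= => /andP[x0 _] _; rewrite dE normrN ger0_norm;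
    last exact/ltW/bkern_gt0.
  rewrite /bkern; apply: ler_wpM2l; first by rewrite exprn_ge0// ltW ?coshR_gt0.
  by rewrite ler_expR; have := coshR_gt0 u; nra.
have derf1 (x u : R) : `]t / 2, t * 2[%classic x -> halfline u ->
    derivable ((bkern n) ^~ u) x 1 by [].
apply: DeriveDef.
  exact: (@derivable_under_integral R _ _ mu (bkern n) halfline (measurable_itv _) _ _ _
    It intf derf1 _ G0 iG Gub).
rewrite -derive1E (@differentiation_under_integral R _ _ mu (bkern n) halfline
  (measurable_itv _) _ _ _ It intf derf1 _ G0 iG Gub).
rewrite (@eq_Rintegral _ _ _ mu halfline (fun u => -1 * bkern n.+1 t u)) => [|u _];
  last by rewrite dE mulN1r.
by rewrite RintegralZl ?mulN1r//; exact: integrable_bkern.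
Qed.

Lemma besselK_ge0 n t : 0 <= besselK n t.
Proof. by apply: Rintegral_ge0 => u _; rewrite ltW// bkern_gt0. Qed.

(** cosh u = sinh u + exp(-u): the first part integrates exactly to
    exp(-t), the second is at most exp(-u).  Both bounds tend to 1 at t = 0,
    which normalizes the Wronskian. *)
Lemma besselK1_bounds t : 0 < t -> expR (- t) <= t * besselK 1 t <= expR (- t) + t.
Proof.
move=> t0.
have [||||ish Ish] := @ge0_FTC_halfline
    (fun u => t * (sinhR u * expR (- t * coshR u))) (fun u => - expR (- t * coshR u)) 0.
- move=> u; apply: cvgMr; apply: cvgM; first exact: continuous_sinhR.
  by have := @continuous_bkern 0 t u; rewrite /bkern; under eq_fun do rewrite expr0 mul1r.
- by move=> u u0; exact: mulr_ge0 (ltW t0) (mulr_ge0 (sinhR_ge0 u0) (expR_ge0 _)).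
- move=> u; have dc := is_derive_coshR u.
  by apply: is_derive_eq; rewrite /GRing.scale /=; ring.
- rewrite -oppr0; apply: cvgN; have := bkern_cvg0 0 t0; rewrite /bkern.
  by under eq_fun do rewrite expr0 mul1r.
have ch0 : coshR 0 = 1 by rewrite /coshR oppr0 expR0; field.
rewrite sub0r opprK ch0 mulr1 in Ish.
have [ie Ie] := integrable_expRN.
rewrite -Ish /besselK -RintegralZl//; last exact: integrable_bkern.
apply/andP; split.
  apply: le_Rintegral => //.
    by have := integrableZl _ t (integrable_bkern 1 t0); apply.
  move=> u _; apply: ler_wpM2l; first exact: ltW.
  rewrite /bkern expr1 ler_wpM2r ?expR_ge0//.
  by rewrite coshR_sinh_exp lerDl expR_ge0.
rewrite -[X in _ + X]mulr1 -Ie.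
rewrite -[X in X + _]mul1r; have [il <-] := integrable_lin 1 t ish ie.
apply: le_Rintegral => //.
  by have := integrableZl _ t (integrable_bkern 1 t0); apply.
move=> u _; rewrite mul1r -mulrDr; apply: ler_wpM2l; first exact: ltW.
rewrite /bkern expr1 {1}coshR_sinh_exp.
rewrite mulrDl lerD2l ler_piMr ?expR_ge0//.
by rewrite expR_le1 mulNr oppr_le0 ltW// mulr_gt0// coshR_gt0.
Qed.

(** The Bessel equation, from the primitive - sinh u exp(-t cosh u) of
    (t sinh^2 u - cosh u) exp(-t cosh u). *)
Lemma besselK_recurrence t : 0 < t ->
  t * (besselK 2 t - besselK 0 t) = besselK 1 t.
Proof.
move=> t0; pose B := bkern_bound 1 t.
(* Adding B exp(-u) makes the integrand nonnegative; its own integral B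
   cancels at the end. *)
have [||||ih Ih] := @ge0_FTC_halfline
    (fun u => t * (sinhR u ^+ 2 * expR (- t * coshR u)) - bkern 1 t u + B * expR (- u))
    (fun u => - (sinhR u * expR (- t * coshR u)) - B * expR (- u)) 0.
- move=> u; apply: cvgD; last first.
    apply: cvgMr; apply: (@continuous_comp _ _ _ -%R expR); first exact: opp_continuous.
    exact: continuous_expR.
  apply: cvgB; last exact: continuous_bkern.
  apply: cvgMr; apply: cvgM.
    apply: (@continuous_comp _ _ _ sinhR (fun x => x ^+ 2)); first exact: continuous_sinhR.
    exact: exprn_continuous.
  by have := @continuous_bkern 0 t u; rewrite /bkern; under eq_fun do rewrite expr0 mul1r.
- move=> u u0; have := bkern_le 1 u t0; rewrite -/B -subr_ge0 => h.
  rewrite -addrA addr_ge0//; last by rewrite addrC.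
  exact: mulr_ge0 (ltW t0) (mulr_ge0 (sqr_ge0 _) (expR_ge0 _)).
- move=> u; have dc := is_derive_coshR u; have ds := is_derive_sinhR u.
  by apply: is_derive_eq; rewrite /bkern /GRing.scale /=; ring.
- rewrite -(subrr 0) -{2}(mulr0 B); apply: cvgB; last first.
    by apply: cvgMr; exact: cvgr_expR.
  rewrite -oppr0; apply: cvgN.
  apply: (@squeeze_cvgr _ _ _ _ (fun=> 0) (bkern 1 t)).
  + near=> u; have u0 : 0 <= u by near: u; exact: nbhs_pinfty_ge.
    rewrite (mulr_ge0 (sinhR_ge0 u0) (expR_ge0 _))/= /bkern expr1 ler_wpM2r ?expR_ge0//.
    by rewrite coshR_sinh_exp lerDl expR_ge0.
  + exact: cvg_cst.
  + exact: bkern_cvg0.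
have [ie Ie] := integrable_expRN.
have [i20 I20] := integrable_lin 1 (-1) (integrable_bkern 2 t0) (integrable_bkern 0 t0).
have [i201 I201] := integrable_lin t (-1) i20 (integrable_bkern 1 t0).
have [_ Itot] := integrable_lin 1 B i201 ie.
move: Ih; rewrite (@eq_Rintegral _ _ _ mu halfline (fun u
  => 1 * (t * (1 * bkern 2 t u + -1 * bkern 0 t u)
    + -1 * bkern 1 t u) + B * expR (- u))); last first.
  move=> u _; rewrite /bkern !expr1 expr0; have := coshR_sinhR u => e.
  have -> : sinhR u ^+ 2 = coshR u ^+ 2 - 1 by rewrite -e; ring.
  ring.
rewrite Itot I201 I20 Ie /sinhR oppr0 expR0 subrr -!/(besselK _ _).
move: (besselK 0 t) (besselK 1 t) (besselK 2 t) => k0 k1 k2 h; lra.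
Unshelve. all: by end_near. Qed.

Lemma besselK01 t : 0 < t -> besselK 0 t <= besselK 1 t.
Proof.
move=> t0; apply: le_Rintegral => //; [exact: integrable_bkern..|].
move=> u _; rewrite /bkern expr0 expr1 ler_wpM2r ?expR_ge0//; exact: coshR_ge1.
Qed.

(** From (cosh u - 1)^2 >= 0 and the Bessel equation. *)
Lemma besselK1_le t : 1 <= t -> besselK 1 t <= 2 * besselK 0 t.
Proof.
move=> t1; have t0 : 0 < t by lra.
have [i20 I20] := integrable_lin 1 1 (integrable_bkern 2 t0) (integrable_bkern 0 t0).
have [i201 I201] := integrable_lin 1 (-2) i20 (integrable_bkern 1 t0).
have : 0 <= \int[mu]_(u in halfline)
  (1 * (1 * bkern 2 t u + 1 * bkern 0 t u) + -2 * bkern 1 t u).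
  apply: Rintegral_ge0 => u _; rewrite /bkern.
  rewrite (_ : _ + _ = (coshR u - 1) ^+ 2 * expR (- t * coshR u)); last by ring.
  by rewrite mulr_ge0 ?sqr_ge0 ?expR_ge0.
rewrite I201 I20 -!/(besselK _ _); have := besselK_recurrence t0.
have := besselK_ge0 1 t.
move: (besselK 0 t) (besselK 1 t) (besselK 2 t) => k0 k1 k2 *; nra.
Qed.

End K0.

(** * Asymptotics along large arguments *)

Section Eventually.
Import numFieldNormedType.Exports.
Local Open Scope classical_set_scope.
Variable R : realType.
Implicit Types (f g : R -> R) (t T : R) (P Q : R -> Prop).

(** Properties that hold for all large t; thresholds are at least 1, so
    that t is invertible where it matters. *)
Definition for_large P := exists2 T, 1 <= T & forall t, T <= t -> P t.

Lemma for_largeI P Q : for_large P -> for_large Q -> for_large (fun t => P t /\ Q t).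
Proof.
move=> [S S1 PS] [T T1 QT]; exists (S + T); first lra.
by move=> t tST; split; [apply: PS|apply: QT]; lra.
Qed.

Lemma for_largeS P Q : (forall t, 1 <= t -> P t -> Q t) -> for_large P -> for_large Q.
Proof.
by move=> PQ [T T1 PT]; exists T => // t Tt; apply: PQ; [lra|exact: PT].
Qed.

Lemma for_largeT P : (forall t, 1 <= t -> P t) -> for_large P.
Proof. by move=> h; exists 1. Qed.

Definition vanishing f := forall e, 0 < e -> for_large (fun t => `|f t| <= e).
Definition bounded_oo f := exists2 M, 0 < M & for_large (fun t => `|f t| <= M).

Lemma vanishingP f : vanishing f <-> f t @[t --> +oo] --> 0.
Proof.
split=> [nf|/cvgr0Pnorm_le fc e e0].
  apply/cvgr0Pnorm_le => e /nf[T T1 fT]; near=> t; apply: fT.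
  by near: t; apply: nbhs_pinfty_ge; rewrite num_real.
have [S [_ fS]] := fc e e0; exists (`|S| + 1); first by have := normr_ge0 S; lra.
by move=> t St; apply: fS; have := ler_norm S; lra.
Unshelve. all: by end_near. Qed.

Lemma vanishing_bounded f : vanishing f -> bounded_oo f.
Proof. by move=> nf; exists 1 => //; exact: nf. Qed.

Lemma eq_vanishing f g : for_large (fun t => f t = g t) -> vanishing f -> vanishing g.
Proof. by move=> fg nf e /nf; move/(for_largeI fg); apply: for_largeS => t _ [<-]. Qed.

Lemma eq_bounded_oo f g : for_large (fun t => f t = g t) -> bounded_oo f -> bounded_oo g.
Proof. by move=> fg [M M0 fM]; exists M => //; move/(for_largeI fg): fM;
  apply: for_largeS => t _ [<-]. Qed.

Lemma vanishingD f g : vanishing f -> vanishing g -> vanishing (fun t => f t + g t).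
Proof.
move=> nf ng e e0; have e20 : 0 < e / 2 by lra.
have := for_largeI (nf _ e20) (ng _ e20); apply: for_largeS => t _ [fe ge].
by have := ler_normD (f t) (g t); lra.
Qed.

Lemma bounded_ooD f g : bounded_oo f -> bounded_oo g -> bounded_oo (fun t => f t + g t).
Proof.
move=> [M M0 fM] [N N0 gN]; exists (M + N); first lra.
have := for_largeI fM gN; apply: for_largeS => t _ [fe ge].
by have := ler_normD (f t) (g t); lra.
Qed.

Lemma vanishingM f g : vanishing f -> bounded_oo g -> vanishing (fun t => f t * g t).
Proof.
move=> nf [M M0 gM] e e0; have := for_largeI (nf _ (divr_gt0 e0 M0)) gM.
apply: for_largeS => t _ [fe ge]; rewrite normrM -[e](divfK (lt0r_neq0 M0)).
by rewrite ler_pM.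
Qed.

Lemma bounded_ooM f g : bounded_oo f -> bounded_oo g -> bounded_oo (fun t => f t * g t).
Proof.
move=> [M M0 fM] [N N0 gN]; exists (M * N); first by rewrite mulr_gt0.
by have := for_largeI fM gN; apply: for_largeS => t _ [fe ge]; rewrite normrM ler_pM.
Qed.

Lemma bounded_oo_cst (a : R) : bounded_oo (fun=> a).
Proof.
exists (`|a| + 1); first by have := normr_ge0 a; lra.
by apply: for_largeT => t _; lra.
Qed.

Lemma vanishing_inv : vanishing (fun t => t^-1).
Proof.
move=> e e0; exists (1 + e^-1); first by rewrite lerDl invr_ge0 ltW.
move=> t te; have ie0 : 0 < e^-1 by rewrite invr_gt0.
have t0 : 0 < t by lra.
rewrite ger0_norm; last by rewrite invr_ge0 ltW.
by rewrite -[e]invrK lef_pV2 ?posrE//; lra.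
Qed.

Lemma bounded_oo_invX n : bounded_oo (fun t => t^-1 ^+ n).
Proof.
exists 1 => //; apply: for_largeT => t t1; rewrite normrX exprn_ile1//.
by rewrite ger0_norm ?invr_ge0 ?invf_le1//; lra.
Qed.

Lemma bounded_oo_poly (p : {poly R}) : bounded_oo (fun t => p.[t^-1]).
Proof.
elim/poly_ind: p => [|p c IH].
  by apply: (@eq_bounded_oo (fun=> 0)); [apply: for_largeT => t _;
    rewrite horner0|exact: bounded_oo_cst].
apply: (@eq_bounded_oo (fun t => p.[t^-1] * t^-1 ^+ 1 + c)).
  by apply: for_largeT => t _; rewrite hornerMXaddC expr1.
by apply: bounded_ooD (bounded_oo_cst c); apply: bounded_ooM IH (bounded_oo_invX 1).
Qed.

Lemma vanishing_poly (p : {poly R}) : vanishing (fun t => p.[t^-1] - p.[0]).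
Proof.
elim/poly_ind: p => [|p c IH].
  apply: (@eq_vanishing (fun t => t^-1 * 0));
    last exact: vanishingM vanishing_inv (bounded_oo_cst 0).
  by apply: for_largeT => t _; rewrite !horner0 subrr mulr0.
apply: (@eq_vanishing (fun t => t^-1 * p.[t^-1]));
  last exact: vanishingM vanishing_inv (bounded_oo_poly p).
by apply: for_largeT => t _; rewrite !hornerMXaddC mulr0 add0r addrK mulrC.
Qed.

End Eventually.

Section ODE.
Import numFieldNormedType.Exports.
Local Open Scope classical_set_scope.
Variable R : realType.
Implicit Types (f g Y b rho : R -> R) (t T c eta : R).

Lemma MVT_halfline f g T : (forall t, T <= t -> is_derive t 1 f (g t)) ->
  forall x y, T <= x -> x < y ->
  exists2 c, x < c < y & f y - f x = g c * (y - x).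
Proof.
move=> df x y Tx xy.
have [||c] := @MVT R f g x y xy.
- move=> z; rewrite in_itv /= => /andP[xz _]; apply: df; lra.
- apply: derivable_within_continuous => z; rewrite in_itv /= => /andP[xz _].
  by case: (df z (le_trans Tx xz)).
- by rewrite in_itv /= => cxy e; exists c.
Qed.

Lemma derive_ge0_le f g T : (forall t, T <= t -> is_derive t 1 f (g t)) ->
  (forall t, T <= t -> 0 <= g t) -> forall x y, T <= x -> x <= y -> f x <= f y.
Proof.
move=> df g0 x y Tx; rewrite le_eqVlt => /predU1P[->//|xy].
have [c /andP[xc cy] e] := MVT_halfline df Tx xy.
by rewrite -subr_ge0 e mulr_ge0 ?g0//; lra.
Qed.

(** A crude decay of the exponential, sufficient to kill bounded factors. *)
Lemma expRN_le c t : 0 < c -> 0 < t -> expR (- (c * t)) <= (c * t)^-1.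
Proof.
move=> c0 t0; rewrite expRN lef_pV2 ?posrE ?expR_gt0 ?mulr_gt0//.
by have := expR_ge1Dx (c * t); lra.
Qed.

Lemma is_derive_weight Y dY (a K t : R) : is_derive t 1 Y dY ->
  is_derive t 1 (fun t => expR (a * t) * (Y t ^+ 2 - K))
    (expR (a * t) * (a * (Y t ^+ 2 - K) + 2 * Y t * dY)).
Proof.
by move=> d; apply: is_derive_eq; rewrite /GRing.scale /=; ring.
Qed.

(** Y^2 satisfies (Y^2)' <= - c (Y^2 - eta^2/c^2) as soon as the forcing is
    at most eta, so that exp(c t) (Y^2 - eta^2/c^2) is nonincreasing. *)
Lemma attracting_vanishing Y b rho c : 0 < c ->
  for_large (fun t => is_derive t 1 Y (rho t - b t * Y t)) ->
  for_large (fun t => c <= b t) -> vanishing rho -> vanishing Y.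
Proof.
move=> c0 dY bc rho0.
suff Y20 : vanishing (fun t => Y t ^+ 2).
  move=> e e0; have e20 : 0 < e ^+ 2 by rewrite exprn_gt0.
  by move: (Y20 _ e20); apply: for_largeS => t _; rewrite normrX ler_pXn2r// nnegrE ltW.
(* The level eta^2/c^2 = e/2 leaves e/2 for the transient. *)
move=> e e0; pose eta := c * Num.sqrt (e / 2).
have eta0 : 0 < eta by rewrite mulr_gt0// sqrtr_gt0; lra.
pose K := eta ^+ 2 / c ^+ 2.
have KE : K = e / 2.
  by rewrite /K /eta exprMn sqr_sqrtr; [field; rewrite gt_eqF|lra].
have [S S1 h] := for_largeI dY (for_largeI bc (rho0 _ eta0)).
pose G t := expR (c * t) * (Y t ^+ 2 - K).
have Gle t : S <= t -> G t <= G S.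
  move=> St; rewrite -lerN2.
  apply: (@derive_ge0_le (fun t => - G t)
    (fun t => - (expR (c * t) * (c * (Y t ^+ 2 - K)
      + 2 * Y t * (rho t - b t * Y t)))) S) => //.
    by move=> x Sx; have [d _] := h x Sx; apply: is_deriveN; exact: is_derive_weight.
  move=> x Sx; have [_ [bx rx]] := h x Sx; rewrite -mulrN mulr_ge0 ?expR_ge0//.
  have : rho x ^+ 2 <= eta ^+ 2 by rewrite -(real_normK (num_real _)) ler_pXn2r// nnegrE
    ltW.
  have -> : c * (Y x ^+ 2 - K) = c * Y x ^+ 2 - eta ^+ 2 / c by rewrite /K; field;
    rewrite gt_eqF.
  move=> rr; have : 0 <= (c * Y x - rho x) ^+ 2 / c by rewrite divr_ge0 ?sqr_ge0// ltW.
  have -> : (c * Y x - rho x) ^+ 2 / c = c * Y x ^+ 2 - 2 * rho x * Y x + rho x ^+ 2 / c.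
    by field; rewrite gt_eqF.
  have : rho x ^+ 2 / c <= eta ^+ 2 / c by rewrite ler_pM2r// invr_gt0.
  have : 0 <= (b x - c) * Y x ^+ 2 by rewrite mulr_ge0 ?sqr_ge0// subr_ge0.
  move: (rho x ^+ 2 / c) (eta ^+ 2 / c) => A B; nra.
pose M := `|G S| + 1.
have M0 : 0 < M by rewrite /M; have := normr_ge0 (G S); lra.
(* After this time the transient M exp(- c t) <= M / (c t) is below e/2. *)
exists (S + 2 * M / (c * e)).
  by rewrite -[1]addr0 lerD// divr_ge0 ?mulr_ge0 ?ltW.
move=> t tS; have D0 : 0 < 2 * M / (c * e) by rewrite divr_gt0 ?mulr_gt0.
have t0 : 0 < t by lra.
have St : S <= t by lra.
rewrite ger0_norm ?sqr_ge0//.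
have YE : Y t ^+ 2 - K = expR (- (c * t)) * G t.
  by rewrite /G mulrA [expR _ * _]mulrC expRxMexpNx_1 mul1r.
have : expR (- (c * t)) * G t <= expR (- (c * t)) * M.
  rewrite ler_wpM2l ?expR_ge0// (le_trans (Gle t St))// /M.
  by have := ler_norm (G S); lra.
have : expR (- (c * t)) * M <= e / 2.
  rewrite -ler_pdivlMr//; apply: le_trans (expRN_le c0 t0) _.
  rewrite -lef_pV2 ?posrE; [rewrite invrK|by rewrite !divr_gt0|by rewrite invr_gt0
    mulr_gt0].
  have -> : (e / 2 / M)^-1 = c * (2 * M / (c * e)).
    by field; rewrite !gt_eqF.
  by rewrite ler_pM2l//; lra.
by rewrite -YE KE; lra.
Qed.

(** Here (Y^2)' >= c (Y^2 - eta^2/c^2), so that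
    exp(-c t) (Y^2 - eta^2/c^2) is nondecreasing; it tends to 0 when Y is
    bounded, so it is nonpositive.  Unlike for attracting equations the
    conclusion holds at the initial point, with the bound of the forcing beyond
    it, and this yields rates of decay. *)
Lemma repelling_bound Y b rho c T eta M : 0 < c -> 0 < T -> 0 <= eta ->
  (forall t, T <= t -> is_derive t 1 Y (rho t - b t * Y t)) ->
  (forall t, T <= t -> b t <= - c) -> (forall t, T <= t -> `|rho t| <= eta) ->
  (forall t, T <= t -> `|Y t| <= M) -> `|Y T| <= eta / c.
Proof.
move=> c0 T0 eta0 dY bc rhoe YM.
pose K := eta ^+ 2 / c ^+ 2; pose G t := expR (- c * t) * (Y t ^+ 2 - K).
have Gle t : T <= t -> G T <= G t.
  move=> Tt; apply: (@derive_ge0_le G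
    (fun t => expR (- c * t) * (- c * (Y t ^+ 2 - K)
      + 2 * Y t * (rho t - b t * Y t))) T) => //.
    by move=> x Tx; have d := dY x Tx; exact: is_derive_weight.
  move=> x Tx; have bx := bc x Tx; have rx := rhoe x Tx; rewrite mulr_ge0 ?expR_ge0//.
  have : rho x ^+ 2 <= eta ^+ 2 by rewrite -(real_normK (num_real _)) ler_pXn2r// nnegrE.
  have -> : - c * (Y x ^+ 2 - K) = - c * Y x ^+ 2 + eta ^+ 2 / c by rewrite /K; field;
    rewrite gt_eqF.
  move=> rr; have : 0 <= (c * Y x + rho x) ^+ 2 / c by rewrite divr_ge0 ?sqr_ge0// ltW.
  have -> : (c * Y x + rho x) ^+ 2 / c = c * Y x ^+ 2 + 2 * rho x * Y x + rho x ^+ 2 / c.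
    by field; rewrite gt_eqF.
  have : rho x ^+ 2 / c <= eta ^+ 2 / c by rewrite ler_pM2r// invr_gt0.
  have : 0 <= (- c - b x) * Y x ^+ 2 by rewrite mulr_ge0 ?sqr_ge0// subr_ge0.
  move: (rho x ^+ 2 / c) (eta ^+ 2 / c) => A B; nra.
have GT : G T <= 0.
  apply/ler_addgt0Pl => e e0; rewrite addr0.
  pose M1 := M ^+ 2 + 1; have M10 : 0 < M1 by rewrite /M1; have := sqr_ge0 M; lra.
  (* At this time M1 exp(- c t) <= M1 / (c t) <= e. *)
  pose t := T + M1 / (c * e).
  have D0 : 0 < M1 / (c * e) by rewrite divr_gt0 ?mulr_gt0.
  have Tt : T <= t by rewrite /t; lra.
  have t0 : 0 < t by lra.
  apply: le_trans (Gle t Tt) _; rewrite /G mulNr.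
  have V : Y t ^+ 2 - K <= M1.
    have : Y t ^+ 2 <= M ^+ 2.
      by rewrite -(real_normK (num_real _)) ler_pXn2r ?YM// nnegrE// (le_trans _ (YM t Tt)).
    by rewrite /M1; have : 0 <= K by [rewrite divr_ge0 ?sqr_ge0]; lra.
  apply: le_trans (_ : expR (- (c * t)) * M1 <= _); first by rewrite ler_wpM2l ?expR_ge0.
  rewrite -ler_pdivlMr//; apply: le_trans (expRN_le c0 t0) _.
  rewrite -lef_pV2 ?posrE; [rewrite invrK|by rewrite !divr_gt0|by rewrite invr_gt0
    mulr_gt0].
  have -> : (e / M1)^-1 = c * (M1 / (c * e)) by field; rewrite !gt_eqF.
  by rewrite ler_pM2l// /t; lra.
have : Y T ^+ 2 <= (eta / c) ^+ 2.
  move: GT; rewrite /G pmulr_rle0 ?expR_gt0// subr_le0 => /le_trans; apply.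
  by rewrite /K expr_div_n.
rewrite -(real_normK (num_real (Y T))) ler_pXn2r// ?nnegrE//.
by rewrite divr_ge0// ltW.
Qed.

End ODE.

Section Expansions.
Import numFieldNormedType.Exports.
Local Open Scope classical_set_scope.
Variable R : realType.
Implicit Types (f g q : R -> R) (t : R) (P Q S : {poly R}) (N : nat).

(** An asymptotic expansion to all orders in powers of 1/t.  Truncations of
    different orders need not be related, which makes the class closed under
    ring operations with no bookkeeping on coefficients. *)
Definition expandable f :=
  forall N, exists P, vanishing (fun t => (f t - P.[t^-1]) * t ^+ N).

Lemma expandable_bounded_oo f : expandable f -> bounded_oo f.
Proof.
move=> /(_ 0%N)[P nP].
apply: (@eq_bounded_oo _ (fun t => (f t - P.[t^-1]) * t ^+ 0 + P.[t^-1])).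
  by apply: for_largeT => t _; rewrite expr0 mulr1 subrK.
by apply: bounded_ooD (bounded_oo_poly P); exact: vanishing_bounded.
Qed.

Lemma expandable_cst (a : R) : expandable (fun=> a).
Proof.
move=> N; exists a%:P; apply: (@eq_vanishing _ (fun t => t^-1 * 0)).
  by apply: for_largeT => t _; rewrite hornerC subrr mul0r mulr0.
exact: vanishingM (@vanishing_inv R) (bounded_oo_cst 0).
Qed.

Lemma expandable_inv : expandable (fun t => t^-1).
Proof.
move=> N; exists 'X; apply: (@eq_vanishing _ (fun t => t^-1 * 0)).
  by apply: for_largeT => t _; rewrite hornerX subrr mul0r mulr0.
exact: vanishingM (@vanishing_inv R) (bounded_oo_cst 0).
Qed.

Lemma eq_expandable f g : for_large (fun t => f t = g t) -> expandable f -> expandable g.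
Proof.
move=> fg ef N; have [P nP] := ef N; exists P; apply: eq_vanishing nP.
by move: fg; apply: for_largeS => t _ ->.
Qed.

Lemma expandableD f g : expandable f -> expandable g -> expandable (fun t => f t + g t).
Proof.
move=> ef eg N; have [P nP] := ef N; have [Q nQ] := eg N.
exists (P + Q); apply: eq_vanishing (vanishingD nP nQ).
by apply: for_largeT => t _; rewrite hornerD; ring.
Qed.

Lemma expandableM f g : expandable f -> expandable g -> expandable (fun t => f t * g t).
Proof.
move=> ef eg N; have [P nP] := ef N; have [Q nQ] := eg N; exists (P * Q).
apply: eq_vanishing (vanishingD (vanishingM nP (expandable_bounded_oo eg))
  (vanishingM nQ (bounded_oo_poly P))).
by apply: for_largeT => t _; rewrite hornerM; ring.
Qed.

Lemma expandableX f n : expandable f -> expandable (fun t => f t ^+ n).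
Proof.
move=> ef; elim: n => [|n IH]; first exact: (expandable_cst 1).
apply: (eq_expandable _ (expandableM ef IH)).
by apply: for_largeT => t _; rewrite exprS.
Qed.

Lemma expandable_sum (I : Type) (r : seq I) (F : I -> R -> R) :
  (forall i, expandable (F i)) -> expandable (fun t => \sum_(i <- r) F i t).
Proof.
move=> eF; elim: r => [|i r IH].
  by apply: (eq_expandable _ (expandable_cst 0)); apply: for_largeT => t _; rewrite big_nil.
apply: (eq_expandable _ (expandableD (eF i) IH)).
by apply: for_largeT => t _; rewrite big_cons.
Qed.

Lemma expandable_prod (I : Type) (r : seq I) (F : I -> R -> R) :
  (forall i, expandable (F i)) -> expandable (fun t => \prod_(i <- r) F i t).
Proof.
move=> eF; elim: r => [|i r IH].
  by apply: (eq_expandable _ (expandable_cst 1)); apply: for_largeT => t _; rewrite big_nil.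
apply: (eq_expandable _ (expandableM (eF i) IH)).
by apply: for_largeT => t _; rewrite big_cons.
Qed.

Lemma vanishing_cst (a : R) : vanishing (fun=> a) -> a = 0.
Proof.
move=> na; apply/eqP; apply: contraT => a0.
have e0 : 0 < `|a| / 2 by rewrite divr_gt0 ?normr_gt0.
by have [T _ /(_ T (lexx _))] := na _ e0; move: e0; lra.
Qed.

Lemma bounded_oo_recip f (l : R) : l != 0 -> vanishing (fun t
  => f t - l) -> bounded_oo (fun t => (f t)^-1).
Proof.
move=> l0 fl; have e0 : 0 < `|l| / 2 by rewrite divr_gt0 ?normr_gt0.
exists (`|l| / 2)^-1; first by rewrite invr_gt0.
move: (fl _ e0); apply: for_largeS => t _ h; rewrite normfV lef_pV2 ?posrE//.
  by have := ler_normB (f t) (f t - l); rewrite opprB addrC subrK; lra.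
by have := ler_normB (f t) (f t - l); rewrite opprB addrC subrK; lra.
Qed.

(** If l is nonzero the truncation P is invertible modulo a power of X,
    by the Bezout identity. *)
Lemma expandable_recip f (l : R) : l != 0 -> vanishing (fun t => f t - l) ->
  expandable f -> expandable (fun t => (f t)^-1).
Proof.
move=> l0 fl ef N; have [P nP] := ef N.
have P0 : P.[0] = l.
  have nP0 : vanishing (fun t => f t - P.[t^-1]).
    apply: (eq_vanishing _ (vanishingM nP (bounded_oo_invX R N)));
      apply: for_largeT => t t1.
    by rewrite exprVn mulfK// expf_neq0//; apply/eqP; lra.
  have : vanishing (fun t => P.[0] - l).
    apply: (@eq_vanishing _ (fun t
      => (f t - l) + ((f t - P.[t^-1]) * -1 + (P.[t^-1] - P.[0]) * -1))).
      by apply: for_largeT => t _; ring.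
    apply: vanishingD fl (vanishingD (vanishingM nP0 (bounded_oo_cst _))
      (vanishingM (vanishing_poly P) (bounded_oo_cst _))).
  by move/vanishing_cst/eqP; rewrite subr_eq0 => /eqP.
have : coprimep P ('X^(N.+1)).
  apply: coprimep_expr; rewrite -['X]subr0 -polyC0 coprimep_XsubC.
  by rewrite /root P0.
case/Bezout_eq1_coprimepP => -[Q S] /= QS; exists Q.
have nf := vanishingD (vanishingM (vanishingM nP (bounded_oo_poly Q))
  (bounded_oo_cst (-1))) (vanishingM (@vanishing_inv R) (bounded_oo_poly S)).
apply: (eq_vanishing _ (vanishingM nf (bounded_oo_recip l0 fl))).
have f0 : for_large (fun t => f t != 0).
  have e0 : 0 < `|l| / 2 by rewrite divr_gt0 ?normr_gt0.
  move: (fl _ e0); apply: for_largeS => t _; apply: contraTneq => ->.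
  by rewrite sub0r normrN -ltNge ltr_pdivrMr// ltr_pMr ?normr_gt0//; lra.
move: f0; apply: for_largeS => t t1 ft0; have t0 : t != 0 by apply/eqP; lra.
have := congr1 (horner^~ t^-1) QS; rewrite hornerD !hornerM hornerXn hornerC => e.
have -> : S.[t^-1] = (1 - Q.[t^-1] * P.[t^-1]) * t ^+ N.+1.
  by rewrite -e exprVn; field; rewrite expf_neq0.
by rewrite exprS; field; rewrite ?ft0 ?t0.
Qed.

Lemma is_derive_poly_inv P t : t != 0 ->
  is_derive t 1 (fun t => P.[t^-1]) (- t^-1 ^+ 2 * P^`().[t^-1]).
Proof.
move=> t0; elim/poly_ind: P => [|P c IH].
  rewrite deriv0 horner0 mulr0.
  by rewrite (_ : (fun t => _) = fun=> 0); [exact: is_derive_cst|apply/funext => x;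
    rewrite horner0].
rewrite (_ : (fun t => _) = fun t => P.[t^-1] * t^-1 + c); last first.
  by apply/funext => x; rewrite hornerMXaddC.
have dV : is_derive t 1 (fun t : R => t^-1) (- t^-1 ^+ 2).
  apply: is_derive_eq; first exact: is_deriveV.
  by rewrite /GRing.scale /=; field.
apply: is_derive_eq; rewrite derivMXaddC hornerD hornerM hornerX /GRing.scale /=.
by ring.
Qed.

(** Formal solutions in s = 1/t, where d/dt = - s^2 d/ds.  The linearization
    at the constant term eps multiplies the next coefficient by 2 eps. *)
Lemma riccati_poly (eps : R) N : eps ^+ 2 = 1 ->
  exists P S, P.[0] = eps /\
   1 + 'X ^+ 2 * P^`() - P ^+ 2 - 'X * P = 'X ^+ N.+1 * S.
Proof.
move=> e1; have e0 : eps != 0 by apply/eqP => e; move: e1; rewrite e; lra.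
elim: N => [|N [P [S [P0 PS]]]].
  exists eps%:P, (- eps%:P); rewrite hornerC derivC; split => //.
  by rewrite -polyC_exp e1 expr1; ring.
pose a := S.[0] / (2 * eps); exists (P + a%:P * 'X ^+ N.+1).
(* The new defect divided by X^(N+1); it vanishes at 0 by the choice of a. *)
pose B := S + a%:P * N.+1%:R * 'X - 2 * a%:P * P - a%:P ^+ 2 * 'X ^+ N.+1 - a%:P * 'X.
have : root B 0.
  rewrite /root /B !hornerE P0 expr0n /= /a; apply/eqP.
  by field.
case/factor_theorem => S' BS'; exists S'; split.
  by rewrite !hornerE P0 expr0n /= mulr0 addr0.
transitivity ('X ^+ N.+1 * B); last by rewrite BS' subr0 [in RHS]exprS; ring.
rewrite derivD derivM derivC derivXn /B -[N.+1.-1]/N.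
transitivity ((1 + 'X ^+ 2 * P^`() - P ^+ 2 - 'X * P) +
   'X ^+ N.+1 * (a%:P * N.+1%:R * 'X - 2 * a%:P * P - a%:P ^+ 2 * 'X ^+ N.+1 - a%:P * 'X)).
  by rewrite -mulr_natr (exprS _ N); ring.
by rewrite PS; ring.
Qed.

End Expansions.

(** * Riccati equations *)

Section Riccati.
Import numFieldNormedType.Exports.
Local Open Scope classical_set_scope.
Variable R : realType.
Implicit Types (q : R -> R) (t : R) (P S : {poly R}) (N : nat).

Definition riccati q := for_large (fun t => is_derive t 1 q (1 - q t ^+ 2 - q t / t)).

(** The difference of an actual and of a truncated formal solution solves a
    linear equation, forced by the defect of the latter. *)
Lemma is_derive_riccati_diff q P S N t : 1 <= t ->
  is_derive t 1 q (1 - q t ^+ 2 - q t / t) ->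
  1 + 'X ^+ 2 * P^`() - P ^+ 2 - 'X * P = 'X ^+ N.+1 * S ->
  is_derive t 1 (fun t => q t - P.[t^-1])
    (t^-1 ^+ N.+1 * S.[t^-1] - (q t + P.[t^-1] + t^-1) * (q t - P.[t^-1])).
Proof.
move=> t1 dq PS; have t0 : t != 0 by apply/eqP; lra.
have dP := is_derive_poly_inv P t0; apply: is_derive_eq.
have := congr1 (horner^~ t^-1) PS; rewrite /= !hornerE => <-; ring.
Qed.

Lemma is_derive_exprn N t : is_derive t 1 (fun u : R => u ^+ N.+1) (N.+1%:R * t ^+ N).
Proof.
apply: DeriveDef; first exact: exprn_derivable.
by rewrite exp_derive /GRing.scale /= mulr1.
Qed.

Lemma is_derive_scaleX f (df : R) N t : t != 0 -> is_derive t 1 f df ->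
  is_derive t 1 (fun t : R => f t * t ^+ N) (df * t ^+ N + N%:R * t^-1 * (f t * t ^+ N)).
Proof.
move=> t0 d; case: N => [|N].
  rewrite (_ : (fun t => _) = f); last by apply/funext => x; rewrite expr0 mulr1.
  by rewrite expr0 mulr1 mul0r mul0r addr0.
have dX := is_derive_exprn N t.
apply: is_derive_eq; rewrite /GRing.scale /= exprS; by field.
Qed.

Lemma vanishing_riccati_lim q P (eps : R) : P.[0] = eps ->
  vanishing (fun t => (q t - P.[t^-1]) * t ^+ 0) -> vanishing (fun t => q t - eps).
Proof.
move=> P0 nP; apply: (eq_vanishing _ (vanishingD nP (vanishing_poly P))).
by apply: for_largeT => t _; rewrite P0 expr0; ring.
Qed.

(** Scaling the difference by t^N changes the rate, close to 2, by N/t only,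
    and leaves a vanishing forcing. *)
Lemma riccati_attracting q : riccati q -> for_large (fun t => 0 <= q t) ->
  expandable q /\ vanishing (fun t => q t - 1).
Proof.
move=> dq q0.
have step N : exists P, P.[0] = 1 /\ vanishing (fun t => (q t - P.[t^-1]) * t ^+ N).
  have [|P [S [P0 PS]]] := @riccati_poly R 1 N; first by rewrite expr1n.
  exists P; split => //.
  apply: (@attracting_vanishing R _ (fun t => q t + P.[t^-1] + t^-1 - N%:R * t^-1)
     (fun t => t^-1 * S.[t^-1]) (1 / 2)); first lra.
  - move: dq; apply: for_largeS => t t1 dq.
    have t0 : t != 0 by apply/eqP; lra.
    have d := is_derive_scaleX N t0 (is_derive_riccati_diff t1 dq PS).
    apply: is_derive_eq; have -> : t^-1 ^+ N.+1 = t^-1 / t ^+ N by rewrite exprS exprVn.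
    by field; rewrite ?t0 ?expf_neq0.
  - have h4 : (0 : R) < 1 / 4 by lra.
    have nN := vanishingM (@vanishing_inv R) (bounded_oo_cst N%:R).
    have := for_largeI q0 (for_largeI (vanishing_poly P h4) (nN _ h4));
      apply: for_largeS => t t1 [qt [Pt Nt]].
    have s0 : 0 <= t^-1 by rewrite invr_ge0; lra.
    move: Pt Nt; rewrite P0 !ler_norml [t^-1 * _]mulrC; lra.
  - exact: vanishingM (@vanishing_inv R) (bounded_oo_poly S).
split; first by move=> N; have [P [_ nP]] := step N; exists P.
by have [P [P0 nP]] := step 0%N; apply: vanishing_riccati_lim P0 nP.
Qed.

(** The forcing beyond t is O(t^(-N-1)), and so is the bounded difference. *)
Lemma riccati_repelling q : riccati q -> for_large (fun t => -2 <= q t <= 0) ->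
  expandable q /\ vanishing (fun t => q t + 1).
Proof.
move=> dq q0.
have step N : exists P, P.[0] = -1 /\ vanishing (fun t => (q t - P.[t^-1]) * t ^+ N).
  have [|P [S [P0 PS]]] := @riccati_poly R (-1) N; first by rewrite sqrrN expr1n.
  exists P; split => //.
  have h4 : (0 : R) < 1 / 4 by lra.
  have [M M0 SM] := bounded_oo_poly S; have [M' M'0 PM] := bounded_oo_poly P.
  have [T T1 h] := for_largeI dq (for_largeI q0 (for_largeI (vanishing_poly P h4)
    (for_largeI (@vanishing_inv R _ h4) (for_largeI SM PM)))).
  suff bound : for_large (fun t => `|(q t - P.[t^-1]) * t ^+ N| <= `|t^-1 * (2 * M)|).
    move=> e e0; have := vanishingM (@vanishing_inv R) (bounded_oo_cst (2 * M)) e0.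
    by move/(for_largeI bound); apply: for_largeS => t _ [/le_trans]; apply.
  exists T => // t Tt; have t0 : 0 < t by lra.
  have : `|q t - P.[t^-1]| <= (M * t^-1 ^+ N.+1) / (1 / 2).
    apply: (@repelling_bound R (fun t => q t - P.[t^-1])
      (fun t => q t + P.[t^-1] + t^-1) (fun t => t^-1 ^+ N.+1 * S.[t^-1])
      (1 / 2) t _ (2 + M')) => //.
    - by rewrite mulr_ge0 ?exprn_ge0 ?invr_ge0 ?ltW.
    - move=> x tx; have [|dx _] := h x; first lra.
      by apply: is_derive_riccati_diff PS => //; lra.
    - move=> x tx; have [|_ [/andP[qx1 qx2] [Px [sx _]]]] := h x; first lra.
      by move: Px sx; rewrite P0 !ler_norml; lra.
    - move=> x tx; have [|_ [_ [_ [_ [Sx _]]]]] := h x; first lra.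
      have x0 : 0 < x by lra.
      rewrite normrM mulrC ler_pM// normrX; apply: lerXn2r;
        rewrite ?nnegrE ?invr_ge0 ?(ltW t0)//.
      by rewrite ger0_norm ?invr_ge0 ?(ltW x0)// lef_pV2.
    - move=> x tx; have [|_ [/andP[qx1 qx2] [_ [_ [_ Px]]]]] := h x; first lra.
      by move: Px; rewrite !ler_norml; lra.
  move=> b; rewrite normrM [leRHS]ger0_norm;
    last by rewrite !mulr_ge0 ?invr_ge0 ?(ltW t0) ?(ltW M0).
  rewrite [`|t ^+ N|]ger0_norm ?exprn_ge0 ?(ltW t0)//.
  have -> : t^-1 * (2 * M) = (M * t^-1 ^+ N.+1) / (1 / 2) * t ^+ N.
    by rewrite exprS exprVn; field; rewrite ?expf_neq0 ?gt_eqF.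
  by rewrite ler_wpM2r// exprn_ge0// ltW.
split; first by move=> N; have [P [_ nP]] := step N; exists P.
have [P [P0 nP]] := step 0%N; have := vanishing_riccati_lim P0 nP.
by apply: eq_vanishing; apply: for_largeT => t _; ring.
Qed.

End Riccati.

(** * Expansion of I_0 K_0 *)

Section BesselAsymptotics.
Import numFieldNormedType.Exports.
Local Open Scope classical_set_scope.
Variable R : realType.
Implicit Types (t : R).

(** The Bessel equation as a first order system in z = t^2/4: y' is
    z d/dz y, and z d/dz y' = z y. *)
Definition bessel_system (y y' : R -> R) := forall t, 0 < t ->
  is_derive t 1 y (2 / t * y' t) /\ is_derive t 1 y' (t / 2 * y t).

Lemma riccati_of_bessel y y' : bessel_system y y' -> for_large (fun t => y t != 0) ->
  riccati (fun t => 2 * y' t / (t * y t)).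
Proof.
move=> sys; apply: for_largeS => t t1 y0; have t0 : 0 < t by lra.
have [dy dy'] := sys t t0; have tn0 : t != 0 by rewrite gt_eqF.
have dty : is_derive t 1 (fun t => t * y t) (y t + 2 * y' t).
  by apply: is_derive_eq; rewrite /GRing.scale /=; field.
have dV : is_derive t 1 (fun t => (t * y t)^-1) (- (t * y t) ^- 2 * (y t + 2 * y' t)).
  apply: is_derive_eq; first by apply: is_deriveV; rewrite mulf_neq0.
  by rewrite /GRing.scale /=.
apply: is_derive_eq; rewrite /GRing.scale /=; field.
by rewrite tn0 y0.
Qed.

Definition K0_euler t : R := - (t / 2 * besselK 1 t).

Lemma I0_system : bessel_system (@besselI0 R) (@I0_euler R).
Proof. by move=> t t0; split; [exact: is_derive_besselI0|exact: is_derive_I0_euler]. Qed.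

Lemma K0_system : bessel_system (@besselK0 R) K0_euler.
Proof.
move=> t t0; have tn0 : t != 0 by rewrite gt_eqF.
have [d0 d1] := (is_derive_besselK 0 t0, is_derive_besselK 1 t0); split.
  rewrite (_ : @besselK0 R = besselK 0); last by apply/funext => u; rewrite besselK0E.
  by apply: is_derive_eq; rewrite /K0_euler; field.
apply: is_derive_eq; rewrite /GRing.scale /= besselK0E.
rewrite -[besselK 0 t](subrK (besselK 2 t)) -opprB.
have -> : besselK 2 t - besselK 0 t = besselK 1 t / t.
  by rewrite -(besselK_recurrence t0); field.
by field.
Qed.

Definition wronskian t : R := besselI0 t * K0_euler t - I0_euler t * besselK0 t.

Lemma is_derive_wronskian t : 0 < t -> is_derive t 1 wronskian 0.
Proof.
move=> t0; have tn0 : t != 0 by rewrite gt_eqF.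
have [dA dB] := I0_system t0; have [dP dQ] := K0_system t0.
by apply: is_derive_eq; rewrite /GRing.scale /=; field.
Qed.

(** At t = 0 only I_0 (t/2) K_0' survives, and t K_0' tends to -1. *)
Lemma wronskian_cvg0 : wronskian t @[t --> 0^'+] --> (- (1 / 2) : R).
Proof.
have idc : t @[t --> (0 : R)^'+] --> (0 : R) by apply: cvg_at_right_filter; exact: cvg_id.
have ec : expR (- t) @[t --> (0 : R)^'+] --> (1 : R).
  rewrite -expR0 -[X in expR X]oppr0; apply: (cvg_comp _ _ (cvgN idc));
    exact: continuous_expR.
have K1c : t * besselK 1 t @[t --> (0 : R)^'+] --> (1 : R).
  apply: (@squeeze_cvgr _ _ _ _ (fun t => expR (- t)) (fun t => expR (- t) + t)) => //.
    by near=> t; apply: besselK1_bounds; near: t; exact: nbhs_right_gt.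
  by rewrite -[X in _ --> X]addr0; apply: cvgD.
have Ac := @besselI0_cvg0 R.
have BPc : I0_euler t * besselK0 t @[t --> (0 : R)^'+] --> (0 : R).
  apply: (@squeeze_cvgr _ _ _ _ (fun=> 0)
    (fun t => t / 4 * besselI0 t * (t * besselK 1 t))).
  - near=> t; have t0 : 0 < t by near: t; exact: nbhs_right_gt.
    rewrite besselK0E mulr_ge0 ?I0_euler_ge0 ?besselK_ge0//=.
    have -> : t / 4 * besselI0 t * (t * besselK 1 t)
              = (t ^+ 2 / 4 * besselI0 t) * besselK 1 t by ring.
    by rewrite ler_pM ?I0_euler_ge0 ?besselK_ge0 ?I0_euler_le ?besselK01.
  - exact: cvg_cst.
  - rewrite -[X in _ --> X](mul0r (1 : R)); apply: cvgM => //.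
    rewrite -[X in _ --> X](mul0r (1 : R)); apply: cvgM => //.
    by rewrite -[X in _ --> X](mul0r (4^-1 : R)); apply: cvgMl.
rewrite (_ : wronskian = fun t
  => - (1 / 2) * (besselI0 t * (t * besselK 1 t)) - I0_euler t * besselK0 t).
  rewrite -[X in _ --> X]subr0; apply: cvgB => //.
  rewrite -[X in _ --> X]mulr1; apply: cvgMr.
  by rewrite -[X in _ --> X]mulr1; exact: cvgM.
by apply/funext => t; rewrite /wronskian /K0_euler; field.
Unshelve. all: by end_near. Qed.

Lemma wronskianE t : 0 < t -> wronskian t = - (1 / 2).
Proof.
move=> t0; apply: (@cvg_unique _ (@Rhausdorff R) (wronskian x @[x --> 0^'+])).
  apply: (@squeeze_cvgr _ _ _ _ (fun=> wronskian t) (fun=> wronskian t));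
    [|exact: cvg_cst|exact: cvg_cst].
  near=> x; have x0 : 0 < x by near: x; exact: nbhs_right_gt.
  have xt : x < t by near: x; exact: nbhs_right_lt.
  have [s xs|c _] := @MVT_halfline R wronskian (fun=> 0) x _ x t (lexx x) xt.
    by apply: is_derive_wronskian; lra.
  by rewrite mul0r => /subr0_eq ->; rewrite lexx.
exact: wronskian_cvg0.
Unshelve. all: by end_near. Qed.

(** The logarithmic derivative d/dt log I_0. *)
Definition I0_log t : R := 2 * I0_euler t / (t * besselI0 t).
Definition K0_log t : R := 2 * K0_euler t / (t * besselK0 t).

Lemma besselI0_neq0 t : besselI0 t != 0.
Proof. by rewrite gt_eqF// (lt_le_trans _ (besselI0_ge1 t)). Qed.

Lemma besselK0_gt0 t : 1 <= t -> 0 < besselK0 t.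
Proof.
move=> t1; have t0 : 0 < t by lra.
have /andP[+ _] := besselK1_bounds t0; have := expR_gt0 (- t).
have := besselK1_le t1; rewrite besselK0E;
  move: (expR _) (besselK 1 t) (besselK 0 t) => e k1 k0 *.
have : 0 < t * k1 by lra.
by rewrite pmulr_rgt0// => ?; lra.
Qed.

Lemma expandable_I0_log : expandable I0_log /\ vanishing (fun t => I0_log t - 1).
Proof.
apply: riccati_attracting.
  by apply: riccati_of_bessel I0_system _; apply: for_largeT => t _; exact: besselI0_neq0.
apply: for_largeT => t t1; rewrite divr_ge0 ?mulr_ge0 ?I0_euler_ge0//; first lra.
by have := besselI0_ge1 t; lra.
Qed.

Lemma expandable_K0_log : expandable K0_log /\ vanishing (fun t => K0_log t + 1).
Proof.
apply: riccati_repelling.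
  by apply: riccati_of_bessel K0_system _; apply: for_largeT => t t1;
    rewrite gt_eqF ?besselK0_gt0.
apply: for_largeT => t t1; have t0 : 0 < t by lra.
have -> : K0_log t = - (besselK 1 t / besselK0 t).
  by rewrite /K0_log /K0_euler; field; rewrite !gt_eqF ?besselK0_gt0.
have k0 := besselK0_gt0 t1; have k1 := besselK_ge0 1 t; have := besselK1_le t1.
rewrite -besselK0E => k12; rewrite lerN2 oppr_le0 divr_ge0 ?(ltW k0)// andbT.
by rewrite ler_pdivrMr.
Qed.

(** The Wronskian divided by I_0 K_0 is (t/2) (r - p), and it is -1/2. *)
Lemma I0K0E t : 1 <= t -> besselI0 t * besselK0 t = t^-1 * (I0_log t - K0_log t)^-1.
Proof.
move=> t1; have t0 : 0 < t by lra.
have k0 := besselK0_gt0 t1; have i0 := besselI0_neq0 t; have := wronskianE t0.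
rewrite /wronskian => W.
have D : I0_log t - K0_log t = (t * (besselI0 t * besselK0 t))^-1.
  rewrite /I0_log /K0_log.
  have -> : K0_euler t = (I0_euler t * besselK0 t - 1 / 2) / besselI0 t.
    by rewrite [X in X - _](_ : _ = besselI0 t * K0_euler t + 1/2); [field|lra].
  by field; rewrite i0 !gt_eqF.
by rewrite D invrK mulKf// gt_eqF.
Qed.

Lemma vanishing_log_diff : vanishing (fun t => I0_log t - K0_log t - 2).
Proof.
have [_ n1] := expandable_I0_log; have [_ n2] := expandable_K0_log.
apply: (eq_vanishing _ (vanishingD n1 (vanishingM n2 (bounded_oo_cst (-1))))).
by apply: for_largeT => t _; ring.
Qed.

Lemma expandable_log_recip : expandable (fun t => (I0_log t - K0_log t)^-1).
Proof.
have [e1 _] := expandable_I0_log; have [e2 _] := expandable_K0_log.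
apply: (expandable_recip _ vanishing_log_diff) => //.
apply: (eq_expandable _ (expandableD e1 (expandableM e2 (expandable_cst (-1))))).
by apply: for_largeT => t _; ring.
Qed.

End BesselAsymptotics.

(** * Pairing a formal solution with products of Bessel functions *)

Section PolynomialParts.
Import numFieldNormedType.Exports.
Local Open Scope classical_set_scope.
Variable R : realType.
Implicit Types (f : R -> R) (t : R) (P A B : {poly R}).

(** The nonnegative powers of t form the polynomial. *)
Lemma expandable_polypart f m : expandable f ->
  exists A, vanishing (fun t => t ^+ m * f t - A.[t]).
Proof.
move=> /(_ m)[P nP].
suff [A nA] : exists A, vanishing (fun t => t ^+ m * P.[t^-1] - A.[t]).
  exists A; apply: (eq_vanishing _ (vanishingD nP nA)); apply: for_largeT => t _; ring.
elim: m P {nP} => [|m IH] P.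
  exists P.[0]%:P; apply: eq_vanishing (vanishing_poly P); apply: for_largeT => t _.
  by rewrite expr0 mul1r hornerC.
elim/poly_ind: P => [|P c _].
  exists 0; apply: (eq_vanishing _ (vanishingM (@vanishing_inv R) (bounded_oo_cst 0))).
  by apply: for_largeT => t _; rewrite !horner0; ring.
have [A nA] := IH P; exists (A + c *: 'X ^+ m.+1); apply: eq_vanishing nA.
apply: for_largeT => t t1; rewrite hornerD hornerZ hornerXn hornerMXaddC exprS.
by field; apply/eqP; lra.
Qed.

Lemma poly_away P : P != 0 -> exists2 e, 0 < e & for_large (fun t => e <= `|P.[t]|).
Proof.
elim/poly_ind: P => [|P c IH]; first by rewrite eqxx.
have [->|P0 _] := eqVneq P 0.
  rewrite mul0r add0r polyC_eq0 => c0; exists `|c|; first by rewrite normr_gt0.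
  by apply: for_largeT => t _; rewrite hornerC.
have [e e0 [T T1 eP]] := IH P0.
exists 1 => //; exists (T + (1 + `|c|) / e).
  by rewrite -[1]addr0 lerD// divr_ge0 ?ltW// addr_ge0.
have D0 : 0 <= (1 + `|c|) / e by rewrite divr_ge0 ?ltW// addr_ge0.
move=> t Tt; have {}eP : e <= `|P.[t]| by apply: eP; lra.
have t0 : 0 <= t by lra.
rewrite hornerMXaddC; have := ler_normB (P.[t] * t + c) c.
rewrite addrK normrM (ger0_norm t0).
have : e * ((1 + `|c|) / e) <= `|P.[t]| * t.
  by rewrite ler_pM// ?ltW//; lra.
by rewrite mulrC divfK ?gt_eqF//; lra.
Qed.

(** If f has a power asymptotics without logarithm, then so has t f', and
    the constant term of the latter is 0: it would make f grow by a fixed amount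
    between T and 2T. *)
Lemma no_constant_term (f df : R -> R) A B :
  for_large (fun t => is_derive t 1 f (df t)) ->
  vanishing (fun t => f t - A.[t]) -> vanishing (fun t => t * df t - B.[t]) -> B.[0] = 0.
Proof.
move=> dfE fA dfB; pose C := B - 'X * A^`().
suff C0 : C = 0.
  by rewrite -[B](subrK ('X * A^`())) -/C C0 add0r hornerM hornerX mul0r.
apply/eqP; apply: contraT => /poly_away[e e0 eC].
have e8 : 0 < e / 8 by lra.
have [T T1 h] := for_largeI dfE (for_largeI (fA _ e8) (for_largeI (dfB _ e8) eC)).
have T0 : 0 < T by lra.
pose psi t := f t - A.[t].
have [t Tt||c /andP[Tc c2] E] := @MVT_halfline R psi (fun t
  => df t - A^`().[t]) T _ T (2 * T) (lexx T).
- have [d _] := h t Tt; have dA : is_derive t 1 (fun t => A.[t]) (A^`().[t]).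
    apply: DeriveDef; first exact: derivable_horner.
    by rewrite -derive1E derivE.
  exact: is_deriveB.
- lra.
have [|_ [p1 _]] := h T; first lra.
have [|_ [p2 _]] := h (2 * T); first lra.
have [|_ [_ [dc ec]]] := h c; first lra.
have cd : c * (df c - A^`().[c]) = (c * df c - B.[c]) + C.[c].
  by rewrite /C hornerD hornerN hornerM hornerX; ring.
have n1 : `|psi (2 * T) - psi T| <= e / 4.
  by have := ler_normB (psi (2 * T)) (psi T); rewrite /psi; lra.
have n2 : e - e / 8 <= `|c * (df c - A^`().[c])|.
  by rewrite cd; have := ler_normB ((c * df c - B.[c]) + C.[c]) (c * df c - B.[c]);
     rewrite addrAC subrr add0r; lra.
have n3 : `|c * (df c - A^`().[c])| <= 2 * `|psi (2 * T) - psi T|.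
  rewrite E [2 * T - T](_ : _ = T); last by lra.
  rewrite !normrM (gtr0_norm T0) gtr0_norm; last lra.
  by have := normr_ge0 (df c - A^`().[c]); nra.
lra.
Qed.

End PolynomialParts.

Section BesselProducts.
Import numFieldNormedType.Exports.
Local Open Scope classical_set_scope.
Variables (R : realType) (k : nat).
Local Notation word := ({ffun 'I_k -> bool}).
Implicit Types (e : word) (t : R).

Definition bfac (j : 'I_k) (b : bool) : R -> R :=
  if (j < k %/ 2)%N then (if b then @I0_euler R else @besselI0 R)
  else (if b then @K0_euler R else @besselK0 R).

(** The value on the word e of the tensor product of k/2 copies of the flat
    functional v_0 -> I_0, v_1 -> z d/dz I_0 and of k/2 copies of the same one
    for K_0.  No symmetrization is needed since it is only paired with symmetric
    tensors. *)
Definition bprod e t : R := \prod_(j < k) bfac j (e j) t.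

Lemma is_derive_bprod_seq (I : eqType) (r : seq I) (f : I -> R -> R) (d : I -> R) t :
  uniq r -> (forall i, is_derive t 1 (f i) (d i)) ->
  is_derive t 1 (fun t => \prod_(i <- r) f i t)
    (\sum_(i <- r) d i * \prod_(l <- r | l != i) f l t).
Proof.
move=> + df; elim: r => [_|a r IH /= /andP[ar ur]].
  rewrite big_nil (_ : (fun t => _) = fun=> 1); first exact: is_derive_cst.
  by apply/funext => x; rewrite big_nil.
rewrite (_ : (fun t => _) = fun t => f a t * \prod_(i <- r) f i t); last first.
  by apply/funext => x; rewrite big_cons.
have dr := IH ur; have da := df a; apply: is_derive_eq.
rewrite big_cons big_cons eqxx /= /GRing.scale /= addrC mulrC; congr (_ * _ + _).
  rewrite [in RHS]big_seq_cond [in LHS]big_seq; apply: eq_bigl => l.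
  by case: eqVneq => [->|]; rewrite ?(negbTE ar) ?andbT.
rewrite mulr_sumr [LHS]big_seq [RHS]big_seq; apply: eq_bigr => i ir.
rewrite big_cons ifT; first by ring.
by apply: contraNneq ar => ->.
Qed.

Definition flip_letter e j : word := upd e j (~~ e j).

Lemma flip_letterK j : involutive (fun e => flip_letter e j).
Proof.
move=> e; apply/ffunP => i; rewrite /flip_letter /upd !ffunE eqxx.
by case: eqP => [->|//]; rewrite negbK.
Qed.

Lemma is_derive_bfac j b t : 0 < t ->
  is_derive t 1 (bfac j b) (2 / t * ((if b then t ^+ 2 / 4 else 1) * bfac j (~~ b) t)).
Proof.
move=> t0; have tn0 : t != 0 by rewrite gt_eqF.
have [dA dB] := I0_system t0; have [dP dQ] := K0_system t0.
by rewrite /bfac; case: ifP => _; case: b => /=; rewrite ?mul1r//;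
  apply: is_derive_eq; field.
Qed.

(** Flatness of the functional: the Leibniz sum flips one letter at a time. *)
Lemma is_derive_bprod e t : 0 < t ->
  is_derive t 1 (bprod e) (2 / t * \sum_(j < k)
     (if e j then t ^+ 2 / 4 else 1) * bprod (flip_letter e j) t).
Proof.
move=> t0; have := is_derive_bprod_seq (index_enum_uniq 'I_k)
  (fun j => is_derive_bfac j (e j) t0).
move=> /is_derive_eq; apply; rewrite mulr_sumr; apply: eq_bigr => j _.
rewrite /bprod [in RHS](bigD1 j) //= /flip_letter /upd ffunE eqxx -!mulrA;
  do 4 congr (_ * _).
by apply: eq_bigr => l lj; rewrite ffunE (negbTE lj).
Qed.

Hypothesis k_even : k = (k %/ 2).*2.

Lemma bprod_false t : bprod [ffun=> false] t = (besselI0 t * besselK0 t) ^+ (k %/ 2).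
Proof.
pose F j := if (j < k %/ 2)%N then besselI0 t else besselK0 t.
transitivity (\prod_(0 <= j < k) F j).
  rewrite big_mkord; apply: eq_bigr => j _.
  by rewrite /bfac ffunE /F; case: ifP.
rewrite exprMn (@big_cat_nat _ _ _ (k %/ 2)) ?leq_div//=; congr (_ * _).
  rewrite (eq_big_nat _ _ (F2 := fun=> besselI0 t)) => [|j /andP[_ jk]].
    by rewrite prodr_const_nat subn0.
  by rewrite /F jk.
rewrite (eq_big_nat _ _ (F2 := fun=> besselK0 t)) => [|j /andP[jk _]].
  by rewrite prodr_const_nat {1}k_even -addnn addnK.
by rewrite /F ltnNge jk.
Qed.

(** Each factor is I_0 or K_0, times t/2 and a logarithmic derivative for
    the letters v_1.  The power t^k is a common bound for these factors t. *)
Lemma expandable_bprod e : exists2 h, expandable h &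
  for_large (fun t => bprod e t = t ^+ k * h t).
Proof.
have [eI _] := expandable_I0_log R; have [eK _] := expandable_K0_log R.
have eV := expandable_inv R; have eD := expandable_log_recip R.
pose q (j : 'I_k) t := (if (j < k %/ 2)%N then I0_log t else K0_log t) / 2.
have eq j : expandable (q j).
  rewrite /q; case: (ltnP j (k %/ 2)) => _.
    by apply: (expandableM eI); exact: expandable_cst.
  by apply: (expandableM eK); exact: expandable_cst.
pose h t := (t^-1 * (I0_log t - K0_log t)^-1) ^+ (k %/ 2) *
  \prod_(j < k) (if e j then q j t else t^-1).
exists h.
  apply: expandableM; first by apply: expandableX; apply: expandableM.
  by apply: expandable_prod => j; case: (e j).
apply: for_largeT => t t1; have t0 : 0 < t by lra.
rewrite /h -(I0K0E t1) -bprod_false mulrCA -[X in t ^+ X]card_ord -prodr_const -big_split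
  /=.
rewrite /bprod -big_split /=; apply: eq_bigr => j _; rewrite /bfac ffunE /q.
have tn0 : t != 0 by rewrite gt_eqF.
have k0 : besselK0 t != 0 by rewrite gt_eqF// besselK0_gt0.
have i0 := besselI0_neq0 t; rewrite /I0_log /K0_log.
case: ifP => _; case: (e j) => /=; field; rewrite ?tn0 ?i0 ?k0//.
Qed.

End BesselProducts.

Section Solution.
Import numFieldNormedType.Exports.
Local Open Scope classical_set_scope.
Variables (R : realType) (k : nat) (x : nat -> int -> R) (n0 : nat).
Local Notation word := ({ffun 'I_k -> bool}).
Hypothesis x_high : forall a n, n0%:Z <= n -> x a n = 0.
Implicit Types (e : word) (t : R) (j : nat).
Local Notation bprod := (@bprod R k).

(** z^(n0 - j) at z = t^2/4, without negative exponents. *)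
Definition zpow j t : R := (t ^+ 2 / 4) ^+ n0 * (4 / t ^+ 2) ^+ j.

Let L := (n0 + k)%N.

Definition trunc_section a t : R := \sum_(j < L.+1) x a (n0%:Z - j%:Z) * zpow j t.

(** The formal section, cut below z^(n0 - L) = z^(-k), evaluated against the
    flat functional [bprod]. *)
Definition bessel_paired t : R := \sum_(e : word) bprod e t * trunc_section (weight e) t.

Lemma zpow_shift j t : t != 0 -> t ^+ 2 / 4 * zpow j.+1 t = zpow j t.
Proof. by move=> t0; rewrite /zpow (exprS (4 / t ^+ 2));
  move: (_ ^+ n0) ((4 / t ^+ 2) ^+ j) => u v; field. Qed.

Lemma is_derive_zpow j t : t != 0 ->
  is_derive t 1 (zpow j) (2 / t * ((n0%:R - j%:R) * zpow j t)).
Proof.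
move=> t0.
have dz : is_derive t 1 (fun t : R => t ^+ 2 / 4) (t / 2).
  by apply: is_derive_eq; rewrite /GRing.scale /=; field.
have dw : is_derive t 1 (fun t : R => 4 / t ^+ 2) (- (8 / t ^+ 3)).
  have dV : is_derive t 1 (fun t : R => (t ^+ 2)^-1) (- t ^+ 2 ^- 2 * (2 * t)).
    apply: is_derive_eq; first by apply: is_deriveV; rewrite expf_neq0.
    by rewrite /GRing.scale /=; field; rewrite ?t0.
  by apply: is_derive_eq; rewrite /GRing.scale /=; field.
have powd f (df : R) n : f t != 0 -> is_derive t 1 f df ->
    is_derive t 1 (fun t => f t ^+ n) (n%:R * f t ^+ n * df / f t).
  move=> f0 d; case: n => [|n].
    rewrite (_ : (fun t => _) = fun=> 1); last by apply/funext => u; rewrite expr0.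
    by rewrite !mul0r; exact: is_derive_cst.
  have dX := is_derive_exprn n (f t).
  have dc : is_derive t 1 ((fun u : R => u ^+ n.+1) \o f) (n.+1%:R * f t ^+ n * df).
    exact: is_derive1_comp.
  by apply: (is_derive_eq dc); rewrite exprS; field.
have z0 : t ^+ 2 / 4 != 0 by rewrite mulf_neq0 ?expf_neq0// invr_eq0.
have w0 : 4 / t ^+ 2 != 0 by rewrite mulf_neq0 ?invr_eq0 ?expf_neq0.
have d1 := powd _ _ n0 z0 dz; have d2 := powd _ _ j w0 dw.
apply: is_derive_eq; rewrite /zpow /GRing.scale /=.
move: (_ ^+ n0) (_ ^+ j) => u v; field; rewrite ?t0//.
Qed.

Lemma is_derive_sum (I : Type) (r : seq I) (f : I -> R -> R) (d : I -> R) t :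
  (forall i, is_derive t 1 (f i) (d i)) ->
  is_derive t 1 (fun t => \sum_(i <- r) f i t) (\sum_(i <- r) d i).
Proof.
move=> df; elim: r => [|a r IH].
  rewrite big_nil (_ : (fun t => _) = fun=> 0); first exact: is_derive_cst.
  by apply/funext => u; rewrite big_nil.
rewrite (_ : (fun t => _) = fun t => f a t + \sum_(i <- r) f i t); last first.
  by apply/funext => u; rewrite big_cons.
by rewrite big_cons; have da := df a; exact: is_deriveD.
Qed.

(** What the cut leaves behind in the equation at its lowest power of z. *)
Definition truncation_defect t : R :=
  \sum_(e : word) bprod e t * ((k%:R - (weight e)%:R)
     * x (weight e).+1 (n0%:Z - L.+1%:Z) * zpow L t).

Lemma weight_flip_letter e (j : 'I_k) : weight (flip_letter e j)
  = if e j then (weight e).-1 else (weight e).+1.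
Proof.
have := weight_upd e j (~~ e j); rewrite /flip_letter; case: (e j) => /=.
  by rewrite addn0 addn1 => <-.
by rewrite addn0 addn1.
Qed.

(** Flatness: z d/dz of the pairing is the pairing with the connection.
    After reindexing the words by the flip of one letter, the sum over letters
    becomes the matrix of the connection. *)
Lemma is_derive_bessel_paired t : 0 < t -> is_derive t 1 bessel_paired
  (2 / t * (\sum_(e : word) bprod e t * (\sum_(j < L.+1)
       sym_conn k x (weight e) (n0%:Z - j%:Z) * zpow j t) - truncation_defect t)).
Proof.
move=> t0; have tn0 : t != 0 by rewrite gt_eqF.
have dsec a : is_derive t 1 (trunc_section a)
    (2 / t * \sum_(j < L.+1) x a (n0%:Z - j%:Z) * ((n0%:R - j%:R) * zpow j t)).
  have dj (j : 'I_L.+1) : is_derive t 1 (fun t => x a (n0%:Z - j%:Z) * zpow j t)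
      (x a (n0%:Z - j%:Z) * (2 / t * ((n0%:R - j%:R) * zpow j t))).
    have dz := is_derive_zpow j tn0; apply: is_derive_eq.
    by rewrite /GRing.scale /=.
  apply: (is_derive_eq (is_derive_sum (index_enum 'I_L.+1) dj)).
  by rewrite mulr_sumr; apply: eq_bigr => j _; ring.
pose w b : R := if b then t ^+ 2 / 4 else 1.
have dterm e : is_derive t 1 (fun t => bprod e t * trunc_section (weight e) t)
   (2 / t * (\sum_(j < k) w (e j) * bprod (flip_letter e j) t * trunc_section (weight e) t
     + bprod e t * \sum_(j < L.+1) x (weight e)
       (n0%:Z - j%:Z) * ((n0%:R - j%:R) * zpow j t))).
  have db := is_derive_bprod e t0; have ds := dsec (weight e).
  by apply: is_derive_eq; rewrite /GRing.scale /= -mulr_suml /w; ring.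
have := is_derive_sum (index_enum word) dterm.
move=> /is_derive_eq; apply; rewrite -mulr_sumr; congr (_ * _).
rewrite big_split /= [X in X + _]exchange_big /=.
rewrite (eq_bigr (fun j : 'I_k => \sum_(e : word) bprod e t *
    (w (~~ e j) * trunc_section (weight (flip_letter e j)) t))); last first.
  move=> j _; rewrite (reindex_inj (can_inj (flip_letterK j))) /=; apply: eq_bigr => e _.
  by rewrite flip_letterK /flip_letter /upd ffunE eqxx; ring.
rewrite exchange_big -big_split /truncation_defect -sumrB; apply: eq_bigr => e _ /=.
rewrite -mulr_sumr -mulrDr -mulrBr; congr (_ * _); set a := weight e.
have -> : \sum_(j < k) w (~~ e j) * trunc_section (weight (flip_letter e j)) t
  = a%:R * trunc_section a.-1 t + (k%:R - a%:R) * (t ^+ 2 / 4 * trunc_section a.+1 t).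
  rewrite (eq_bigr (fun j : 'I_k => (e j)%:R * trunc_section a.-1 t
     + (1 - (e j)%:R) * (t ^+ 2 / 4 * trunc_section a.+1 t))).
    by rewrite big_split -!mulr_suml /= sumrB sumr_const card_ord -natr_sum.
  move=> j _; rewrite weight_flip_letter /w -/a; case: (e j) => /=; ring.
have shift : t ^+ 2 / 4 * trunc_section a.+1 t
  = \sum_(j < L.+1) x a.+1 (n0%:Z - j%:Z - 1) * zpow j t
    - x a.+1 (n0%:Z - L.+1%:Z) * zpow L t.
  rewrite /trunc_section mulr_sumr big_ord_recl subr0 x_high// mul0r mulr0 add0r.
  rewrite [in RHS]big_ord_recr /=.
  rewrite (_ : n0%:Z - L%:Z - 1 = n0%:Z - L.+1%:Z); last by lia.
  rewrite addrK; apply: eq_bigr => j _.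
  rewrite /bump /= add1n mulrCA zpow_shift//; congr (x _ _ * _); lia.
rewrite shift mulrBr !mulr_sumr addrA -!mulrA [LHS]addrAC; congr (_ - _).
rewrite -!big_split; apply: eq_bigr => j _ /=.
by rewrite /sym_conn intrB; ring.
Qed.

End Solution.

(** * The coefficients gamma as residues *)

Section Gamma.
Import numFieldNormedType.Exports.
Local Open Scope classical_set_scope.
Variables (R : realType) (k : nat) (gamma : nat -> R).
Hypotheses (k_ge1 : (1 <= k)%N) (k4 : (4 %| k)%N).
Hypothesis gammaP : IK_expansion k (fun j => gamma (k %/ 4 + j)%N).
Hypothesis gamma_low : forall i, (i < k %/ 4)%N -> gamma i = 0.
Implicit Types (t : R).
Local Notation word := ({ffun 'I_k -> bool}).

Let m := (k %/ 4)%N.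
Let k_even : k = (k %/ 2).*2. Proof. by case/dvdnP: k4 => q ->; lia. Qed.
Let k2E : (k %/ 2 = m + m)%N. Proof. by rewrite /m; case/dvdnP: k4 => q ->; lia. Qed.
Let m_ge1 : (1 <= m)%N. Proof. by rewrite /m; case/dvdnP: k4 => q kE; lia. Qed.

Definition IKpow t : R := 2 ^+ k * (besselI0 t * besselK0 t) ^+ (k %/ 2).

(** The polynomial part in t of w^a z^b, where w = 1/z = 4/t^2. *)
Definition wpow_poly (a b : nat) : {poly R} :=
  if (a <= b)%N then (4^-1 *: 'X ^+ 2) ^+ (b - a) else 0.

Lemma wpow_polyP a b : (wpow_poly a b).[0] = (a == b)%:R /\
  vanishing (fun t => (4 / t ^+ 2) ^+ a * (t ^+ 2 / 4) ^+ b - (wpow_poly a b).[t]).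
Proof.
have inv t : 1 <= t -> 4 / t ^+ 2 = (t ^+ 2 / 4)^-1 by rewrite invf_div.
have z0 t : 1 <= t -> t ^+ 2 / 4 != 0.
  by move=> t1; rewrite mulf_neq0 ?expf_neq0// ?invr_eq0//; apply/eqP; lra.
rewrite /wpow_poly; case: leqP => ab; split.
- rewrite horner_exp hornerZ hornerXn expr0n /= mulr0 expr0n subn_eq0.
  by rewrite eqn_leq ab.
- apply: (eq_vanishing _ (vanishingM (@vanishing_inv R) (bounded_oo_cst 0)));
  apply: for_largeT => t t1.
  rewrite horner_exp hornerZ hornerXn inv// exprVn -{1}(subnKC ab) exprD mulKf ?expf_neq0
    ?z0//.
  by rewrite [4^-1 * _]mulrC subrr mulr0.
- by rewrite horner0 gtn_eqF.
- apply: (@eq_vanishing _ (fun t => t^-1 * (4 * t^-1 ^+ 1 * (4 / t ^+ 2) ^+ (a - b).-1))).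
    apply: for_largeT => t t1; rewrite horner0 subr0.
    have [d aE] : exists d, a = (b + d.+1)%N by exists (a - b).-1; lia.
    have t0 : t != 0 by apply/eqP; lra.
    have -> : t ^+ 2 / 4 = (4 / t ^+ 2)^-1 by rewrite invf_div.
    rewrite aE addKn /= (exprVn (4 / t ^+ 2)) exprD (exprS _ d) expr1.
    have : (4 / t ^+ 2) ^+ b != 0 by rewrite expf_neq0// mulf_neq0// invr_eq0 expf_neq0.
    by move: (_ ^+ b) (_ ^+ d) => u v u0; field; rewrite u0 t0.
  apply: vanishingM (@vanishing_inv R) _.
  apply: bounded_ooM; first by apply: bounded_ooM (bounded_oo_invX R 1);
    exact: bounded_oo_cst.
  apply: (@eq_bounded_oo _ (fun t => (4 ^+ (a - b).-1) * t^-1 ^+ (2 * (a - b).-1))).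
    by apply: for_largeT => t _; rewrite exprM -exprMn exprVn.
  by apply: bounded_ooM (bounded_oo_cst _) (bounded_oo_invX R _).
Qed.

Lemma vanishing_sum (I : Type) (r : seq I) (f : I -> R -> R) :
  (forall i, vanishing (f i)) -> vanishing (fun t => \sum_(i <- r) f i t).
Proof.
move=> nf; elim: r => [|i r IH].
  apply: (eq_vanishing _ (vanishingM (@vanishing_inv R) (bounded_oo_cst 0))).
  by apply: for_largeT => t _; rewrite big_nil mulr0.
apply: (eq_vanishing _ (vanishingD (nf i) IH)).
by apply: for_largeT => t _; rewrite big_cons.
Qed.

(** The constant term of 2^k (I_0 K_0)^(k/2) z^i is the coefficient of w^i. *)
Lemma IKpow_polypart i : exists B : {poly R}, B.[0] = gamma i /\
  vanishing (fun t => IKpow t * (t ^+ 2 / 4) ^+ i - B.[t]).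
Proof.
exists (\sum_(j < i.+1) gamma (m + j)%N *: wpow_poly (m + j) i); split.
  rewrite horner_sum.
  under eq_bigr => j _ do rewrite hornerZ (wpow_polyP _ _).1.
  case: (leqP m i) => mi.
    have ji : (i - m < i.+1)%N by lia.
    rewrite (bigD1 (Ordinal ji)) //= subnKC// eqxx mulr1 big1 ?addr0// => j jne.
    rewrite (_ : _ == _ = false) ?mulr0//; apply: contraNF jne => /eqP e.
    by apply/eqP/val_inj => /=; lia.
  by rewrite gamma_low// big1// => j _; rewrite gtn_eqF ?mulr0//; lia.
have /vanishingP := gammaP i; rewrite -/m -/(IKpow _) => nI.
have nw : bounded_oo (fun t => (4 / t ^+ 2) ^+ m).
  apply: (@eq_bounded_oo _ (fun t => (4 ^+ m) * t^-1 ^+ (2 * m))).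
    by apply: for_largeT => t _; rewrite exprM -exprMn exprVn.
  by apply: bounded_ooM (bounded_oo_cst _) (bounded_oo_invX R _).
have nS : vanishing (fun t => \sum_(j < i.+1) (gamma (m + j)%N *
    ((4 / t ^+ 2) ^+ (m + j) * (t ^+ 2 / 4) ^+ i - (wpow_poly (m + j) i).[t]))).
  apply: vanishing_sum => j; have [_ nj] := wpow_polyP (m + j) i.
  apply: (eq_vanishing _ (vanishingM nj (bounded_oo_cst (gamma (m + j)%N)))).
  by apply: for_largeT => t _; rewrite mulrC.
apply: (eq_vanishing _ (vanishingD (vanishingM nI nw) nS)); apply: for_largeT => t t1.
rewrite horner_sum.
have t0 : t != 0 by apply/eqP; lra.
have inv : t ^+ 2 / 4 = (4 / t ^+ 2)^-1 by rewrite invf_div.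
have w0 : 4 / t ^+ 2 != 0 by rewrite mulf_neq0// invr_eq0 expf_neq0.
rewrite inv; move: (4 / t ^+ 2) w0 => w w0.
under [X in _ + X]eq_bigr => j _ do rewrite mulrBr.
under [X in _ = _ - X]eq_bigr => j _ do rewrite hornerZ.
rewrite sumrB addrA; congr (_ - _).
rewrite [X in _ + X](_ : _ = w ^+ m * (\sum_(j < i.+1) gamma (m
  + j)%N * w ^+ j) * w^-1 ^+ i).
  rewrite exprD exprVn; move: (\sum_(j < _) _) => S.
  by rewrite /IKpow; move: (2 ^+ k * _) => I; field; rewrite !expf_neq0.
by rewrite mulr_sumr mulr_suml; apply: eq_bigr => j _; rewrite exprD; ring.
Qed.

(** w^(-k/4) 2^k (I_0 K_0)^(k/2) is the power k/2 of 2 / (p - r), which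
    tends to 1. *)
Lemma gamma_lead : gamma m = 1.
Proof.
have /vanishingP := gammaP 0; rewrite -/m -/(IKpow _) => nI.
pose h t := 2 * (I0_log t - K0_log t)^-1.
have nh : vanishing (fun t => h t - 1).
  have nb : bounded_oo (fun t => (I0_log t - K0_log t)^-1).
    by apply: (@bounded_oo_recip _ _ 2) => //; exact: vanishing_log_diff.
  apply: (eq_vanishing _ (vanishingM (@vanishing_log_diff R)
    (bounded_ooM (bounded_oo_cst (-1)) nb))).
  have := @vanishing_log_diff R 1 ltr01; apply: for_largeS => t _ D1.
  have D0 : I0_log t - K0_log t != 0.
    by apply: contraTneq D1 => ->; rewrite sub0r normrN normr_nat -ltNge ltr1n.
  by rewrite /h; field.
have nhX n : vanishing (fun t => h t ^+ n - 1).
  elim: n => [|n IH].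
    apply: (eq_vanishing _ (vanishingM (@vanishing_inv R) (bounded_oo_cst 0)));
      apply: for_largeT => t _.
    by rewrite mulr0 subrr.
  have bX : bounded_oo (fun t => h t ^+ n).
    apply: (eq_bounded_oo _ (bounded_ooD (vanishing_bounded IH) (bounded_oo_cst 1))).
    by apply: for_largeT => t _; rewrite subrK.
  by apply: (eq_vanishing _ (vanishingD (vanishingM nh bX) IH));
    apply: for_largeT => t _; rewrite exprS; ring.
have : vanishing (fun=> gamma m - 1).
  apply: (eq_vanishing _ (vanishingD (nhX (2 * m)%N)
    (vanishingM nI (bounded_oo_cst (-1))))).
  apply: for_largeT => t t1; have t0 : t != 0 by apply/eqP; lra.
  have w0 : 4 / t ^+ 2 != 0 by rewrite mulf_neq0// invr_eq0 expf_neq0.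
  have IE : IKpow t = (4 / t ^+ 2) ^+ m * h t ^+ (2 * m).
    rewrite /IKpow (I0K0E t1) k2E addnn -mul2n.
    have kE : k = (4 * m)%N by rewrite /m mulnC divnK.
    rewrite [in 2 ^+ _]kE ![_ ^+ (_ * m)]exprM -!exprMn; congr (_ ^+ _).
    by rewrite /h; move: ((_ - _)^-1) => D; field.
  rewrite big_ord1 -/(IKpow t) IE !addn0 expr0 mulr1.
  have := expf_neq0 m w0; move: (_ ^+ m) (h t ^+ _) => u v u0.
  by field.
by move/vanishing_cst/eqP; rewrite subr_eq0 => /eqP.
Qed.

Lemma expandable_bprod_scaled (e : word) : expandable (fun t => bprod e t / t ^+ k).
Proof.
have [h eh he] := expandable_bprod R k_even e; apply: (eq_expandable _ eh).
move: he; apply: for_largeS => t t1 ->; rewrite mulrC mulKf// expf_neq0//.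
by apply/eqP; lra.
Qed.

(** The products grow at most like t^k, while z^(-k) is of order t^(-2k). *)
Lemma vanishing_truncation_defect (x : nat -> int -> R) n0 : vanishing (truncation_defect
  k x n0).
Proof.
rewrite /truncation_defect; apply: vanishing_sum => e.
set c := _ * x _ _.
apply: (@eq_vanishing _ (fun t
  => t^-1 * (t^-1 ^+ k.-1 * (bprod e t / t ^+ k * (c * 4 ^+ k))))).
  apply: for_largeT => t t1; have t0 : t != 0 by apply/eqP; lra.
  have -> : zpow n0 (n0 + k) t = 4 ^+ k * t^-1 ^+ k * t^-1 ^+ k.
    rewrite /zpow exprD; have -> : 4 / t ^+ 2 = (t ^+ 2 / 4)^-1 by rewrite invf_div.
    rewrite mulrA (exprVn (t ^+ 2 / 4) n0) mulfV ?mul1r; last first.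
      by rewrite expf_neq0// mulf_neq0 ?expf_neq0// invr_eq0.
    by rewrite -exprMn -exprMn; congr (_ ^+ _); field.
  have e1 : t^-1 ^+ k = t^-1 * t^-1 ^+ k.-1 by rewrite -exprS prednK.
  by rewrite -exprVn e1; ring.
apply: vanishingM (@vanishing_inv R) _; apply: bounded_ooM (bounded_oo_invX R _) _;
  apply: bounded_ooM (bounded_oo_cst _).
exact: expandable_bounded_oo (expandable_bprod_scaled e).
Qed.

Lemma bessel_paired_polypart (x : nat -> int -> R) n0 :
  exists A : {poly R}, vanishing (fun t => bessel_paired k x n0 t - A.[t]).
Proof.
pose H t := \sum_(e : word) bprod e t / t ^+ k *
  \sum_(j < (n0 + k).+1) x (weight e) (n0%:Z - j%:Z) * (4^-1 ^+ n0 * (4 * t^-1 ^+ 2) ^+ j).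
have eH : expandable H.
  apply: expandable_sum => e; apply: expandableM; first exact: expandable_bprod_scaled.
  apply: expandable_sum => j; apply: expandableM; first exact: expandable_cst.
  apply: expandableM; first exact: expandable_cst.
  apply: expandableX; apply: expandableM; first exact: expandable_cst.
  by apply: expandableX; exact: expandable_inv.
have [A nA] := expandable_polypart (k + 2 * n0) eH.
exists A; apply: eq_vanishing nA; apply: for_largeT => t t1;
  have t0 : t != 0 by apply/eqP; lra.
congr (_ - _); rewrite /H /bessel_paired mulr_sumr; apply: eq_bigr => e _.
set S := \sum_(j < _) _.
transitivity (bprod e t * (t ^+ (2 * n0) * S)).
  rewrite exprD; move: S (t ^+ (2 * n0)) => S u.
  by field; rewrite expf_neq0.
congr (_ * _); rewrite /S /trunc_section mulr_sumr.
apply: eq_bigr => j _; rewrite /zpow mulrCA; congr (_ * _).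
by rewrite mulrA exprM -exprMn exprVn.
Qed.

(** The constant c that makes z^i - c z^(k/4) exact at infinity is gamma_i:
    both sides are read off from the constant term of z d/dz of the pairing with
    products of Bessel functions, which vanishes. *)
Lemma residue_eq_gamma (x : nat -> int -> R) (N : int) (c : R) i :
  (forall a n, N < n -> x a n = 0) ->
  (forall a n, (a <= k)%N -> sym_conn k x a n =
     if a == 0%N then (n == i%:Z)%:R - c * (n == m%:Z)%:R else 0) ->
  c = gamma i.
Proof.
move=> xN xE; pose n0 := (`|N| + 1 + i + m)%N.
have x_high a (n : int) : n0%:Z <= n -> x a n = 0 by move=> nn; apply: xN; lia.
have [A nA] := bessel_paired_polypart x n0.
have [Bi [Bi0 nBi]] := IKpow_polypart i; have [Bm [Bm0 nBm]] := IKpow_polypart m.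
pose B : {poly R} := 2 *: (Bi - c *: Bm).
have B0 : B.[0] = 2 * (gamma i - c) by rewrite !hornerE Bi0 Bm0 gamma_lead mulr1.
have source t : 1 <= t -> \sum_(e : word) bprod e t * (\sum_(j < (n0 + k).+1)
       sym_conn k x (weight e) (n0%:Z - j%:Z) * zpow n0 j t)
   = (besselI0 t * besselK0 t) ^+ (k %/ 2) * ((t ^+ 2 / 4) ^+ i - c * (t ^+ 2 / 4) ^+ m).
  move=> t1; have t0 : t != 0 by apply/eqP; lra.
  rewrite (bigD1 [ffun=> false]) //= [X in _ + X]big1 ?addr0 => [|e e0]; last first.
    rewrite big1 ?mulr0// => j _; rewrite xE ?weight_le// ifF ?mul0r//.
    apply: contraNF e0; rewrite /weight sum_nat_eq0 => /forallP e0.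
    by apply/eqP/ffunP => l; rewrite ffunE; have := e0 l; case: (e l).
  rewrite bprod_false//; congr (_ * _).
  have w0 : weight ([ffun=> false] : word) = 0%N.
    by rewrite /weight big1// => l _; rewrite ffunE.
  have zE l : (l <= n0)%N -> \sum_(j < (n0 + k).+1) (n0%:Z - j%:Z == l%:Z)%:R * zpow n0 j t
      = (t ^+ 2 / 4) ^+ l.
    move=> ln; have jl : (n0 - l < (n0 + k).+1)%N by lia.
    rewrite (bigD1 (Ordinal jl)) //= big1 ?addr0 => [|j jne]; last first.
      rewrite (_ : _ == _ = false) ?mul0r//; apply: contraNF jne => /eqP e.
      by apply/eqP/val_inj => /=; lia.
    have -> : (n0%:Z - (n0 - l)%N%:Z == l%:Z) by apply/eqP; lia.
    rewrite mul1r /zpow -[X in _ ^+ X * _](subnK ln) exprD.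
    have -> : 4 / t ^+ 2 = (t ^+ 2 / 4)^-1 by rewrite invf_div.
    by rewrite exprVn mulrAC divff ?mul1r// expf_neq0// mulf_neq0 ?expf_neq0// invr_eq0.
  rewrite w0 -(zE i) ?leq_addr -?(zE m); [|rewrite /n0; lia..].
  rewrite mulr_sumr -sumrB; apply: eq_bigr => j _; rewrite xE//=; ring.
have : B.[0] = 0.
  apply: (@no_constant_term R (fun t => 2 ^+ k * bessel_paired k x n0 t)
    (fun t => 2 ^+ k * (2 / t * (\sum_(e : word) bprod e t * (\sum_(j < (n0 + k).+1)
       sym_conn k x (weight e) (n0%:Z - j%:Z) * zpow n0 j t) - truncation_defect k x n0 t)))
    (2 ^+ k *: A) B).
  - apply: for_largeT => t t1; have t0 : 0 < t by lra.
    have d := @is_derive_bessel_paired R k x n0 x_high t t0; apply: is_derive_eq.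
    by rewrite /GRing.scale /=.
  - apply: (eq_vanishing _ (vanishingM nA (bounded_oo_cst (2 ^+ k))));
    apply: for_largeT => t _.
    by rewrite hornerZ; ring.
  - have nC := vanishingD (vanishingM nBi (bounded_oo_cst 2))
    (vanishingM nBm (bounded_oo_cst (- 2 * c))).
    apply: (eq_vanishing _ (vanishingD nC (vanishingM (vanishing_truncation_defect x n0)
      (bounded_oo_cst (- 2 * 2 ^+ k))))).
    apply: for_largeT => t t1; have t0 : t != 0 by apply/eqP; lra.
    rewrite source// /B hornerZ hornerD hornerN hornerZ /IKpow.
    move: (truncation_defect _ _ _ _) (_ ^+ (k %/ 2)) (_ ^+ i) (_ ^+ m) => b I zi zm.
    by field.
rewrite B0 => /eqP; rewrite mulf_eq0 pnatr_eq0 /= subr_eq0 => /eqP ->.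
by [].
Qed.

End Gamma.

(** * The intersection matrix *)

Lemma dfact_odd l : dfact l.*2.+1 = (\prod_(i < l.+1) i.*2.+1)%N.
Proof.
elim: l => [|l IH]; first by rewrite big_ord1.
by rewrite big_ord_recr /= -IH mulnC.
Qed.

Lemma fact_dfact l : ((l.*2.+1)`! = dfact l.*2.+1 * (2 ^ l * l`!))%N.
Proof.
elim: l => [//|l IH].
have dfactS : dfact l.*2.+3 = (l.*2.+3 * dfact l.*2.+1)%N by [].
rewrite doubleS factS factS IH dfactS expnS factS.
have -> : l.*2.+2 = (2 * l.+1)%N by lia.
ring.
Qed.

Section Final.
Variables (R : realType) (k : nat) (gamma : nat -> R).
Hypotheses (k_ge1 : (1 <= k)%N) (gammaP : is_gamma k gamma).
Local Notation C := (R[i]).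

Lemma gamma_below i : (4 * i < k)%N -> gamma i = 0.
Proof.
by move: gammaP; rewrite /is_gamma; case: ifP => [k4 [_ g] ik|_ g _]; apply: g; lia.
Qed.

Lemma sym_conn_real_complex (x : nat -> int -> R) a n :
  sym_conn k (fun a n => (x a n)%:C%C : C) a n = (sym_conn k x a n)%:C%C.
Proof. by rewrite /sym_conn !rmorphD !rmorphM rmorphB !rmorph_nat rmorph_int. Qed.

(** The coefficients of the solution at infinity are taken in R, where the
    constant can be compared with gamma_i. *)
Lemma lift_oo_exists i :
  exists x N, solves k x (omega_coef k gamma i) /\ supp_le N x.
Proof.
have [|x [N [c [xN xE]]]] := @solve_oo R k (fun n => (n == i%:Z)%:R) i%:Z.
  by move=> n ni; rewrite gt_eqF.
have cE : c * (4 %| k)%:R = gamma i.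
  move: gammaP; rewrite /is_gamma; case: ifP => k4 gP; last by rewrite gP mulr0.
  rewrite mulr1; case: gP => IK g_low; apply: (residue_eq_gamma k_ge1 k4 IK g_low xN).
  by move=> a n ak; rewrite xE// k4.
exists (fun a n => (x a n)%:C%C), N; split => [a n ak|a n /xN ->//].
rewrite sym_conn_real_complex xE// /omega_coef; case: eqP => // _.
by rewrite rmorphB rmorphM /= -cE rmorphM !rmorph_nat -mulrA -natrM mulnb.
Qed.

Lemma mid_lift_exists i : in_idx k i -> exists x0 xoo, mid_lift k gamma i x0 xoo.
Proof.
move=> ik; have [xoo [N [soo hoo]]] := lift_oo_exists i.
have [n n0|x0 l0 s0] := @solve_0 C k (omega_coef k gamma i).
  move: ik; rewrite /in_idx /omega_coef => /andP[i1 _].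
  rewrite (lt_eqF (le_lt_trans n0 _)) ?sub0r//.
  have [k40|k40] := eqVneq (k %/ 4)%N 0%N.
    suff -> : gamma i = 0 by rewrite mul0r oppr0.
    move: gammaP; rewrite /is_gamma ifF; first exact.
    by apply/negP => /dvdnP[q kq]; move: k40; rewrite kq mulnK//; lia.
  by rewrite (_ : n == _ = false) ?mulr0 ?oppr0//; apply/eqP; lia.
by exists x0, xoo; split => //; [exists 1|exists N] => // a n n1; apply: l0; lia.
Qed.

Lemma S_mid_direct i j : in_idx k i -> in_idx k j ->
  odd k || (4 * j < k)%N -> (i + j <= uphalf k)%N ->
  S_mid k gamma i j = - (k`!)%:R / lead_oo C k i%:Z * ((i + j)%N == uphalf k)%:R.
Proof.
move=> ik jk kj ij; apply: dR_mid_pairing_eval (mid_lift_exists ik) (mid_lift_exists jk) _.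
move=> x0 xoo li; apply: (mid_lift_value li _ _ kj _ ij); last by case/andP: jk.
- case/orP: kj => [ok|]; last exact: gamma_below.
  by move: gammaP; rewrite /is_gamma ifF//; apply: contraTF ok => /dvdnP[q ->]; lia.
- case/orP: kj => [ok|->]; last by right.
  by left; move: gammaP; rewrite /is_gamma ifF//; apply: contraTF ok => /dvdnP[q ->]; lia.
Qed.

(** For k even this is antisymmetry, for k odd symmetry. *)
Lemma S_mid_skew i j : in_idx k i -> in_idx k j ->
  S_mid k gamma i j = - (-1) ^+ k * S_mid k gamma j i.
Proof.
move=> ik jk; have [y0 [yoo lj]] := mid_lift_exists jk.
have [x0 [xoo li]] := mid_lift_exists ik.
have -> : S_mid k gamma j i
    = spair k y0 (omega_sec k gamma i) - spair k yoo (omega_sec k gamma i).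
  apply: dR_mid_pairing_eval; [exact: mid_lift_exists|exact: mid_lift_exists|].
  by move=> z0 zoo lz; rewrite (spair_skew lz li) -(spair_skew lj li).
apply: dR_mid_pairing_eval; [exact: mid_lift_exists|exact: mid_lift_exists|].
by move=> z0 zoo lz; rewrite (spair_skew lz lj).
Qed.

(** For 4 j > k the roles of i and j are exchanged.  The factor i - K/2 of
    [lead_oo] is then odd under the exchange, because i + j = K on the
    anti-diagonal. *)
Lemma S_mid_value i j : in_idx k i -> in_idx k j -> (i + j <= uphalf k)%N ->
  S_mid k gamma i j = - (k`!)%:R / lead_oo C k i%:Z * ((i + j)%N == uphalf k)%:R.
Proof.
move=> ik jk ij; have [kj|] := boolP (odd k || (4 * j < k)%N).
  exact: S_mid_direct.
rewrite negb_or => /andP[ek jk4].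
have ik4 : (4 * i < k)%N.
  move: ik jk; rewrite /in_idx => /and3P[_ _ i4] /and3P[_ _ j4].
  have [e4|ne4] := eqVneq (4 * j)%N k.
    by move: j4; rewrite -e4 dvdn_mulr// mulKn// eqxx.
  by have := uphalf_half k; lia.
rewrite S_mid_skew// S_mid_direct//; [|by rewrite ik4 orbT|by rewrite addnC].
rewrite (addnC j); case: eqP => [ijk|]; last by rewrite !mulr0.
rewrite -signr_odd (negbTE ek) expr0 !mulr1 /lead_oo (negbTE ek).
have -> : j%:Z%:~R - (uphalf k)%:R / 2 = - (i%:Z%:~R - (uphalf k)%:R / 2) :> C.
  by rewrite -ijk natrD; field.
by rewrite mulrN invrN mulN1r mulrN opprK.
Qed.

End Final.

Theorem theorem3p19 (R : realType) (k : nat) (k_ge1 : (1 <= k)%N)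
    (gamma : nat -> R) (gammaP : is_gamma k gamma) :
  (forall i j : nat, in_idx k i -> in_idx k j -> (i + j <= kprime k)%N ->
     S_mid k gamma i j = 0)
  /\
  (forall i j : nat, in_idx k i -> in_idx k j -> (i + j = kprime k + 1)%N ->
     S_mid k gamma i j =
       if odd k then
         (-2) ^+ kprime k * ((kprime k)`!)%:R / (dfact k)%:R
       else
         (-1) ^+ (kprime k + 1)
           / (2 ^+ kprime k * ((kprime k + 1)%:R - 2 * i%:R))
         * ((dfact (k - 1))%:R / ((kprime k + 1)`!)%:R)).
Proof.
have k'E : (kprime k).+1 = uphalf k by rewrite /kprime; lia.
split=> i j ik jk ij; rewrite (S_mid_value k_ge1 gammaP)//; try lia.
  by rewrite ltn_eqF ?mulr0//; lia.
have -> : ((i + j)%N == uphalf k) by apply/eqP; lia.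
rewrite mulr1 /lead_oo -k'E addn1; move: (kprime k) k'E => l k'E.
case: ifPn => ok.
  have kE : k = l.*2.+1 by lia.
  rewrite -natr_prod -dfact_odd -kE {1}kE fact_dfact -kE !natrM natrX.
  have d0 : (dfact k)%:R != 0 :> R[i].
    by rewrite pnatr_eq0 kE dfact_odd -lt0n prodn_gt0.
  rewrite -[in RHS]mulN1r exprMn invfM invr_sign exprS.
  by field.
have kE : k = l.+1.*2 by lia.
have -> : (k - 1 = l.*2.+1)%N by lia.
rewrite {1}kE doubleS factS fact_dfact -doubleS -muln2 (factS l) !natrM !natrX.
have d0 : l.+1%:R - 2 * i%:R != 0 :> R[i].
  rewrite -natrM subr_eq0 eqr_nat; apply/eqP => l2i.
  move: ik; rewrite /in_idx => /and3P[_ _ /negP[]].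
  by rewrite (_ : k = 4 * i)%N ?dvdn_mulr ?mulKn ?eqxx//; lia.
rewrite !invfM !invr_sign !exprS.
have -> : 4 = 2 * 2 :> R[i] by rewrite -natrM.
rewrite exprMn; field.
rewrite fact_neq0 nat1r d0 expf_neq0 ?pnatr_eq0//=.
by rewrite -oppr_eq0 opprB [_ * 2]mulrC d0.
Qed.
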